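(* Let $\Omega$ be a domain in $\mathbb{C}$, let $K$ be a nonempty removable set in $\Omega$, and let $D=\Omega\setminus K$. Assume that $D$ is $c$-hyperbolic. Then for every $z\in D$, $$i_{D}^{c}(z)\le H_{D}^{c}(z)\le \min_{w\in K}\tanh\left[c_{\Omega}(z,w)\right].$$
   Context: Let $\mathbb{D}=\{\xi\in\mathbb{C}:|\xi|<1\}$. A compact set $K\subset\mathbb{C}$ is called removable (for bounded holomorphic functions) if for every open set $U\supseteq K$ in $\mathbb{C}$, each bounded holomorphic function on $U\setminus K$ extends holomorphically to all of $U$. A removable set in a domain $G$ is a removable compact set contained in $G$. The Carathéodory pseudodistance on a domain $G\subseteq\mathbb{C}$ is $$c_G(\xi_1,\xi_2)=\sup\{\tanh^{-1}|\alpha| : f:G\to\mathbb{D}\text{ holomorphic},\ f(\xi_1)=0,\ f(\xi_2)=\alpha\}.$$ $G$ is $c$-hyperbolic if $c_G$ is a distance. For $z\in G$ and $r>0$ put $B_G^c(z,r)=\{\xi\in G: c_G(z,\xi)<r\}$. For a $c$-hyperbolic domain $G\subseteq\mathbb{C}$ and $z\in G$: the (modified) Fridman invariant with respect to the Carathéodory metric is $$H_G^c(z)=\sup\{\tanh r : r>0,\ B_G^c(z,r)\subseteq f(\mathbb{D})\text{ for some injective holomorphic } f:\mathbb{D}\to G\};$$ the injectivity radius function with respect to the Carathéodory metric is $$i_G^c(z)=\sup\{\tanh r : r>0,\ B_G^c(z,r)\text{ is simply connected}\}$$ (simply connected includes connected). *)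

(* Defs.v *)
From HB Require Import structures.
From mathcomp Require Import all_boot all_order all_algebra.
From mathcomp Require Import complex.
From mathcomp Require Import all_classical all_reals all_analysis.
From mathcomp Require Import ring lra.

Set Implicit Arguments.
Unset Strict Implicit.
Unset Printing Implicit Defensive.

Import Order.TTheory GRing.Theory Num.Theory numFieldNormedType.Exports.

Local Open Scope classical_set_scope.
Local Open Scope complex_scope.
Local Open Scope ring_scope.

(* MathComp-Analysis equips abstract number fields (and R[i]^o) with their
   norm topology, but not the concrete type R[i]; these instances make the
   topology and the normed space structure of R[i]^o available on R[i]. *)
HB.instance Definition _ (R : realType) := PseudoPointedMetric.copy R[i] R[i]^o.
HB.instance Definition _ (R : realType) := GRing.ComAlgebra.copy R[i] R[i]^o.
HB.instance Definition _ (R : realType) := Vector.copy R[i] R[i]^o.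
HB.instance Definition _ (R : realType) := NormedModule.copy R[i] R[i]^o.

Section hyperbolic_functions.
Variable R : realType.

Definition tanh (x : R) : R :=
  (expR x - expR (- x)) / (expR x + expR (- x)).

Definition atanh (x : R) : R := ln ((1 + x) / (1 - x)) / 2.

Lemma atanhK (x : R) : `|x| < 1 -> tanh (atanh x) = x.
Proof.
rewrite ltr_norml => /andP[x1 x2].
have p1 : 0 < 1 + x by lra.
have p2 : 0 < 1 - x by lra.
have u_gt0 : 0 < expR (atanh x) := expR_gt0 _.
have u2 : expR (atanh x) ^+ 2 = (1 + x) / (1 - x).
  rewrite expr2 -expRD -[RHS]lnK ?posrE ?divr_gt0//; congr expR.
  by rewrite /atanh -splitr.
rewrite /tanh expRN; move: (expR (atanh x)) u_gt0 u2 => u u_gt0 u2.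
have u0 : u != 0 by rewrite gt_eqF.
have u21 : u ^+ 2 + 1 != 0 by rewrite gt_eqF// addr_gt0// exprn_gt0.
have -> : (u - u^-1) / (u + u^-1) = (u ^+ 2 - 1) / (u ^+ 2 + 1).
  by field; rewrite u0 u21.
apply: (mulIf u21); rewrite mulfVK //.
have p2' : 1 - x != 0 by rewrite gt_eqF.
by rewrite u2; field.
Qed.

(* Continuous extension of [tanh] to the extended real line. *)
Definition etanh (x : \bar R) : \bar R :=
  match x with
  | r%:E => (tanh r)%:E
  | +oo%E => 1%E
  | -oo%E => (-1)%E
  end.

End hyperbolic_functions.

Section planar_domains.
Variable R : realType.
Local Notation C := R[i].

Definition domain (G : set C) : Prop := [/\ open G, connected G & G !=set0].

Definition unit_disc : set C := [set z | `|z| < 1].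

(* A function on a subset of C is represented by a total function C -> C whose
   values outside the subset are irrelevant; on an open set, [derivable f z 1]
   is complex differentiability of f at z. *)
Definition holomorphic_on (U : set C) (f : C -> C) : Prop :=
  forall z, U z -> derivable f z 1.

Definition removable (K : set C) : Prop :=
  compact K /\
  forall U : set C, open U -> K `<=` U ->
  forall f : C -> C,
    holomorphic_on (U `\` K) f -> [bounded f z | z in U `\` K] ->
    exists2 g : C -> C, holomorphic_on U g & {in U `\` K, g =1 f}.

(* [`|a|] lives in R[i], while [Normc.normc a] is the modulus as an element
   of R. *)
Definition caratheodory (G : set C) (z w : C) : \bar R :=
  ereal_sup [set (atanh (Normc.normc (f w)))%:E | f in
    [set f : C -> C | [/\ holomorphic_on G f, f @` G `<=` unit_disc & f z = 0]]].

Definition is_distance_on (G : set C) (d : C -> C -> \bar R) : Prop :=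
  [/\ forall x y, G x -> G y -> d x y \is a fin_num /\ (0 <= d x y)%E,
      forall x y, G x -> G y -> (d x y = 0%E <-> x = y),
      forall x y, G x -> G y -> d x y = d y x &
      forall x y z, G x -> G y -> G z -> (d x z <= d x y + d y z)%E].

Definition c_hyperbolic (G : set C) : Prop := is_distance_on G (caratheodory G).

Definition caratheodory_ball (G : set C) (z : C) (r : R) : set C :=
  [set w | G w /\ (caratheodory G z w < r%:E)%E].

Definition path_connected (A : set C) : Prop :=
  forall x y, A x -> A y ->
  exists p : R -> C, [/\ {within `[0, 1], continuous p},
    p @` `[0, 1] `<=` A, p 0 = x & p 1 = y].

(* Every loop in A contracts to its base point inside A, through loops with the
   same base point; [h (s, t)] is the point at time t of the s-th loop. *)
Definition null_homotopic_loops (A : set C) : Prop :=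
  forall p : R -> C,
    {within `[0, 1], continuous p} -> p @` `[0, 1] `<=` A -> p 0 = p 1 ->
  exists h : R * R -> C, [/\ {within `[0, 1] `*` `[0, 1], continuous h},
    h @` (`[0, 1] `*` `[0, 1]) `<=` A,
    {in `[0, 1], forall t, h (0, t) = p t},
    {in `[0, 1], forall t, h (1, t) = p 0} &
    {in `[0, 1], forall s, h (s, 0) = p 0 /\ h (s, 1) = p 0}].

Definition simply_connected (A : set C) : Prop :=
  path_connected A /\ null_homotopic_loops A.

Definition fridman_invariant (G : set C) (z : C) : \bar R :=
  ereal_sup [set (tanh r)%:E | r in [set r : R | 0 < r /\
    exists f : C -> C, [/\ holomorphic_on unit_disc f, set_inj unit_disc f,
      f @` unit_disc `<=` G & caratheodory_ball G z r `<=` f @` unit_disc]]].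

Definition injectivity_radius (G : set C) (z : C) : \bar R :=
  ereal_sup [set (tanh r)%:E | r in [set r : R | 0 < r /\
    simply_connected (caratheodory_ball G z r)]].

End planar_domains.

(* Main.v *)
(* First inequality: a simply connected Caratheodory ball of the domain D is open and
   omits K, so by the Riemann mapping theorem it is itself the image of an injective
   holomorphic map of the unit disc.

   Second inequality: bounded holomorphic functions on D extend to Omega, so c_D = c_Omega
   on D and, if c_Omega(z, w) < r with w in K, the ball of center z and radius r in D
   contains U \ K for a neighborhood U of w. If this ball lay in the image V of an
   injective holomorphic map of the disc into D, a branch of sqrt(zeta - w) would exist
   on V, hence on U \ K. Now K is totally disconnected: otherwise two points a, b of K
   are joined in K by chains of arbitrarily small step, so that a branch of
   sqrt((zeta - a) / (zeta - b)) exists off K, and it omits an open set. So removability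
   applies to a small relatively clopen part of K around w, and sqrt(zeta - w) would
   extend holomorphically to w, which is absurd. The minimum over K is attained because
   c_Omega(z, .) is lower semicontinuous.

   The function theory rests on the maximum principle: Goursat's theorem gives primitives
   of difference quotients, whose periodicity along circles is the mean value property.
   Applied to first and second divided differences, the maximum principle gives uniform
   Lipschitz bounds; these pass to pointwise limits along an ultrafilter, whence the
   theorems of Montel and Hurwitz. *)
Require Import Defs.
From mathcomp Require Import all_boot all_order all_algebra.
From mathcomp Require Import complex.
From mathcomp Require Import all_classical all_reals all_analysis.
From mathcomp Require Import ring lra.

Set Implicit Arguments.
Unset Strict Implicit.
Unset Printing Implicit Defensive.

Import Order.TTheory GRing.Theory Num.Theory.
Import numFieldNormedType.Exports.

Local Open Scope classical_set_scope.
Local Open Scope complex_scope.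
Local Open Scope ring_scope.

Local Notation Re := complex.Re.
Local Notation Im := complex.Im.

(** * The modulus as a real number *)

Section complex_modulus.
Variable R : realType.
Local Notation C := R[i].
Implicit Types (x y z : C).

(** Removability concerns functions on neighborhoods of all of [K], while a root of [z - w] is at
    hand only near [w]. It must therefore be continued by another function, here 0, near the rest of
    [K]; this is why [K] has to be split into a small part around [w] and a remainder at positive
    distance. Square roots suffice throughout, without logarithms or winding numbers. They are
    always continued in the same way: multiply by the principal root of a ratio of successive
    values, which lies in the right half-plane when the step is short. The steps run along rays of a
    square for homotopies, along segments, or along a chain of points of [K]. A root [s] of
    [(z - a) / (z - b)] may be unbounded near [b], so removability is applied to [1 / (s + s p)]
    instead, and the contradiction is algebraic, at the point [a]. As [w] is not in the domain D,
    distances are compared through competitors: their extensions satisfy the bound at [w], and the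
    uniform Lipschitz estimate carries it to the points of D near [w]. *)

Definition nm (z : C) : R := Normc.normc z.

Lemma normcE_nm z : `|z| = (nm z)%:C.
Proof. by rewrite normc_def; case: z. Qed.

Lemma nm_ge0 z : 0 <= nm z.
Proof. by case: z => a b; exact: sqrtr_ge0. Qed.

Lemma nm0 : nm 0 = 0. Proof. exact: Normc.normc0. Qed.

Lemma nm1 : nm 1 = 1. Proof. exact: Normc.normc1. Qed.

Lemma nm0_eq0 z : nm z = 0 -> z = 0. Proof. exact: Normc.eq0_normc. Qed.

Lemma nm_eq0 z : (nm z == 0) = (z == 0).
Proof. by apply/eqP/eqP => [/nm0_eq0|->]; rewrite ?nm0. Qed.

Lemma nm_gt0 z : (0 < nm z) = (z != 0).
Proof. by rewrite lt_def nm_ge0 nm_eq0 andbT. Qed.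

Lemma nmM x y : nm (x * y) = nm x * nm y. Proof. exact: Normc.normcM. Qed.

Lemma nmV x : nm x^-1 = (nm x)^-1. Proof. exact: Normc.normcV. Qed.

Lemma nmf x y : nm (x / y) = nm x / nm y. Proof. by rewrite nmM nmV. Qed.

Lemma nmX x n : nm (x ^+ n) = nm x ^+ n.
Proof. by elim: n => [|n IH]; rewrite ?expr0 ?nm1// !exprS nmM IH. Qed.

Lemma nmN x : nm (- x) = nm x. Proof. exact: normcN. Qed.

Lemma nmD x y : nm (x + y) <= nm x + nm y. Proof. exact: le_normcD. Qed.

Lemma nmB x y : nm (x - y) <= nm x + nm y.
Proof. by rewrite -(nmN y) nmD. Qed.

Lemma nm_distC x y : nm (x - y) = nm (y - x).
Proof. by rewrite -opprB nmN. Qed.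

Lemma nm_distD z x y : nm (x - y) <= nm (x - z) + nm (z - y).
Proof. by have := nmD (x - z) (z - y); rewrite subrKA. Qed.

Lemma nm_lerB x y : nm x - nm y <= nm (x - y).
Proof. by rewrite lerBlDr; have := nmD (x - y) y; rewrite subrK. Qed.

Lemma nm_real (a : R) : nm a%:C = `|a|.
Proof. by rewrite /nm /= expr0n /= addr0 sqrtr_sqr. Qed.

Lemma nm_Re z : `|Re z| <= nm z.
Proof.
case: z => a b; rewrite /nm /= -sqrtr_sqr ler_wsqrtr// lerDl.
exact: sqr_ge0.
Qed.

Lemma nm_Im z : `|Im z| <= nm z.
Proof.
case: z => a b; rewrite /nm /= -sqrtr_sqr ler_wsqrtr// lerDr.
exact: sqr_ge0.
Qed.

Lemma nm_ReIm z : nm z <= `|Re z| + `|Im z|.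
Proof.
have -> : z = (Re z)%:C + 'i * (Im z)%:C.
  by case: z => a b; simpc.
apply: le_trans (nmD _ _) _; rewrite nmM !nm_real.
have -> : nm 'i = 1 by rewrite /nm /= expr0n /= add0r expr1n sqrtr1.
by rewrite mul1r; case: z => a b; simpc.
Qed.

Lemma Re_conjM z : Re (z^*%C * z) = nm z ^+ 2.
Proof.
case: z => a b; rewrite /nm /= sqr_sqrtr ?addr_ge0 ?sqr_ge0// !expr2.
by rewrite mulNr opprK.
Qed.

Lemma nm_conj z : nm z^*%C = nm z.
Proof. by case: z => a b; rewrite /nm /= sqrrN. Qed.

Lemma Re_le z : Re z <= nm z.
Proof. exact: le_trans (ler_norm _) (nm_Re z). Qed.

Lemma ReD x y : Re (x + y) = Re x + Re y.
Proof. by case: x y => [? ?] [? ?]. Qed.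

Lemma ReB x y : Re (x - y) = Re x - Re y.
Proof. by case: x y => [? ?] [? ?]. Qed.

Lemma ImB x y : Im (x - y) = Im x - Im y.
Proof. by case: x y => [? ?] [? ?]. Qed.

Lemma ReZ (a : R) x : Re (a%:C * x) = a * Re x.
Proof. by case: x => ? ?; rewrite /= mul0r subr0. Qed.

Lemma ImZ (a : R) x : Im (a%:C * x) = a * Im x.
Proof. by case: x => ? ?; rewrite /= mul0r addr0. Qed.

Lemma rc0 : (0 : R)%:C = 0 :> C. Proof. by []. Qed.

Lemma rc1 : (1 : R)%:C = 1 :> C. Proof. by []. Qed.

Lemma rcB (a b : R) : (a - b)%:C = a%:C - b%:C :> C.
Proof. by apply/eqP; rewrite eq_complex /= subr0 !eqxx. Qed.

Lemma rcD (a b : R) : (a + b)%:C = a%:C + b%:C :> C.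
Proof. by apply/eqP; rewrite eq_complex /= addr0 !eqxx. Qed.

Lemma rcN (a : R) : (- a)%:C = - a%:C :> C.
Proof. by apply/eqP; rewrite eq_complex /= oppr0 !eqxx. Qed.

Lemma rcM (a b : R) : (a * b)%:C = a%:C * b%:C :> C.
Proof. by apply/eqP; rewrite eq_complex /= !mulr0 !mul0r subr0 addr0 !eqxx. Qed.

Lemma rcV (a : R) : (a^-1)%:C = a%:C^-1 :> C.
Proof.
have [->|a0] := eqVneq a 0; first by rewrite invr0 rc0 invr0.
have a0' : a%:C != 0 :> C.
  by apply: contra a0 => /eqP[->].
by apply: (mulfI a0'); rewrite -rcM !mulfV.
Qed.

End complex_modulus.

(* [{for t, continuous f}] head-normalizes to a product, which sends [done] into
   unification over the instances of R[i]; the inductive wrapper blocks that. *)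
Variant cont_at (R : realType) (T : topologicalType) (f : T -> R[i]) (t : T) : Prop :=
  ContAt of {for t, continuous f}.

Lemma cont_atP (R : realType) (T : topologicalType) (f : T -> R[i]) (t : T) :
  cont_at f t <-> {for t, continuous f}.
Proof. by split => [[]|]; [exact|exact: ContAt]. Qed.

(** * Epsilon-delta forms of limits, continuity and complex differentiability *)

Section epsilon_delta.
Variable R : realType.
Local Notation C := R[i].

Lemma cvg_nmP (T : Type) (F : set_system T) (FF : Filter F) (f : T -> C) (l : C) :
  f x @[x --> F] --> l <-> forall e : R, 0 < e -> \forall x \near F, nm (f x - l) < e.
Proof.
split=> [/cvgrPdist_lt fl e e0|fl].
  have e0' : (0 : C) < e%:C by rewrite ltcR.
  have := fl _ e0'; apply: filterS => x; rewrite normcE_nm ltcR nm_distC //.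
apply/cvgrPdist_lt => e e0.
have eE : e = (Re e)%:C by case: e e0 => a b; rewrite ltcE /= => /andP[/eqP -> _].
have Re0 : 0 < Re e by rewrite eE ltcR in e0.
have := fl _ Re0; apply: filterS => x; rewrite eE normcE_nm ltcR nm_distC //.
Qed.

Lemma nbhs_nmP (z : C) (A : set C) :
  nbhs z A <-> exists2 d : R, 0 < d & forall w, nm (w - z) < d -> A w.
Proof.
split=> [/nbhs_ballP[e /= e0 ezA]|[d d0 dA]].
  have eE : e = (Re e)%:C.
    by case: e e0 {ezA} => a b; rewrite ltcE /= => /andP[/eqP -> _].
  exists (Re e); first by rewrite eE ltcR in e0.
  move=> w wz; apply: ezA; rewrite -ball_normE /ball_ /= normcE_nm eE ltcR.
  by rewrite nm_distC.
apply/nbhs_ballP; exists d%:C => /=; first by rewrite ltcR.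
move=> w; rewrite -ball_normE /ball_ /= normcE_nm ltcR nm_distC.
exact: dA.
Qed.

Lemma open_nmP (U : set C) : open U <->
  forall z, U z -> exists2 d : R, 0 < d & forall w, nm (w - z) < d -> U w.
Proof.
rewrite openE; split => [UO z /UO/nbhs_nmP//|UO z /UO ?].
exact/nbhs_nmP.
Qed.

Lemma continuous_nmP (f : C -> C) (z : C) : cont_at f z <->
  forall e : R, 0 < e -> exists2 d : R, 0 < d &
    forall w, nm (w - z) < d -> nm (f w - f z) < e.
Proof.
have P := @cvg_nmP C (nbhs z) _ f (f z).
rewrite cont_atP.
by split=> [/P fz e /fz/nbhs_nmP//|fz]; apply/P => e /fz ?; exact/nbhs_nmP.
Qed.

Lemma nbhs_realP (t : R) (A : set R) :
  nbhs t A <-> exists2 d : R, 0 < d & forall s, `|s - t| < d -> A s.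
Proof.
split=> [/nbhs_ballP[e /= e0 ezA]|[d d0 dA]].
  by exists e => // s st; apply: ezA; rewrite /ball /= distrC.
by apply/nbhs_ballP; exists d => //= s; rewrite /ball /= distrC; exact: dA.
Qed.

Lemma continuous_RCP (f : R -> C) (t : R) : cont_at f t <->
  forall e : R, 0 < e -> exists2 d : R, 0 < d &
    forall s, `|s - t| < d -> nm (f s - f t) < e.
Proof.
have P := @cvg_nmP R (nbhs t) _ f (f t).
rewrite cont_atP.
by split=> [/P fz e /fz/nbhs_realP//|fz]; apply/P => e /fz ?; exact/nbhs_realP.
Qed.

Section composition_with_Re_Im.
Variables (T : topologicalType).

Lemma continuous_Re (f : T -> C) (t : T) :
  cont_at f t -> {for t, continuous (fun s => Re (f s))}.
Proof.
move=> /cont_atP/(@cvg_nmP T (nbhs t) _ f (f t)) ft; apply/cvgrPdist_lt => e /ft; apply: filterS => s.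
by apply: le_lt_trans; rewrite -ReB nm_distC nm_Re.
Qed.

Lemma continuous_Im (f : T -> C) (t : T) :
  cont_at f t -> {for t, continuous (fun s => Im (f s))}.
Proof.
move=> /cont_atP/(@cvg_nmP T (nbhs t) _ f (f t)) ft; apply/cvgrPdist_lt => e /ft; apply: filterS => s.
by apply: le_lt_trans; rewrite -ImB nm_distC nm_Im.
Qed.

Lemma continuous_nm (f : T -> C) (t : T) :
  cont_at f t -> {for t, continuous (fun s => nm (f s))}.
Proof.
move=> /cont_atP/(@cvg_nmP T (nbhs t) _ f (f t)) ft; apply/cvgrPdist_lt => e /ft; apply: filterS => s.
apply: le_lt_trans; rewrite ler_norml.
have := nm_lerB (f s) (f t); have := nm_lerB (f t) (f s).
by rewrite (nm_distC (f t)) => ? ?; apply/andP; split; lra.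
Qed.

Lemma continuous_real (f : T -> R) (t : T) :
  {for t, continuous f} -> cont_at (fun s => (f s)%:C) t.
Proof.
move=> /(@cvgrPdist_lt _ _ _ (nbhs t)) ft; apply/cont_atP/cvg_nmP => e /ft; apply: filterS => s.
by rewrite -rcB nm_real distrC.
Qed.

End composition_with_Re_Im.

(** Caratheodory's form of the derivative: with a factor [phi] continuous at [z], the product, chain
    and inverse rules become algebraic identities. *)
Definition cder (f : C -> C) (z d : C) := exists phi : C -> C,
  [/\ cont_at phi z, phi z = d & forall w, f w - f z = phi w * (w - z)].

(** First divided difference with node [z], completed there by the candidate derivative. Iterating
    it yields the second divided differences of the uniform estimates. *)
Definition slope (f : C -> C) (z d w : C) : C :=
  if w == z then d else (f w - f z) / (w - z).

Lemma slope_eq f z d w : f w - f z = slope f z d w * (w - z).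
Proof.
rewrite /slope; case: eqVneq => [->|wz]; first by rewrite !subrr mulr0.
by rewrite mulfVK// subr_eq0.
Qed.

Lemma cderP f z d : cder f z d <-> cont_at (slope f z d) z.
Proof.
split=> [[phi [cphi phiz E]]|cs].
  suff -> : slope f z d = phi by [].
  apply/funext => w; rewrite /slope; case: eqVneq => [->//|wz].
  by rewrite E mulfK// subr_eq0.
exists (slope f z d); split => //; first by rewrite /slope eqxx.
exact: slope_eq.
Qed.

Lemma cder_epsP f z d : cder f z d <-> forall e : R, 0 < e ->
  exists2 r : R, 0 < r & forall w, nm (w - z) < r ->
    nm (f w - f z - d * (w - z)) <= e * nm (w - z).
Proof.
rewrite cderP; split=> [/continuous_nmP cs e /cs[r r0 rs]|H].
  exists r => // w wr; rewrite (slope_eq f z d w) -mulrBl nmM.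
  rewrite ler_wpM2r ?nm_ge0//; have := rs _ wr.
  by rewrite [slope f z d z]/slope eqxx => /ltW.
apply/continuous_nmP => e e0.
have e20 : 0 < e / 2 by rewrite divr_gt0.
have [r r0 rH] := H _ e20; exists r => // w wr.
rewrite [slope f z d z]/slope eqxx {1}/slope; case: eqVneq => [_|wz].
  by rewrite subrr nm0.
have wz0 : w - z != 0 by rewrite subr_eq0.
have -> : (f w - f z) / (w - z) - d = (f w - f z - d * (w - z)) / (w - z).
  by field.
rewrite nmf ltr_pdivrMr ?nm_gt0//; apply: le_lt_trans (rH _ wr) _.
by rewrite ltr_pM2r ?nm_gt0// ltr_pdivrMr// ltr_pMr// ltr1n.
Qed.

Lemma derivable_cderP (f : C -> C) (z : C) : derivable f z 1 <-> exists d, cder f z d.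
Proof.
have scal (a b : C) : a *: b = a * b by [].
split=> [|[d /cder_epsP H]].
  move=> fd; exists (lim (h^-1 *: (f (h *: 1 + z) - f z) @[h --> 0^'])).
  apply/cder_epsP => e e0.
  move/cvg_nmP: fd => /(_ _ e0) /nbhs_nmP[r r0 rH].
  exists r => // w wr; have [->|wz] := eqVneq w z.
    by rewrite !subrr mulr0 subrr nm0 mulr0.
  have wz0 : w - z != 0 by rewrite subr_eq0.
  have := rH (w - z); rewrite subr0 => /(_ wr wz0) /ltW.
  set L := lim _; rewrite /= !scal mulr1 subrK => LH.
  have -> : f w - f z - L * (w - z) = ((w - z)^-1 * (f w - f z) - L) * (w - z).
    by field.
  by rewrite nmM ler_wpM2r ?nm_ge0.
apply/cvg_ex; exists d; apply/cvg_nmP => e e0.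
have e20 : 0 < e / 2 by rewrite divr_gt0.
have [r r0 rH] := H _ e20; apply/nbhs_nmP; exists r => // h; rewrite subr0 => hr h0.
have := rH (h + z); rewrite addrK => /(_ hr) hH.
rewrite /= !scal mulr1.
have -> : h^-1 * (f (h + z) - f z) - d = (f (h + z) - f z - d * h) / h by field.
rewrite nmf ltr_pdivrMr ?nm_gt0//; apply: le_lt_trans hH _.
by rewrite ltr_pM2r ?nm_gt0// ltr_pdivrMr// ltr_pMr// ltr1n.
Qed.

End epsilon_delta.

(** * Algebra of continuous functions *)

Section continuity_calculus.
Variables (R : realType) (T : topologicalType).
Local Notation C := R[i].
Implicit Types (f g : T -> C) (t : T).

Lemma cont_cst (c : C) t : cont_at (fun=> c) t.
Proof. by apply/cont_atP; exact: cst_continuous. Qed.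

Lemma contD f g t : cont_at f t -> cont_at g t -> cont_at (fun s => f s + g s) t.
Proof. move=> [cf] [cg]; apply/cont_atP; exact (continuousD cf cg). Qed.

Lemma contN f t : cont_at f t -> cont_at (fun s => - f s) t.
Proof. move=> [cf]; apply/cont_atP; exact (continuousN cf). Qed.

Lemma contB f g t : cont_at f t -> cont_at g t -> cont_at (fun s => f s - g s) t.
Proof. by move=> cf cg; apply: contD => //; exact: contN. Qed.

Lemma contM f g t : cont_at f t -> cont_at g t -> cont_at (fun s => f s * g s) t.
Proof. move=> [cf] [cg]; apply/cont_atP; exact (continuousM cf cg). Qed.

Lemma contV f t : f t != 0 -> cont_at f t -> cont_at (fun s => (f s)^-1) t.
Proof. move=> f0 [cf]; apply/cont_atP; exact (continuousV f0 cf). Qed.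

Lemma contX f t n : cont_at f t -> cont_at (fun s => f s ^+ n) t.
Proof.
move=> cf; elim: n => [|n IH].
  have -> : (fun s => f s ^+ 0) = fun=> 1 by apply/funext => s; rewrite expr0.
  exact: cont_cst.
have -> : (fun s => f s ^+ n.+1) = fun s => f s * f s ^+ n.
  by apply/funext => s; rewrite exprS.
exact: contM.
Qed.

Lemma cont_comp (U : topologicalType) (h : U -> C) (k : T -> U) t :
  {for t, continuous k} -> cont_at h (k t) -> cont_at (fun s => h (k s)) t.
Proof. move=> ck [ch]; apply/cont_atP; exact (continuous_comp ck ch). Qed.

Lemma cont_compC (h : C -> C) f t :
  cont_at f t -> cont_at h (f t) -> cont_at (fun s => h (f s)) t.
Proof. move=> [cf] [ch]; apply/cont_atP; exact (continuous_comp cf ch). Qed.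

Lemma cont_near f g t : (\forall s \near t, f s = g s) -> cont_at f t -> cont_at g t.
Proof.
move=> fg [cf]; apply/cont_atP; have fgt : f t = g t by exact: (nbhs_singleton fg).
move: cf; rewrite /prop_for /continuous_at fgt; apply: cvg_trans.
apply: near_eq_cvg; near do rewrite (near fg _)//.
Unshelve. all: by end_near. Qed.

End continuity_calculus.

Arguments cont_cst {R T} c t.

(** * Rules for the complex derivative *)

Section complex_derivative.
Variable R : realType.
Local Notation C := R[i].
Implicit Types (f g : C -> C) (z d : C).

Lemma cont_id z : cont_at (fun w : C => w) z.
Proof. by apply/cont_atP; exact: cvg_id. Qed.

Arguments cont_id z : clear implicits.

Lemma cder_cont f z d : cder f z d -> cont_at f z.
Proof.
move=> [phi [cphi _ E]].
have -> : f = fun w => f z + phi w * (w - z).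
  by apply/funext => w; rewrite -E addrC subrK.
apply: contD; first exact: cont_cst.
exact: (contM cphi (contB (cont_id z) (cont_cst z z))).
Qed.

Lemma derivable_cont f z : derivable f z 1 -> cont_at f z.
Proof. by move=> /derivable_cderP[d] /cder_cont. Qed.

Lemma cont_subc (a z : C) : cont_at (fun w => w - a) z.
Proof. by apply: contB; [exact: cont_id|exact: cont_cst]. Qed.

Lemma cder_cst (c z : C) : cder (fun=> c) z 0.
Proof.
by exists (fun=> 0); split => //; [exact: cont_cst|move=> w; rewrite subrr mul0r].
Qed.

Lemma cder_id z : cder (fun w => w) z 1.
Proof. by exists (fun=> 1); split => //; [exact: cont_cst|move=> w; rewrite mul1r]. Qed.

Lemma cderD f g z d d' : cder f z d -> cder g z d' -> cder (fun w => f w + g w) z (d + d').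
Proof.
move=> [p [cp <- pE]] [q [cq <- qE]]; exists (fun w => p w + q w); split; [exact: (contD cp cq)|by []|].
by move=> w; rewrite mulrDl -pE -qE; ring.
Qed.

Lemma cderM f g z d d' : cder f z d -> cder g z d' ->
  cder (fun w => f w * g w) z (d * g z + f z * d').
Proof.
move=> cf [q [cq <- qE]]; have cfz := cder_cont cf; case: cf => p [cp <- pE].
exists (fun w => p w * g z + f w * q w); split; first 1 last.
- by [].
- by move=> w; rewrite mulrDl mulrAC -pE -mulrA -qE; ring.
  exact: (contD (contM cp (cont_cst _ z)) (contM cfz cq)).
Qed.

Lemma cderN f z d : cder f z d -> cder (fun w => - f w) z (- d).
Proof.
move=> [p [cp <- pE]]; exists (fun w => - p w); split; [exact: (contN cp)|by []|].
by move=> w; rewrite mulNr -pE; ring.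
Qed.

Lemma cderB f g z d d' : cder f z d -> cder g z d' -> cder (fun w => f w - g w) z (d - d').
Proof. by move=> cf cg; apply: cderD => //; exact: cderN. Qed.

Lemma cderV f z d : f z != 0 -> cder f z d -> cder (fun w => (f w)^-1) z (- d / f z ^+ 2).
Proof.
move=> fz0 cf; have cfz := cder_cont cf; case: cf => p [cp <- pE].
have /continuous_nmP := cfz => /(_ (nm (f z))); rewrite nm_gt0 => /(_ fz0)[r r0 rH].
have fn0 w : nm (w - z) < r -> f w != 0.
  by move=> /rH; apply: contraTneq => ->; rewrite sub0r nmN ltxx.
apply/cderP; apply: (@cont_near _ _ (fun w => - p w / (f z * f w))); last first.
  have fz20 : f z * f z != 0 by rewrite mulf_neq0.
  apply: contM; first exact: contN.
  apply: (@contV _ _ (fun w => f z * f w) z fz20); by apply: contM => //; exact: cont_cst.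
apply/nbhs_nmP; exists r => // w /fn0 fw0; rewrite /slope; case: eqVneq => [->|wz].
  by rewrite expr2.
have wz0 : w - z != 0 by rewrite subr_eq0.
have -> : p w = (f w - f z) / (w - z) by rewrite pE mulfK.
by field; rewrite ?fz0 ?fw0 ?wz0.
Qed.

Lemma cder_comp f g z d d' : cder f z d -> cder g (f z) d' ->
  cder (fun w => g (f w)) z (d' * d).
Proof.
move=> cf [q [cq <- qE]]; have cfz := cder_cont cf; case: cf => p [cp <- pE].
exists (fun w => q (f w) * p w); split; last by move=> w; rewrite qE pE mulrA.
  exact: (contM (cont_compC cfz cq) cp).
by [].
Qed.

Lemma cderX f z d n : cder f z d -> exists d', cder (fun w => f w ^+ n) z d'.
Proof.
move=> cf; elim: n => [|n [d' IH]].
  exists 0; have -> : (fun w => f w ^+ 0) = fun=> 1 by apply/funext => s; rewrite expr0.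
  exact: cder_cst.
exists (d * f z ^+ n + f z * d'); have -> : (fun s => f s ^+ n.+1) = fun s => f s * f s ^+ n.
  by apply/funext => s; rewrite exprS.
exact: cderM.
Qed.

Lemma derivable_subc f (c z : C) : derivable f z 1 -> derivable (fun w => f w - c) z 1.
Proof.
move=> /derivable_cderP[d fd]; apply/derivable_cderP; exists (d - 0).
by apply: cderB => //; exact: cder_cst.
Qed.

Lemma cder_near f g z d : (exists2 r : R, 0 < r & forall w, nm (w - z) < r -> f w = g w) ->
  cder f z d -> cder g z d.
Proof.
move=> [r r0 rH] /cderP cf; apply/cderP; apply: cont_near cf.
apply/nbhs_nmP; exists r => // w wr; rewrite /slope rH// (rH z)//.
by rewrite subrr nm0.
Qed.

Lemma punctured_nonempty z (r : R) : 0 < r -> exists2 w, w != z & nm (w - z) < r.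
Proof.
move=> r0; exists (z + (r / 2)%:C).
  by rewrite -subr_eq0 addrAC subrr add0r -nm_gt0 nm_real normr_gt0 gt_eqF// divr_gt0.
rewrite addrAC subrr add0r nm_real gtr0_norm ?divr_gt0//.
by rewrite ltr_pdivrMr// ltr_pMr// ltr1n.
Qed.

Lemma cont_eq_off f g z : cont_at f z -> cont_at g z ->
  (forall r : R, 0 < r -> exists2 w, nm (w - z) < r & f w = g w) -> f z = g z.
Proof.
move=> /continuous_nmP cf /continuous_nmP cg H; apply/eqP; rewrite -subr_eq0 -nm_eq0.
apply: contraT => n0; have e0 : 0 < nm (f z - g z) / 2.
  by rewrite divr_gt0// lt_def n0 nm_ge0.
have [r r0 rH] := cf _ e0; have [s s0 sH] := cg _ e0.
have rs0 : 0 < Num.min r s by rewrite lt_min r0 s0.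
have [w] := H _ rs0; rewrite lt_min => /andP[/rH fw /sH gw] fgw.
have := nm_distD (f w) (f z) (g z); rewrite {2}fgw (nm_distC (f z) (f w)) => ?.
lra.
Qed.

Lemma cder_unique f z d d' : cder f z d -> cder f z d' -> d = d'.
Proof.
move=> [p [cp <- pE]] [q [cq <- qE]]; apply: cont_eq_off => // r r0.
have [w wz wr] := punctured_nonempty z r0; exists w => //.
have wz0 : w - z != 0 by rewrite subr_eq0.
by apply: (mulIf wz0); rewrite -pE.
Qed.

End complex_derivative.

(** * Derivatives and primitives of complex functions of a real variable *)

Section derivative_along_paths.
Variable R : realType.
Local Notation C := R[i].
Implicit Types (P Q : R -> C) (t s : R) (u v : C).

(** The factor form of the derivative again, so that composing with [cder] only multiplies
    factors. *)
Definition rder P t v := exists phi : R -> C,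
  [/\ cont_at phi t, phi t = v & forall s, P s - P t = (s - t)%:C * phi s].

Lemma rder_epsP P t v : rder P t v <-> forall e : R, 0 < e ->
  exists2 r : R, 0 < r & forall s, `|s - t| < r ->
    nm (P s - P t - (s - t)%:C * v) <= e * `|s - t|.
Proof.
split=> [[phi [/continuous_RCP cphi <- pE]] e /cphi[r r0 rH]|H].
  exists r => // s /rH /ltW; rewrite pE -mulrBr nmM nm_real mulrC => ?.
  by rewrite ler_wpM2r.
exists (fun s => if s == t then v else (s - t)%:C^-1 * (P s - P t)); split.
- apply/continuous_RCP => e e0.
  have e20 : 0 < e / 2 by rewrite divr_gt0.
  have [r r0 rH] := H _ e20; exists r => // s sr; rewrite eqxx.
  case: eqVneq => [_|st]; first by rewrite subrr nm0.
  have st0 : 0 < `|s - t| by rewrite normr_gt0 subr_eq0.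
  have st0' : (s - t)%:C != 0 :> C by rewrite -nm_gt0 nm_real.
  have -> : (s - t)%:C^-1 * (P s - P t) - v = (P s - P t - (s - t)%:C * v) / (s - t)%:C.
    by move: (s - t)%:C st0' => x x0; field.
  rewrite nmf nm_real ltr_pdivrMr//; apply: le_lt_trans (rH _ sr) _.
  by rewrite ltr_pM2r// ltr_pdivrMr// ltr_pMr// ltr1n.
- by rewrite eqxx.
- move=> s; case: eqVneq => [->|st]; first by rewrite !subrr mul0r.
  by rewrite mulrA mulfV ?mul1r// -nm_gt0 nm_real normr_gt0 subr_eq0.
Qed.

Lemma rder_comp (f : C -> C) P t v d : rder P t v -> cder f (P t) d ->
  rder (fun s => f (P s)) t (d * v).
Proof.
move=> [p [cp <- pE]] [q [cq <- qE]]; exists (fun s => q (P s) * p s); split; first 1 last.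
- by [].
- by move=> s; rewrite qE pE mulrCA.
apply: (fun a => contM a cp); apply: (fun a => cont_compC a cq).
have -> : P = fun s => P t + (s - t)%:C * p s.
  by apply/funext => s; rewrite -pE addrC subrK.
apply: contD; first exact: cont_cst.
apply: (fun a => contM a cp); apply: continuous_real.
by apply: continuousB; [exact: cvg_id|exact: cvg_cst].
Qed.

Lemma rder_affine (a u : C) t : rder (fun s => a + s%:C * u) t u.
Proof.
exists (fun=> u); split => //; first exact: cont_cst.
by move=> s; rewrite rcB; ring.
Qed.

Lemma rder_rescale P (a b : R) t v : rder P (a + b * t) v ->
  rder (fun s => P (a + b * s)) t (b%:C * v).
Proof.
move=> [p [cp <- pE]]; exists (fun s => b%:C * p (a + b * s)); split; first 1 last.
- by [].
- by move=> s; rewrite pE mulrA -rcM; congr (_%:C * _); ring.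
apply: contM; first exact: cont_cst.
apply: (fun x => @cont_comp _ _ _ p (fun s => a + b * s) _ x cp).
apply: continuousD; first exact: cvg_cst.
by apply: continuousM; [exact: cvg_cst|exact: cvg_id].
Qed.

Lemma rderB P Q t u v : rder P t u -> rder Q t v -> rder (fun s => P s - Q s) t (u - v).
Proof.
move=> [p [cp <- pE]] [q [cq <- qE]]; exists (fun w => p w - q w); split; [exact: (contB cp cq)|by []|].
by move=> w; rewrite mulrBr -pE -qE; ring.
Qed.

Lemma is_derive_epsP (f : R -> R) t (d : R) : is_derive t (1 : R) f d <->
  forall e : R, 0 < e -> exists2 r : R, 0 < r & forall s, `|s - t| < r ->
    `|f s - f t - (s - t) * d| <= e * `|s - t|.
Proof.
split=> [[fd <-]|H].
  move=> e e0; move/cvgrPdist_le: fd => /(_ _ e0) /nbhs_realP[r r0 rH].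
  exists r => // s sr; have [->|st] := eqVneq s t.
    by rewrite !subrr mul0r subrr normr0 mulr0.
  have st0 : s - t != 0 by rewrite subr_eq0.
  have := rH (s - t); rewrite subr0 => /(_ sr st0).
  rewrite -['D_1 f t]/(lim _); set L := lim _.
  rewrite /= /GRing.scale /= mulr1 subrK distrC => LH.
  have -> : f s - f t - (s - t) * L = ((s - t)^-1 * (f s - f t) - L) * (s - t).
    by field.
  by rewrite normrM ler_wpM2r.
have fd : h^-1 *: (f (h *: 1 + t) - f t) @[h --> 0^'] --> d.
  apply/cvgrPdist_le => e e0; have [r r0 rH] := H _ e0.
  apply/nbhs_realP; exists r => // h; rewrite subr0 => hr h0.
  have := rH (h + t); rewrite addrK => /(_ hr) hH.
  rewrite /= /GRing.scale /= mulr1 distrC.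
  have -> : h^-1 * (f (h + t) - f t) - d = (f (h + t) - f t - h * d) / h by field.
  by rewrite normrM normfV ler_pdivrMr// normr_gt0.
by apply: DeriveDef; [apply/cvg_ex; exists d|exact: cvg_lim].
Qed.

Lemma rder_Re P t v (c : C) : rder P t v ->
  is_derive t (1 : R) (fun s => Re (c * P s)) (Re (c * v)).
Proof.
move=> /rder_epsP H; apply/is_derive_epsP => e e0.
have c1 : 0 < nm c + 1 by rewrite ltr_wpDl// nm_ge0.
have [r r0 rH] := H _ (divr_gt0 e0 c1); exists r => // s /rH sr.
have -> : Re (c * P s) - Re (c * P t) - (s - t) * Re (c * v) =
    Re (c * (P s - P t - (s - t)%:C * v)).
  by rewrite -ReZ -!ReB; congr Re; ring.
apply: le_trans (nm_Re _) _; rewrite nmM.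
apply: (@le_trans _ _ ((nm c + 1) * nm (P s - P t - (s - t)%:C * v))).
  by rewrite ler_wpM2r ?nm_ge0// lerDl.
by rewrite mulrC -ler_pdivlMr// mulrAC.
Qed.

Lemma rder_ReIm (F G : R -> R) t (a b : R) : is_derive t (1 : R) F a ->
  is_derive t (1 : R) G b -> rder (fun s => F s +i* G s) t (a +i* b).
Proof.
move=> /is_derive_epsP HF /is_derive_epsP HG; apply/rder_epsP => e e0.
have e20 : 0 < e / 2 by rewrite divr_gt0.
have [r r0 rH] := HF _ e20; have [q q0 qH] := HG _ e20.
exists (Num.min r q); first by rewrite lt_min r0.
move=> s; rewrite lt_min => /andP[/rH sr /qH sq].
apply: le_trans (nm_ReIm _) _.
rewrite !ReB !ImB ReZ ImZ /=.
by apply: le_trans (lerD sr sq) _; rewrite -mulrDl -splitr.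
Qed.

Lemma continuous_primitive (f : R -> R) : continuous f ->
  exists F : R -> R, forall t, 0 <= t <= 1 -> is_derive t (1 : R) F (f t).
Proof.
move=> cf.
(* Integrating from [-1], inside an interval that reaches [2], makes 0 and 1 interior points, so the
   derivative is two-sided there. *)
exists (fun x => \int[lebesgue_measure]_(t in [set` `[- 1, x]]) f t)%R => t /andP[t0 t1].
have t2 : t < 2 by apply: le_lt_trans t1 _; rewrite ltr1n.
have tN1 : -1 < t by apply: lt_le_trans t0; rewrite ltrN10.
have fi : lebesgue_measure.-integrable `[-1, 2 : R] (EFin \o f).
  apply: continuous_compact_integrable; first exact: segment_compact.
  exact: continuous_subspaceT.
have [dF dFE] := continuous_FTC1_closed t2 fi tN1 (cf t).
apply: DeriveDef; first exact dF.
rewrite -derive1E; exact dFE.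
Qed.

Lemma path_primitive (g : R -> C) : (forall t, cont_at g t) ->
  exists P : R -> C, forall t, 0 <= t <= 1 -> rder P t (g t).
Proof.
move=> cg.
have [F FH] := continuous_primitive (fun t => continuous_Re (cg t)).
have [G GH] := continuous_primitive (fun t => continuous_Im (cg t)).
exists (fun s => F s +i* G s) => t t01.
have -> : g t = Re (g t) +i* Im (g t) by case: (g t).
by apply: rder_ReIm; [exact: FH|exact: GH].
Qed.

Lemma real_MVT (f f' : R -> R) (a b : R) : a <= b ->
  (forall t, a <= t <= b -> is_derive t (1 : R) f (f' t)) ->
  exists2 c, a <= c <= b & f b - f a = f' c * (b - a).
Proof.
move=> ab fd; have [t|t /=|c] := @MVT_segment R f f' a b ab.
- by rewrite in_itv /= => /andP[t0 t1]; apply: fd; rewrite !ltW.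
- apply: derivable_within_continuous => {}t; rewrite in_itv /= => tab.
  exact: (@ex_derive _ _ _ _ _ _ _ (fd _ tab)).
by rewrite in_itv /= => cab E; exists c.
Qed.

(** Mean value inequality: the real mean value theorem is applied to the projection of [P] on the
    direction of its total increment [v], whose own increment is the square of the modulus of
    [v]. *)
Lemma rder_growth P (P' : R -> C) (M : R) :
  (forall t, 0 <= t <= 1 -> rder P t (P' t) /\ nm (P' t) <= M) ->
  nm (P 1 - P 0) <= M.
Proof.
move=> H; set v := P 1 - P 0.
have [->|v0] := eqVneq (nm v) 0.
  have [_] := H 0 (ltac:(by rewrite lexx ler01)).
  by apply: le_trans; exact: nm_ge0.
have vgt0 : 0 < nm v by rewrite lt_def v0 nm_ge0.
have [t /H[Pt _]|c c01] :=
    @real_MVT (fun s => Re (v^*%C * P s)) (fun s => Re (v^*%C * P' s)) 0 1 ler01.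
  exact: rder_Re.
rewrite subr0 mulr1 -ReB -mulrBr Re_conjM => E.
have [_ cM] := H _ c01.
suff : nm v * nm v <= nm v * M by rewrite ler_pM2l.
rewrite -expr2 E; apply: le_trans (Re_le _) _.
by rewrite nmM nm_conj ler_pM2l.
Qed.

End derivative_along_paths.

(** * Limits along ultrafilters *)

Section ultrafilter_limits.
Variable R : realType.
Local Notation C := R[i].

(** A free ultrafilter replaces the extraction of subsequences: along it every bounded sequence
    converges, so a bounded sequence of functions has a limit at all points at once, without a
    diagonal argument. *)
Lemma ultra_nat : exists U : set_system nat, [/\ UltraFilter U, ProperFilter U, Filter U &
  forall P : nat -> Prop, (exists N, forall n, (N <= n)%N -> P n) -> U P].
Proof.
have [U [UU sU]] := ultraFilterLemma eventually_filter.
have UF : ProperFilter U by exact: ultra_proper.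
have UFf : Filter U by exact: filter_filter.
exists U; split => // P [N NP].
by apply: sU; exists N => // n /=; exact: NP.
Qed.

Variables (T : Type) (U : set_system T).
Hypothesis UU : UltraFilter U.

Lemma ultra_realcvg (f : T -> R) (M : R) : U [set x | `|f x| <= M] ->
  exists l : R, f x @[x --> U] --> l.
Proof.
move=> fM; have UF : ProperFilter U by exact: ultra_proper.
have UFf : Filter U by exact: filter_filter.
have [|l [_ cl]] := @segment_compact R (- M) M (f x @[x --> U]) _.
  suff : U [set x | `[- M, M]%classic (f x)] by [].
  by apply: (@filterS _ U _ _ _ _ fM) => x /=; rewrite in_itv /= ler_norml.
exists l => A lA; case: (in_ultra_setVsetC (f @^-1` A) UU) => // nA.
have /= [y [//]] := cl (~` A) A nA lA.
Qed.

Lemma ultra_cvg (f : T -> C) (M : R) : U [set x | nm (f x) <= M] ->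
  exists l : C, f x @[x --> U] --> l.
Proof.
move=> fM; have UF : ProperFilter U by exact: ultra_proper.
have UFf : Filter U by exact: filter_filter.
have [|a fa] := @ultra_realcvg (fun x => Re (f x)) M.
  by move: fM; apply: filterS => x /=; exact: le_trans (nm_Re _).
have [|b fb] := @ultra_realcvg (fun x => Im (f x)) M.
  by move: fM; apply: filterS => x /=; exact: le_trans (nm_Im _).
exists (a +i* b); apply/cvg_nmP => e e0.
have e20 : 0 < e / 2 by rewrite divr_gt0.
move/cvgrPdist_lt: fa => /(_ _ e20) fa; move/cvgrPdist_lt: fb => /(_ _ e20) fb.
move: fa fb; apply: filterS2 => x ax bx; apply: le_lt_trans (nm_ReIm _) _.
by rewrite ReB ImB /= [e]splitr ltrD// distrC.
Qed.

End ultrafilter_limits.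

(** * Estimates in the limit, compactness and extrema in the plane *)

Section limits.
Variable R : realType.
Local Notation C := R[i].

Lemma cvg_nm_le (T : Type) (F : set_system T) (FF : ProperFilter F) (f : T -> C)
    (l a : C) (b : R) : f x @[x --> F] --> l -> (\forall x \near F, nm (f x - a) <= b) ->
  nm (l - a) <= b.
Proof.
move=> /cvg_nmP fl fb; rewrite leNgt; apply/negP => lt.
have e0 : 0 < nm (l - a) - b by rewrite subr_gt0.
have [x [/= xb xl]] := filter_ex (filterI fb (fl _ e0)).
by have := nm_distD (f x) l a; rewrite (nm_distC l (f x)); lra.
Qed.

Lemma geometric_small (M e : R) : 0 < e -> exists n : nat, M / 2 ^+ n < e.
Proof.
move=> e0; have [M0|M0] := leP M 0.
  by exists 0%N; rewrite expr0 divr1; exact: le_lt_trans e0.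
have := @cvg_geometric R M (2^-1).
rewrite ger0_norm ?invr_ge0// invf_lt1// ltr1n => /(_ isT).
move=> /cvgrPdist_lt /(_ _ e0) [N _ /(_ N (leqnn N))] /=.
rewrite sub0r normrN /geometric /= exprVn ger0_norm; last first.
  by rewrite ltW// divr_gt0// exprn_gt0.
by exists N.
Qed.

Lemma invS_small (e : R) : 0 < e -> exists N, forall n : nat, (N <= n)%N -> n.+1%:R^-1 < e.
Proof.
move=> e0; exists (Num.bound e^-1) => n nb.
have i0 : 0 <= e^-1 by rewrite invr_ge0 ltW.
rewrite -[e]invrK ltf_pV2 ?posrE ?invr_gt0//.
by apply: lt_le_trans (archi_boundP i0) _; rewrite ler_nat ltnW// ltnS.
Qed.

Definition approached (A : set C) (c : C) :=
  forall e : R, 0 < e -> exists2 w, A w & nm (w - c) < e.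

(** Heine-Borel: an ultrafilter on a bounded set converges, coordinate by coordinate. *)
Lemma compact_nm (A : set C) (M : R) : (forall z, A z -> nm z <= M) ->
  (forall c, approached A c -> A c) -> compact A.
Proof.
move=> AM Acl; rewrite compact_ultra => F FU FA.
have FF : ProperFilter F by exact: ultra_proper.
have FFf : Filter F by exact: filter_filter.
have [|l Fl] := @ultra_cvg R _ F FU id M; first by move: FA; apply: filterS => z /AM.
exists l; split => //; apply: Acl => e e0.
move/cvg_nmP : Fl => /(_ _ e0) Fl.
by have [w [/= Aw wl]] := filter_ex (filterI FA Fl); exists w.
Qed.

Lemma complex_EVT_max (A : set C) (M : R) (f : C -> R) : A !=set0 ->
  (forall z, A z -> nm z <= M) -> (forall c, approached A c -> A c) ->
  (forall z, A z -> {for z, continuous f}) ->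
  exists2 p, A p & forall z, A z -> f z <= f p.
Proof.
move=> A0 AM Acl cf; have cA := compact_nm AM Acl.
have [] := @compact_EVT_max C R f A A0 cA.
  by apply: continuous_in_subspaceT => z; rewrite inE => /cf.
by move=> p; rewrite inE => Ap pM; exists p => // z Az; apply: pM; rewrite inE.
Qed.

End limits.

(** * Integrals along segments and around triangles *)

Section segment_integrals.
Variable R : realType.
Local Notation C := R[i].
Implicit Types (G : C -> C) (p q s v : C) (t : R).

Definition seg p q t : C := p + t%:C * (q - p).

(** The integral is encoded by a primitive of the pulled-back integrand; reversing or splitting a
    segment then only reparametrizes that primitive. *)
Definition seg_integral G p q v := exists2 P : R -> C,
  (forall t, 0 <= t <= 1 -> rder P t ((q - p) * G (seg p q t))) & v = P 1 - P 0.

(** Retraction of the line onto the unit interval: it turns paths given on the interval into paths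
    continuous everywhere. *)
Definition clamp (t : R) : R := Num.max 0 (Num.min 1 t).

Lemma clamp01 t : 0 <= clamp t <= 1.
Proof. by rewrite le_max lexx/= ge_max ler01 ge_min lexx. Qed.

Lemma clampE t : 0 <= t <= 1 -> clamp t = t.
Proof. by move=> /andP[t0 t1]; rewrite /clamp min_r// max_r. Qed.

Lemma clamp_cont : continuous clamp.
Proof.
move=> t; apply: (@continuous_max R R (fun=> 0) (fun t => Num.min 1 t)); first exact: cvg_cst.
by apply: (@continuous_min R R (fun=> 1) id); [exact: cvg_cst|exact: cvg_id].
Qed.

Lemma seg0 p q : seg p q 0 = p.
Proof. by rewrite /seg rc0 mul0r addr0. Qed.

Lemma seg1 p q : seg p q 1 = q.
Proof. by rewrite /seg rc1 mul1r addrC subrK. Qed.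

Lemma seg_cont p q t : cont_at (seg p q) t.
Proof.
apply: contD; first exact: cont_cst.
by apply: contM; [apply: continuous_real; exact: cvg_id|exact: cont_cst].
Qed.

Lemma rder_seg p q t : rder (seg p q) t (q - p).
Proof. exact: rder_affine. Qed.

Lemma seg_integral_exists G p q : (forall t, 0 <= t <= 1 -> cont_at G (seg p q t)) ->
  exists v, seg_integral G p q v.
Proof.
move=> cG; have [|P PH] := @path_primitive R (fun t => (q - p) * G (seg p q (clamp t))).
  move=> t; apply: contM; first exact: cont_cst.
  refine (@cont_comp R R R (fun u => G (seg p q u)) clamp t (@clamp_cont t) _).
  by apply: cont_compC; [exact: seg_cont|apply: cG; exact: clamp01].
by exists (P 1 - P 0), P => // t t01; have := PH _ t01; rewrite clampE.
Qed.

(** The integrand is compared with a function [A] having a primitive [Q]: affine for Goursat's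
    theorem, constant for the derivative of an integral, zero for a crude bound. *)
Lemma seg_integral_bound G p q v (Q A : C -> C) (k : R) : seg_integral G p q v ->
  (forall t, 0 <= t <= 1 -> cder Q (seg p q t) (A (seg p q t)) /\
     nm (G (seg p q t) - A (seg p q t)) <= k) ->
  nm (v - (Q q - Q p)) <= k * nm (q - p).
Proof.
move=> [P PH ->] H; have := @rder_growth R (fun t => P t - Q (seg p q t))
  (fun t => (q - p) * (G (seg p q t) - A (seg p q t))) (k * nm (q - p)).
rewrite seg0 seg1; have -> : P 1 - Q q - (P 0 - Q p) = P 1 - P 0 - (Q q - Q p) by ring.
apply => t t01; have [cQ GA] := H _ t01; split; last first.
  by rewrite nmM mulrC ler_wpM2r// nm_ge0.
rewrite mulrBr [_ * A _]mulrC; apply: rderB; first exact: PH.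
exact: (rder_comp (rder_seg p q t) cQ).
Qed.

Lemma seg_integral_unique G p q v v' : seg_integral G p q v -> seg_integral G p q v' -> v = v'.
Proof.
move=> [P PH ->] [Q QH ->]; have := @rder_growth R (fun t => P t - Q t) (fun=> 0) 0.
have -> : P 1 - Q 1 - (P 0 - Q 0) = P 1 - P 0 - (Q 1 - Q 0) by ring.
move=> H; apply/eqP; rewrite -subr_eq0 -nm_eq0 eq_le nm_ge0 andbT; apply: H => t t01.
by rewrite nm0 -[X in rder _ _ X](subrr ((q - p) * G (seg p q t))); split => //;
  apply: rderB; [exact: PH|exact: QH].
Qed.

Lemma seg_integral_rev G p q v : seg_integral G p q v -> seg_integral G q p (- v).
Proof.
move=> [P PH ->]; exists (fun t => P (1 + (- 1) * t)); last first.
  by rewrite mulr1 subrr mulr0 addr0 opprB.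
move=> t /andP[t0 t1].
have s01 : 0 <= 1 + -1 * t <= 1 by apply/andP; split; lra.
have := rder_rescale (PH _ s01); congr rder.
have -> : seg p q (1 + -1 * t) = seg q p t by rewrite /seg rcD rcM rcN rc1; ring.
by rewrite mulrA rcN rc1; congr (_ * _); ring.
Qed.

Lemma seg_integral_split G p q v t : 0 <= t <= 1 -> seg_integral G p q v ->
  exists v1 v2, [/\ seg_integral G p (seg p q t) v1,
    seg_integral G (seg p q t) q v2 & v = v1 + v2].
Proof.
move=> /andP[t0 t1] [P PH ->]; exists (P t - P 0), (P 1 - P t); split.
- exists (fun u => P (0 + t * u)); last by rewrite mulr1 mulr0 !add0r.
  move=> u /andP[u0 u1]; have u01 : 0 <= 0 + t * u <= 1.
    by rewrite add0r mulr_ge0// mulr_ile1.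
  have := rder_rescale (PH _ u01); congr rder.
  have -> : seg p q (0 + t * u) = seg p (seg p q t) u by rewrite /seg add0r rcM; ring.
  by rewrite mulrA; congr (_ * _); rewrite /seg; ring.
- exists (fun u => P (t + (1 - t) * u)); last first.
    by rewrite mulr0 addr0 mulr1 addrCA subrr addr0.
  move=> u /andP[u0 u1]; have u01 : 0 <= t + (1 - t) * u <= 1.
    apply/andP; split; first by rewrite addr_ge0// mulr_ge0// subr_ge0.
    have : (1 - t) * u <= (1 - t) * 1 by rewrite ler_wpM2l// subr_ge0.
    by rewrite mulr1; lra.
  have := rder_rescale (PH _ u01); congr rder.
  have -> : seg p q (t + (1 - t) * u) = seg (seg p q t) q u.
    by rewrite /seg rcD rcM rcB rc1; ring.
  by rewrite mulrA; congr (_ * _); rewrite /seg rcB rc1; ring.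
- by ring.
Qed.

Definition seg_int G p q : C := xget 0 [set v | seg_integral G p q v].

Definition cconvex (K : set C) :=
  forall p q, K p -> K q -> forall t, 0 <= t <= 1 -> K (seg p q t).

Lemma convex_closed_ball a (r : R) : cconvex [set z | nm (z - a) <= r].
Proof.
move=> p q /= pr qr t /andP[t0 t1].
have -> : seg p q t - a = (1 - t)%:C * (p - a) + t%:C * (q - a).
  by rewrite /seg rcB rc1; ring.
apply: le_trans (nmD _ _) _; rewrite !nmM !nm_real !ger0_norm ?subr_ge0//.
have H1 : (1 - t) * nm (p - a) <= (1 - t) * r by rewrite ler_wpM2l// subr_ge0.
have H2 : t * nm (q - a) <= t * r by rewrite ler_wpM2l.
by apply: le_trans (lerD H1 H2) _; rewrite -mulrDl subrK mul1r.
Qed.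

Lemma convex_half_plane a n (m : R) : cconvex [set z | m <= Re (n * (z - a))].
Proof.
move=> p q /= pr qr t /andP[t0 t1].
have -> : n * (seg p q t - a) = (1 - t)%:C * (n * (p - a)) + t%:C * (n * (q - a)).
  by rewrite /seg rcB rc1; ring.
rewrite ReD !ReZ.
have H1 : (1 - t) * m <= (1 - t) * Re (n * (p - a)) by rewrite ler_wpM2l// subr_ge0.
have H2 : t * m <= t * Re (n * (q - a)) by rewrite ler_wpM2l.
by apply: le_trans (lerD H1 H2); rewrite -mulrDl subrK mul1r.
Qed.

Section on_a_convex_set.
Variables (G : C -> C) (K : set C).
Hypotheses (Kconv : cconvex K) (cG : forall z, K z -> cont_at G z).

Lemma seg_intP p q : K p -> K q -> seg_integral G p q (seg_int G p q).
Proof.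
move=> Kp Kq; have [|v vP] := @seg_integral_exists G p q.
  by move=> t t01; apply: cG; exact: Kconv.
rewrite /seg_int; case: xgetP => [w -> //|/(_ v)]; by case.
Qed.

Lemma seg_int_rev p q : K p -> K q -> seg_int G q p = - seg_int G p q.
Proof.
move=> Kp Kq; apply: (@seg_integral_unique G q p); first exact: seg_intP.
by apply: seg_integral_rev; exact: seg_intP.
Qed.

Lemma seg_int_split p q t : K p -> K q -> 0 <= t <= 1 ->
  seg_int G p q = seg_int G p (seg p q t) + seg_int G (seg p q t) q.
Proof.
move=> Kp Kq t01; have Ks := Kconv Kp Kq t01.
have [v1 [v2 [h1 h2 ->]]] := seg_integral_split t01 (seg_intP Kp Kq).
by congr (_ + _); apply: seg_integral_unique; try eassumption; exact: seg_intP.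
Qed.

Definition tri_int p q s := seg_int G p q + seg_int G q s + seg_int G s p.

Definition mid p q := seg p q 2^-1.

Lemma half01 : 0 <= (2^-1 : R) <= 1.
Proof. by rewrite invr_ge0 ler0n invf_le1// ler1n. Qed.

Lemma nm_half (z : C) : nm ((2^-1 : R)%:C * z) = nm z / 2.
Proof. by rewrite nmM nm_real ger0_norm ?invr_ge0// mulrC. Qed.

Definition small_tri (d : R) (x : C * C * C) :=
  [/\ K x.1.1 /\ K x.1.2, K x.2, nm (x.1.2 - x.1.1) <= d,
      nm (x.2 - x.1.2) <= d & nm (x.1.1 - x.2) <= d].

(** Of the four triangles cut out by the midpoints, one carries at least a quarter of the integral,
    since the inner edges cancel. The choice of [y] precedes [d], so that a single selection
    function can be iterated while the sizes shrink. *)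
Lemma tri_step (x : C * C * C) : exists y : C * C * C, forall d, small_tri d x ->
  [/\ small_tri (d / 2) y, nm (y.1.1 - x.1.1) <= d / 2 &
      nm (tri_int x.1.1 x.1.2 x.2) <= 4 * nm (tri_int y.1.1 y.1.2 y.2)].
Proof.
case: x => [[p q] s] /=.
have [Kx|nK] := pselect (K p /\ K q /\ K s); last first.
  by exists (p, q, s) => d [[/= Kp Kq] Ks]; exfalso; exact: nK.
case: Kx => Kp [Kq Ks].
have Km1 : K (mid p q) by exact: (Kconv Kp Kq half01).
have Km2 : K (mid q s) by exact: (Kconv Kq Ks half01).
have Km3 : K (mid s p) by exact: (Kconv Ks Kp half01).
set m1 := mid p q in Km1 *; set m2 := mid q s in Km2 *; set m3 := mid s p in Km3 *.
have E : tri_int p q s = tri_int p m1 m3 + tri_int m1 q m2 + tri_int m3 m2 s + tri_int m1 m2 m3.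
  rewrite /tri_int (seg_int_split Kp Kq half01) (seg_int_split Kq Ks half01).
  rewrite (seg_int_split Ks Kp half01) -/(mid p q) -/(mid q s) -/(mid s p) -/m1 -/m2 -/m3.
  rewrite (seg_int_rev Km1 Km3) (seg_int_rev Km1 Km2) (seg_int_rev Km2 Km3).
  by ring.
set h : C := (2^-1 : R)%:C.
have h2 : h + h = 1 by rewrite /h -rcD -div1r -splitr.
have hE : 1 - h = h by rewrite -h2 addrK.
have half (u : C) : u = h * u + h * u by rewrite -mulrDl h2 mul1r.
have small y d : nm (tri_int p q s) <= 4 * nm (tri_int y.1.1 y.1.2 y.2) ->
    (small_tri d (p, q, s) -> small_tri (d / 2) y /\ nm (y.1.1 - p) <= d / 2) ->
    small_tri d (p, q, s) -> [/\ small_tri (d / 2) y, nm (y.1.1 - p) <= d / 2 &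
      nm (tri_int p q s) <= 4 * nm (tri_int y.1.1 y.1.2 y.2)].
  by move=> ? H /H[].
have e1 : m1 - p = h * (q - p) by rewrite /m1 /mid /seg -/h; ring.
have e1' : q - m1 = h * (q - p).
  by rewrite -[in RHS]hE /m1 /mid /seg -/h; ring.
have e2 : m2 - q = h * (s - q) by rewrite /m2 /mid /seg -/h; ring.
have e2' : s - m2 = h * (s - q).
  by rewrite -[in RHS]hE /m2 /mid /seg -/h; ring.
have e3 : m3 - s = h * (p - s) by rewrite /m3 /mid /seg -/h; ring.
have e3' : p - m3 = h * (p - s).
  by rewrite -[in RHS]hE /m3 /mid /seg -/h; ring.
have e4 : m2 - m1 = h * (s - p).
  have -> : m2 - m1 = (m2 - q) + (q - m1) by ring.
  by rewrite e1' e2; ring.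
have e5 : m3 - m2 = h * (p - q).
  have -> : m3 - m2 = (m3 - s) + (s - m2) by ring.
  by rewrite e2' e3; ring.
have e6 : m1 - m3 = h * (q - s).
  have -> : m1 - m3 = (m1 - p) + (p - m3) by ring.
  by rewrite e3' e1; ring.
have H d u : nm u <= d -> nm (h * u) <= d / 2 by move=> ud; rewrite nm_half ler_pM2r.
have [L|L1] := lerP (nm (tri_int p q s)) (4 * nm (tri_int p m1 m3)).
  exists (p, m1, m3) => d; apply: small => // -[_ _ /= Hqp Hsq Hps].
  split; last by rewrite subrr nm0 divr_ge0// (le_trans _ Hqp)// nm_ge0.
  by split => //=; rewrite ?e1 ?e3' 1?nm_distC ?e6; apply: H => //; rewrite nm_distC.
have [L|L2] := lerP (nm (tri_int p q s)) (4 * nm (tri_int m1 q m2)).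
  exists (m1, q, m2) => d; apply: small => // -[_ _ /= Hqp Hsq Hps].
  split; last by rewrite e1; exact: H.
  split => //=; rewrite ?e1' ?e2; try exact: H.
  by rewrite nm_distC e4; apply: H; rewrite nm_distC.
have [L|L3] := lerP (nm (tri_int p q s)) (4 * nm (tri_int m3 m2 s)).
  exists (m3, m2, s) => d; apply: small => // -[_ _ /= Hqp Hsq Hps].
  split; last by rewrite nm_distC e3'; exact: H.
  split => //=; rewrite ?e2' ?e3; try exact: H.
  by rewrite nm_distC e5; apply: H; rewrite nm_distC.
exists (m1, m2, m3) => d; apply: small.
  have := nmD (tri_int p m1 m3 + tri_int m1 q m2 + tri_int m3 m2 s) (tri_int m1 m2 m3).
  have := nmD (tri_int p m1 m3 + tri_int m1 q m2) (tri_int m3 m2 s).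
  have := nmD (tri_int p m1 m3) (tri_int m1 q m2).
  rewrite -E /=; lra.
move=> -[_ _ /= Hqp Hsq Hps]; split; last by rewrite e1; exact: H.
by split => //=; rewrite ?e4 ?e5 ?e6; apply: H => //; rewrite nm_distC.
Qed.

End on_a_convex_set.

End segment_integrals.

(** * Goursat's theorem and the mean value argument *)

Section goursat.
Variable R : realType.
Local Notation C := R[i].
Implicit Types (G F : C -> C) (p q s a z w : C).

(** The affine part of [G] at [c] has a primitive and contributes nothing around a triangle. The
    sides stay within [3 * d] of [c], so the remainder contributes at most [e * (3 * d) * d] on each
    of the three sides. *)
Lemma tri_int_small G (K : set C) p q s c d (e : R) : cconvex K ->
  (forall z, K z -> cont_at G z) -> K p -> K q -> K s -> 0 <= e ->
  small_tri K d (p, q, s) -> nm (c - p) <= d ->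
  (exists g, forall z, nm (z - c) <= 3 * d ->
    nm (G z - G c - g * (z - c)) <= e * nm (z - c)) ->
  nm (tri_int G p q s) <= 9 * e * d ^+ 2.
Proof.
move=> Kc cG Kp Kq Ks e0 [_ _ /= Hqp Hsq Hps] cp [g gH].
have d0 : 0 <= d by exact: le_trans (nm_ge0 _) cp.
pose A z := G c + g * (z - c); pose Q z := G c * z + g * (z - c) ^+ 2 / 2.
have dQ z : cder Q z (A z).
  have -> : A z = (0 * z + G c * 1) + ((1 - 0) * (z - c) + (z - c) * (1 - 0)) * (g / 2) +
      (z - c) ^+ 2 * 0 by rewrite /A; field.
  rewrite -addrA; have -> : Q = fun z => G c * z + (z - c) * (z - c) * (g / 2).
    by apply/funext => w; rewrite /Q; field.
  apply: cderD; first by apply: cderM; [exact: cder_cst|exact: cder_id].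
  rewrite expr2; apply: cderM; last exact: cder_cst.
  by apply: cderM; apply: cderB; (exact: cder_id || exact: cder_cst).
have edge x y : K x -> K y -> nm (x - p) <= d -> nm (y - x) <= d ->
    nm (seg_int G x y - (Q y - Q x)) <= e * (3 * d) * d.
  move=> Kx Ky xp yx; apply: le_trans (_ : e * (3 * d) * nm (y - x) <= _); last first.
    by apply: ler_wpM2l => //; rewrite !mulr_ge0.
  apply: (@seg_integral_bound _ G _ _ _ Q A); first exact: (seg_intP Kc cG).
  move=> t /andP[t0 t1]; split; first exact: dQ.
  have H : nm (seg x y t - c) <= 3 * d.
    have -> : seg x y t - c = t%:C * (y - x) + (x - p) - (c - p) by rewrite /seg; ring.
    apply: le_trans (nmB _ _) _.
    have := nmD (t%:C * (y - x)) (x - p); rewrite nmM nm_real ger0_norm//.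
    have : t * nm (y - x) <= 1 * d by rewrite ler_pM// nm_ge0.
    by lra.
  rewrite /A opprD addrA; apply: le_trans (gH _ H) _.
  by rewrite ler_wpM2l.
have H1 := edge _ _ Kp Kq (ltac:(by rewrite subrr nm0)) Hqp.
have H2 := edge _ _ Kq Ks Hqp Hsq.
have H3 := edge _ _ Ks Kp (ltac:(by rewrite nm_distC)) Hps.
have -> : tri_int G p q s = (seg_int G p q - (Q q - Q p)) + (seg_int G q s - (Q s - Q q)) +
  (seg_int G s p - (Q p - Q s)) by rewrite /tri_int; ring.
apply: le_trans (nmD _ _) _; apply: le_trans (lerD (le_trans (nmD _ _) (lerD H1 H2)) H3) _.
by rewrite le_eqVlt; apply/orP; left; apply/eqP; ring.
Qed.

Lemma goursat G (K : set C) p q s : cconvex K ->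
  (forall c, approached K c -> K c) -> (forall z, K z -> derivable G z 1) ->
  K p -> K q -> K s -> tri_int G p q s = 0.
Proof.
move=> Kc Kcl dG Kp Kq Ks.
have cG z : K z -> cont_at G z by move=> /dG; exact: derivable_cont.
have [f fP] := choice (tri_step Kc cG).
pose x n := iter n f (p, q, s).
pose d := nm (q - p) + nm (s - q) + nm (p - s).
have d0 : 0 <= d by rewrite !addr_ge0 ?nm_ge0.
have x0 : small_tri K d (x 0%N).
  have := nm_ge0 (q - p); have := nm_ge0 (s - q); have := nm_ge0 (p - s).
  by move=> ? ? ?; split => //=; rewrite /d; lra.
have xs n : small_tri K (d / 2 ^+ n) (x n).
  elim: n => [|n /fP[]]; first by rewrite expr0 divr1.
  by rewrite exprS invfM mulrCA mulrC.
pose T n := tri_int G (x n).1.1 (x n).1.2 (x n).2.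
have TN n : nm (T 0%N) <= 4 ^+ n * nm (T n).
  elim: n => [|n IH]; first by rewrite expr0 mul1r.
  apply: le_trans IH _; rewrite exprSr -mulrA ler_wpM2l// ?exprn_ge0//.
  by have [_ _] := fP _ _ (xs n).
have step n : nm ((x n.+1).1.1 - (x n).1.1) <= d / 2 ^+ n / 2 by have [] := fP _ _ (xs n).
(* The geometric sum is kept as a difference of two terms, so that the induction telescopes. *)
have far n m : nm ((x (n + m)%N).1.1 - (x n).1.1) <= d / 2 ^+ n - d / 2 ^+ (n + m).
  elim: m => [|m IH]; first by rewrite addn0 !subrr nm0.
  apply: le_trans (nm_distD ((x (n + m)%N).1.1) _ _) _.
  rewrite addnS; apply: le_trans (lerD (step (n + m)%N) IH) _.
  rewrite exprS invfM -(mulrC (2 ^+ _)^-1) mulrA.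
  by set y := d / 2 ^+ (n + m); set y' := d / 2 ^+ n; lra.
have [U [UU UF UFf Uinf]] := ultra_nat.
have [|c cl] := @ultra_cvg R _ U UU (fun n => (x n).1.1) (nm p + d).
  apply: Uinf; exists 0%N => n _ /=; have := far 0%N n; rewrite add0n expr0 divr1 /=.
  have := nm_lerB (x n).1.1 p; have : 0 <= d / 2 ^+ n by rewrite divr_ge0// exprn_ge0.
  by lra.
have cx n : nm (c - (x n).1.1) <= d / 2 ^+ n.
  apply: (cvg_nm_le _ cl); apply: Uinf; exists n => m /subnKC <-.
  by apply: le_trans (far n _) _; rewrite gerBl divr_ge0// exprn_ge0.
have Kcc : K c.
  apply: Kcl => e e0; have [n ne] := geometric_small d e0.
  have [[Kx _] _ _ _ _] := xs n; exists ((x n).1.1) => //.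
  by rewrite nm_distC; apply: le_lt_trans ne.
have /derivable_cderP[g /cder_epsP gH] := dG _ Kcc.
apply: nm0_eq0; apply/eqP; rewrite eq_le nm_ge0 andbT; apply/ler_addgt0Pl => e e0.
(* At depth [n] the factor [4 ^+ n] is compensated by the squared size, leaving [9 * d ^+ 2] times
   this tolerance, which is at most [e]; the [+ 1] covers [d = 0]. *)
rewrite addr0; have e'0 : 0 < e / (9 * d ^+ 2 + 1).
  by rewrite divr_gt0// ltr_wpDl// mulr_ge0// exprn_ge0.
have [r r0 rH] := gH _ e'0; have r30 : 0 < r / 3 by rewrite divr_gt0.
have [n ne] := geometric_small d r30; have [[K1 K2] K3 _ _ _] := xs n.
have := @tri_int_small G K _ _ _ c (d / 2 ^+ n) _ Kc cG K1 K2 K3 (ltW e'0).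
rewrite -!surjective_pairing => /(_ (xs n) (cx n)) H.
apply: le_trans (TN n) _.
apply: (@le_trans _ _ (4 ^+ n * (9 * (e / (9 * d ^+ 2 + 1)) * (d / 2 ^+ n) ^+ 2))).
  rewrite ler_wpM2l ?exprn_ge0//; apply: H; exists g => z zc; apply: rH.
  by apply: le_lt_trans zc _; move: ne; rewrite ltr_pdivlMr// [X in X < _]mulrC.
have -> : 4 ^+ n * (9 * (e / (9 * d ^+ 2 + 1)) * (d / 2 ^+ n) ^+ 2) =
    e * ((9 * d ^+ 2) / (9 * d ^+ 2 + 1)).
  have -> : 4 ^+ n = (2 ^+ n) ^+ 2 :> R by rewrite -exprM mulnC exprM; congr (_ ^+ _); ring.
  have D0 : 9 * d ^+ 2 + 1 != 0 by rewrite gt_eqF// ltr_wpDl// mulr_ge0// exprn_ge0.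
  have n0 : (2 : R) ^+ n != 0 by rewrite expf_neq0// pnatr_eq0.
  by field; rewrite D0 n0.
rewrite -[leRHS]mulr1 ler_pM2l// ler_pdivrMr ?mul1r ?lerDl//.
by rewrite ltr_wpDl// mulr_ge0// exprn_ge0.
Qed.

Lemma approached_le (A : set C) (f : C -> R) c (m : R) :
  (forall z, A z -> f z <= m) -> {for c, continuous f} -> approached A c -> f c <= m.
Proof.
move=> fm cf Ac; rewrite leNgt; apply/negP => lt.
have e0 : 0 < f c - m by rewrite subr_gt0.
move/cvgrPdist_lt: cf => /(_ _ e0)/nbhs_nmP[r r0 rH].
have [w Aw wr] := Ac _ r0; have := rH _ wr; have := fm _ Aw.
by rewrite ltr_norml => ? /andP[]; lra.
Qed.

Lemma cont_nm_sub a z : {for z, continuous (fun w => nm (w - a))}.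
Proof.
by apply: (@continuous_nm _ _ (fun w : C => w - a)); exact: cont_subc.
Qed.

Lemma cconvexI (A B : set C) : cconvex A -> cconvex B -> cconvex (A `&` B).
Proof. by move=> cA cB p q [Ap Bp] [Aq Bq] t t01; split; [exact: cA|exact: cB]. Qed.

Lemma convex_ball a (r : R) : cconvex [set z : C | nm (z - a) < r].
Proof.
move=> p q /= pr qr t t01; pose m := Num.max (nm (p - a)) (nm (q - a)).
have pm : nm (p - a) <= m by rewrite le_max lexx.
have qm : nm (q - a) <= m by rewrite le_max lexx orbT.
by apply: le_lt_trans (convex_closed_ball pm qm t01) _; rewrite gt_max pr.
Qed.

(** At the vertex [a], [G] is only assumed continuous. The last hypothesis places [q], like [p],
    strictly on the positive side of the line through [a] orthogonal to [p - a]; a smaller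
    half-plane then holds what remains after the cut, in a convex set without [a]. *)
Lemma tri_int_center G a (r : R) p q : (forall z, nm (z - a) < r -> cont_at G z) ->
  (forall z, nm (z - a) < r -> z != a -> derivable G z 1) ->
  nm (p - a) < r -> nm (q - a) < r -> nm (q - p) < nm (p - a) -> tri_int G a p q = 0.
Proof.
move=> cG dG pr qr qp.
pose B := [set z | nm (z - a) < r].
have Bc : cconvex B := @convex_ball a r.
have cB z : B z -> cont_at G z := @cG z.
have Ba : B a by rewrite /B /= subrr nm0; apply: le_lt_trans pr; exact: nm_ge0.
have pa0 : 0 < nm (p - a) by apply: le_lt_trans qp; exact: nm_ge0.
pose n := (p - a)^*%C; pose l z := Re (n * (z - a)).
have lp : 0 < l p by rewrite /l Re_conjM exprn_gt0.
have lq : 0 < l q.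
  have -> : l q = nm (p - a) ^+ 2 + Re (n * (q - p)).
    by rewrite /l -Re_conjM -ReD -mulrDr; congr (Re (_ * _)); ring.
  have : - Re (n * (q - p)) <= nm (p - a) * nm (q - p).
    by rewrite -(nm_conj (p - a)) -nmM; apply: le_trans (nm_Re _); rewrite -normrN ler_norm.
  by have := ltr_pM2l pa0 (nm (q - p)) (nm (p - a)); rewrite qp -expr2; lra.
(* the corner at [a] is cut off by homothety, what remains avoids [a] *)
have cut (e : R) : 0 < e <= 1 -> tri_int G a p q = tri_int G a (seg a p e) (seg a q e).
  move=> /andP[e0 e1]; have e01 : 0 <= e <= 1 by rewrite ltW.
  pose m := e * Num.min (l p) (l q).
  have m0 : 0 < m by rewrite mulr_gt0// lt_min lp.
  pose rho := Num.max (nm (p - a)) (nm (q - a)).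
  pose K := [set z | nm (z - a) <= rho] `&` [set z | m <= l z].
  have Kc : cconvex K.
    by apply: cconvexI; [exact: convex_closed_ball|exact: convex_half_plane].
  have Kcl c : approached K c -> K c.
    move=> Kc'; split; first by apply: (approached_le _ (@cont_nm_sub a c) Kc') => z [].
    rewrite /mkset -lerN2; apply: (@approached_le K (fun z => - l z) c) => //.
      by move=> z [_]; rewrite /mkset lerN2.
    apply: continuousN; apply: (@continuous_Re _ _ (fun z => n * (z - a))).
    apply: contM; first exact: cont_cst.
    exact: cont_subc.
  have KB z : K z -> B z /\ z != a.
    move=> [zr zm]; split; first by apply: le_lt_trans zr _; rewrite gt_max pr.
    by apply: contraTneq zm => ->; rewrite /mkset /l subrr mulr0 -ltNge.
  have KdG z : K z -> derivable G z 1 by move=> /KB[]; exact: dG.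
  have lseg z : l (seg a z e) = e * l z.
    by rewrite /l -ReZ; congr Re; rewrite /seg; ring.
  have nmseg z : nm (seg a z e - a) <= nm (z - a).
    have -> : seg a z e - a = e%:C * (z - a) by rewrite /seg; ring.
    by rewrite nmM nm_real ger0_norm ?(ltW e0)// -[leRHS]mul1r ler_wpM2r// nm_ge0.
  have m1 : m <= e * l p by rewrite ler_pM2l// ge_min lexx.
  have m2 : m <= e * l q by rewrite ler_pM2l// ge_min lexx orbT.
  have Kp : K p.
    by split => /=; [rewrite le_max lexx|apply: le_trans m1 _; rewrite ger_pMl].
  have Kq : K q.
    by split => /=; [rewrite le_max lexx orbT|apply: le_trans m2 _; rewrite ger_pMl].
  have Kp' : K (seg a p e).
    by split => /=; [rewrite le_max nmseg|rewrite lseg].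
  have Kq' : K (seg a q e).
    by split => /=; [rewrite le_max nmseg orbT|rewrite lseg].
  have T1 := goursat Kc Kcl KdG Kp' Kp Kq; have T2 := goursat Kc Kcl KdG Kp' Kq Kq'.
  have cK z : K z -> cont_at G z by move=> /KB[]/cB.
  move: T1 T2; rewrite /tri_int.
  rewrite (seg_int_split Bc cB Ba pr e01) (seg_int_rev Bc cB Ba qr).
  rewrite (seg_int_split Bc cB Ba qr e01).
  rewrite (seg_int_rev Kc cK Kp' Kq) (seg_int_rev Kc cK Kq' Kq) (seg_int_rev Kc cK Kp' Kq').
  rewrite (seg_int_rev Bc cB Ba (KB _ Kq').1).
  set x1 := seg_int G a _; set x2 := seg_int G _ p; set x3 := seg_int G p q.
  set x4 := seg_int G _ q; set x5 := seg_int G _ q; set x6 := seg_int G a _.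
  set x7 := seg_int G _ _ => T1 T2.
  have -> : x1 + x2 + x3 + - (x6 + x5) = x1 + x7 + - x6 + (x2 + x3 + - x4) + (x4 + - x5 + - x7).
    by ring.
  by rewrite T1 T2 !addr0.
have /continuous_nmP/(_ 1 ltr01)[dl dl0 dlH] := cB _ Ba.
pose M := nm (G a) + 1; have M0 : 0 <= M by rewrite addr_ge0 ?nm_ge0.
have edge x y : nm (x - a) < Num.min r dl -> nm (y - a) < Num.min r dl ->
    nm (seg_int G x y) <= M * nm (y - x).
  move=> xd yd; have bnd z : nm (z - a) < Num.min r dl -> B z /\ nm (z - a) < dl.
    by rewrite lt_min => /andP[].
  have -> : seg_int G x y = seg_int G x y - ((fun=> 0) y - (fun=> 0) x).
    by rewrite subrr subr0.
  apply: (@seg_integral_bound _ G _ _ _ (fun=> 0) (fun=> 0)).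
    by apply: (seg_intP Bc cB); [have [] := bnd _ xd|have [] := bnd _ yd].
  move=> t t01; split; first exact: cder_cst.
  have [_ /dlH] := bnd _ (convex_ball xd yd t01).
  by have := nm_lerB (G (seg x y t)) (G a); rewrite subr0 /M; lra.
have d0 : 0 < Num.min r dl by rewrite lt_min dl0 andbT (le_lt_trans _ pr)// nm_ge0.
apply: nm0_eq0; apply/eqP; rewrite eq_le nm_ge0 andbT leNgt; apply/negP => T0.
pose D := nm (p - a) + nm (q - a) + nm (q - p).
have D0 : 0 < D by rewrite /D -addrA ltr_wpDr// addr_ge0 ?nm_ge0.
have MD0 : 0 < M * D + 1 by rewrite ltr_wpDl// mulr_ge0// ltW.
(* The second bound keeps the shrunken triangle where [G] is bounded by [M]; the third makes its
   integral, at most [e * (M * D)], smaller than the integral supposed nonzero. *)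
pose e := Num.min 1 (Num.min (Num.min r dl / 2 / D) (nm (tri_int G a p q) / (M * D + 1) / 2)).
have e0 : 0 < e by rewrite !lt_min ltr01 !divr_gt0//; apply/and3P.
have e1 : e <= 1 by rewrite ge_min lexx.
have eD : e * D < Num.min r dl.
  have : e <= Num.min r dl / 2 / D by rewrite !ge_min lexx orbT.
  by rewrite ler_pdivlMr//; lra.
have eT : e * (M * D + 1) < nm (tri_int G a p q).
  have : e <= nm (tri_int G a p q) / 2 / (M * D + 1).
    by rewrite mulrAC !ge_min lexx !orbT.
  by rewrite ler_pdivlMr//; lra.
have segE z : seg a z e - a = e%:C * (z - a) by rewrite /seg; ring.
have nmseg z : nm (seg a z e - a) = e * nm (z - a).
  by rewrite segE nmM nm_real gtr0_norm.
have pD : e * nm (p - a) <= e * D.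
  by rewrite ler_pM2l// /D -addrA lerDl addr_ge0 ?nm_ge0.
have qD : e * nm (q - a) <= e * D.
  by rewrite ler_pM2l// /D addrAC lerDr addr_ge0 ?nm_ge0.
have H0 : nm (a - a) < Num.min r dl by rewrite subrr nm0.
have H1 : nm (seg a p e - a) < Num.min r dl by rewrite nmseg; apply: le_lt_trans eD.
have H2 : nm (seg a q e - a) < Num.min r dl by rewrite nmseg; apply: le_lt_trans eD.
have E1 := edge _ _ H0 H1; have E2 := edge _ _ H1 H2; have E3 := edge _ _ H2 H0.
have : nm (tri_int G a p q) <= e * (M * D).
  rewrite (cut e) ?e0// /tri_int; apply: le_trans (nmD _ _) _.
  apply: le_trans (lerD (le_trans (nmD _ _) (lerD E1 E2)) E3) _.
  rewrite nmseg (nm_distC a) nmseg.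
  have -> : seg a q e - seg a p e = e%:C * (q - p) by rewrite /seg; ring.
  rewrite nmM nm_real gtr0_norm// le_eqVlt; apply/orP; left; apply/eqP.
  by rewrite /D; ring.
by lra.
Qed.

(** Integration from the center [a] gives the primitive; only triangles with vertex [a] have to be
    closed. *)
Lemma primitive_off_center G a (r : R) : (forall z, nm (z - a) < r -> cont_at G z) ->
  (forall z, nm (z - a) < r -> z != a -> derivable G z 1) ->
  exists Phi, forall z, nm (z - a) < r -> cder Phi z (G z).
Proof.
move=> cG dG; exists (seg_int G a) => z zr.
have Bc := @convex_ball a r.
have Ba : nm (a - a) < r by rewrite subrr nm0; apply: le_lt_trans zr; exact: nm_ge0.
apply/cder_epsP => e e0; have /continuous_nmP/(_ e e0)[d d0 dH] := cG _ zr.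
(* Increments shorter than [nm (z - a)] meet the hypothesis of [tri_int_center]. For [z = a] the
   triangle degenerates and any positive value will do. *)
pose rho := Num.min d (Num.min (r - nm (z - a)) (if z == a then 1 else nm (z - a))).
have rho0 : 0 < rho.
  rewrite !lt_min d0 subr_gt0 zr /=; case: eqVneq => // za.
  by rewrite nm_gt0 subr_eq0.
exists rho => // w; rewrite !lt_min => /and3P[wd wr wza].
have wB : nm (w - a) < r by have := nm_distD z w a; lra.
have -> : seg_int G a w - seg_int G a z = seg_int G z w.
  have T0 : tri_int G a z w = 0.
    have [za|za] := eqVneq z a; last first.
      by apply: (tri_int_center cG dG) => //; rewrite (negPf za) in wza.
    rewrite za /tri_int (seg_int_rev Bc cG Ba wB) addrK.
    apply: (@seg_integral_unique _ G a a); first exact: (seg_intP Bc cG).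
    by exists (fun=> 0); rewrite ?subrr// => t _; rewrite mul0r; apply/rder_epsP => e' e'0;
      exists 1 => // s _; rewrite mulr0 !subrr nm0 mulr_ge0// ltW.
  move: T0; rewrite /tri_int (seg_int_rev Bc cG Ba wB).
  set x := seg_int G a z; set y := seg_int G z w; set v := seg_int G a w => T0.
  by rewrite -[v](_ : x + y - (x + y + - v) = v); [rewrite T0 subr0; ring|ring].
have -> : G z * (w - z) = G z * w - G z * z by ring.
apply: (@seg_integral_bound _ G _ _ _ (fun u => G z * u) (fun=> G z)).
  exact: (seg_intP Bc cG).
move=> t t01; split.
  have := cderM (cder_cst (G z) (seg z w t)) (cder_id (seg z w t)).
  by rewrite mul0r add0r mulr1.
have Hz : nm (z - z) < d by rewrite subrr nm0.
by apply/ltW/dH; exact: (convex_ball Hz wd t01).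
Qed.

Lemma slope_derivable F a d z : derivable F z 1 -> z != a -> derivable (slope F a d) z 1.
Proof.
move=> /derivable_cderP[d' zd'] za; apply/derivable_cderP.
have za0 : z - a != 0 by rewrite subr_eq0.
have := cderM (cderB zd' (cder_cst (F a) z))
  (@cderV _ (fun w => w - a) _ _ za0 (cderB (cder_id z) (cder_cst a z))).
set D := (X in cder _ _ X) => H; exists D; apply: cder_near H.
exists (nm (z - a)); first by rewrite nm_gt0.
move=> w wz; rewrite /slope ifN//; apply: contraTneq wz => ->.
by rewrite nm_distC ltxx.
Qed.

(* Periodicity of [Phi] along the circle, [Phi] a primitive of the difference
   quotient of [F] at [a], is the mean value property. *)
Lemma max_principle_center F a (r : R) v : (forall z, nm (z - a) < r -> derivable F z 1) ->
  nm v < r -> (forall z, nm (z - a) = nm v -> nm (F z) <= nm (F a)) ->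
  nm (F (a + v)) = nm (F a).
Proof.
move=> dF vr Fmax.
have Ba : nm (a - a) < r by rewrite subrr nm0; apply: le_lt_trans vr; exact: nm_ge0.
have /derivable_cderP[d ad] := dF _ Ba.
pose G := slope F a d.
have dG z : nm (z - a) < r -> z != a -> derivable G z 1.
  by move=> /dF dFz za; exact: slope_derivable.
have cG z : nm (z - a) < r -> cont_at G z.
  have [-> _|za zr] := eqVneq z a; first exact/cderP.
  by apply: derivable_cont; exact: dG.
have [Phi PhiH] := primitive_off_center cG dG.
pose g (t : R) : C := a + v * (cos t +i* sin t).
have nmg t : nm (g t - a) = nm v.
  rewrite /g addrAC subrr add0r nmM.
  by rewrite [X in _ * X](_ : _ = 1) ?mulr1// /nm /= cos2Dsin2 sqrtr1.
have rg t : rder g t ('i * (g t - a)).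
  have -> : 'i * (g t - a) = v * ((- sin t) +i* cos t).
    rewrite /g addrAC subrr add0r mulrCA; congr (_ * _).
    by apply/eqP; rewrite eq_complex /=; apply/andP; split; apply/eqP; ring.
  apply: (@rder_comp _ (fun z => a + v * z) (fun t => cos t +i* sin t)).
    by apply: rder_ReIm.
  have := cderD (cder_cst a (cos t +i* sin t))
    (cderM (cder_cst v (cos t +i* sin t)) (cder_id (cos t +i* sin t))).
  by rewrite mul0r !add0r mulr1.
(* The factor cancels the ['i] from the speed of the circle, so the derivative along it is the real
   part of [(F a)^*%C * F] minus its value at the center, which is never positive. *)
pose c := - 'i * (F a)^*%C.
have du t : is_derive t (1 : R) (fun t => Re (c * Phi (g t)))
    (Re ((F a)^*%C * F (g t)) - nm (F a) ^+ 2).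
  have -> : Re ((F a)^*%C * F (g t)) - nm (F a) ^+ 2 = Re (c * (G (g t) * ('i * (g t - a)))).
    rewrite -Re_conjM -ReB -mulrBr; congr Re.
    have -> : G (g t) * ('i * (g t - a)) = 'i * (F (g t) - F a).
      by rewrite mulrCA /G -slope_eq.
    have ii : 'i * 'i = -1 :> C by rewrite -expr2 sqr_i.
    by rewrite /c mulrACA mulNr ii opprK mul1r.
  apply: rder_Re; apply: rder_comp; first exact: rg.
  by apply: PhiH; rewrite nmg.
have du0 t : Re ((F a)^*%C * F (g t)) - nm (F a) ^+ 2 <= 0.
  rewrite subr_le0 expr2; apply: le_trans (Re_le _) _; rewrite nmM nm_conj.
  by rewrite ler_wpM2l ?nm_ge0// Fmax// nmg.
have udec (t1 t2 : R) : t1 <= t2 -> Re (c * Phi (g t2)) <= Re (c * Phi (g t1)).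
  move=> st; have [x _ E] := real_MVT st (fun x _ => du x).
  by rewrite -subr_le0 E mulr_le0_ge0// subr_ge0.
have g2pi : g (pi *+ 2) = g 0 by rewrite /g cos2pi sin2pi cos0 sin0.
have ucst t : 0 <= t <= pi *+ 2 -> Re (c * Phi (g t)) = Re (c * Phi (g 0)).
  move=> /andP[t0 t1]; apply/eqP; rewrite eq_le udec//=.
  by rewrite -[X in Phi X]g2pi udec.
have g0 : g 0 = a + v.
  by rewrite /g cos0 sin0; congr (_ + _); rewrite -[RHS]mulr1.
have pi20 : 0 < (pi *+ 2 : R) by rewrite mulrn_wgt0// pi_gt0.
(* The function is nonincreasing and takes equal values at [0] and [2 pi], hence constant in
   between; increments to the right of [0] determine its derivative there. *)
have D0 : Re ((F a)^*%C * F (g 0)) - nm (F a) ^+ 2 = 0.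
  apply/eqP; rewrite -normr_eq0 eq_le normr_ge0 andbT; apply/ler_addgt0Pl => e e0.
  rewrite addr0; have /is_derive_epsP/(_ e e0)[x x0 xH] := du 0.
  pose y := Num.min (x / 2) (pi *+ 2).
  have y0 : 0 < y by rewrite lt_min pi20 divr_gt0.
  have := xH y; rewrite subr0 gtr0_norm// => /(_ _).
  rewrite ucst; last by rewrite ltW//= ge_min lexx orbT.
  rewrite subrr sub0r normrN normrM gtr0_norm// mulrC ler_pM2r//; apply.
  by rewrite gt_min ltr_pdivrMr// ltr_pMr// ltr1n.
have Fav : nm (F (a + v)) <= nm (F a) by apply: Fmax; rewrite addrAC subrr add0r.
apply: le_anti; rewrite Fav /=; have [->|Fa0] := eqVneq (F a) 0; first by rewrite nm0 nm_ge0.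
rewrite -(@ler_pM2l _ (nm (F a))) ?nm_gt0// -expr2.
move/subr0_eq: D0 => <-; apply: le_trans (Re_le _) _.
by rewrite nmM nm_conj g0.
Qed.

End goursat.

(** * The maximum principle, also with finitely many exceptional points *)

Section maximum_principle.
Variable R : realType.
Local Notation C := R[i].
Implicit Types (F G : C -> C) (a p q z w : C) (r M : R) (l : seq C).

(** Among the points of maximal modulus, [q] is taken farthest from [a]. If it were interior, a
    small circle around it would contain a point of maximal modulus still farther away. *)
Lemma max_principle F a r M : 0 < r ->
  (forall z, nm (z - a) <= r -> cont_at F z) ->
  (forall z, nm (z - a) < r -> derivable F z 1) ->
  (forall z, nm (z - a) = r -> nm (F z) <= M) ->
  forall z, nm (z - a) <= r -> nm (F z) <= M.
Proof.
move=> r0 cF dF FM.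
pose B := [set z | nm (z - a) <= r].
have Ba : B a by rewrite /B /= subrr nm0 ltW.
have Bbd z : B z -> nm z <= r + nm a.
  by rewrite /B /= => zr; have := nm_lerB z a; lra.
have Bcl c : approached B c -> B c.
  by move=> Bc; apply: (approached_le _ (@cont_nm_sub _ a c) Bc).
have [p Bp pmax] : exists2 p, B p & forall z, B z -> nm (F z) <= nm (F p).
  apply: (complex_EVT_max (f := fun z => nm (F z)) _ Bbd Bcl); first by exists a.
  by move=> z /cF; exact: continuous_nm.
pose A := [set z | B z /\ nm (F p) <= nm (F z)].
have [q [Bq Fq] qmax] : exists2 q, A q & forall z, A z -> nm (z - a) <= nm (q - a).
  apply: (@complex_EVT_max _ A (r + nm a) (fun z => nm (z - a))).
  - by exists p.
  - by move=> z [/Bbd].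
  - move=> c Ac; have Bc : B c by apply: Bcl => e /Ac[w [Bw _] wc]; exists w.
    split => //; rewrite -lerN2; apply: (@approached_le _ A (fun z => - nm (F z)) c) => //.
      by move=> z [_]; rewrite lerN2.
    by apply: continuousN; apply: continuous_nm; exact: cF.
  - by move=> z _; exact: cont_nm_sub.
move=> z zr; apply: le_trans (pmax _ zr) _; apply: (le_trans Fq).
move: Bq; rewrite /B /= le_eqVlt => /orP[/eqP/FM//|qr]; exfalso.
pose k := r - nm (q - a); have k0 : 0 < k by rewrite subr_gt0.
(* [v] points radially outwards from [a], in an arbitrary direction when [q = a]. *)
have [v vk vq] : exists2 v, nm v = k / 2 & nm (q + v - a) = nm (q - a) + k / 2.
  have [->|qa] := eqVneq q a.
    exists (k / 2)%:C; first by rewrite nm_real gtr0_norm// divr_gt0.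
    by rewrite addrAC subrr add0r nm0 add0r nm_real gtr0_norm// divr_gt0.
  have qa0 : 0 < nm (q - a) by rewrite nm_gt0 subr_eq0.
  exists ((k / 2 / nm (q - a))%:C * (q - a)).
    by rewrite nmM nm_real gtr0_norm ?divr_gt0// divfK// gt_eqF.
  have -> : q + (k / 2 / nm (q - a))%:C * (q - a) - a =
      (1 + k / 2 / nm (q - a))%:C * (q - a) by rewrite rcD rc1; ring.
  rewrite nmM nm_real gtr0_norm; last by rewrite addr_gt0// !divr_gt0.
  by rewrite mulrDl mul1r divfK// gt_eqF.
have inB w : nm (w - q) < k -> nm (w - a) < r.
  by move=> wk; have := nm_distD q w a; rewrite /k in wk; lra.
have vk' : nm v < k by rewrite vk ltr_pdivrMr// ltr_pMr// ltr1n.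
have /= E := @max_principle_center _ F q k v (fun w wk => dF _ (inB _ wk)) vk'.
have /E Fqv : forall w, nm (w - q) = nm v -> nm (F w) <= nm (F q).
  move=> w wv; apply: (le_trans _ Fq); apply: pmax; apply/ltW/inB; by rewrite wv.
have /qmax : A (q + v).
  split; last by rewrite Fqv.
  by apply/ltW/inB; rewrite addrAC subrr add0r.
by rewrite vq gerDl leNgt divr_gt0.
Qed.

Definition roots_poly l z : C := \prod_(x <- l) (z - x).

Lemma roots_poly_cder l z : exists d, cder (roots_poly l) z d.
Proof.
rewrite /roots_poly; elim: l => [|x l [d IH]].
  exists 0; have -> : (fun z => \prod_(x <- [::]) (z - x)) = (fun=> 1) :> (C -> C).
    by apply/funext => w; rewrite big_nil.
  exact: cder_cst.
exists ((1 - 0) * (\prod_(x <- l) (z - x)) + (z - x) * d).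
have -> : (fun z => \prod_(y <- x :: l) (z - y)) = (fun z => (z - x) * \prod_(y <- l) (z - y)).
  by apply/funext => w; rewrite big_cons.
by apply: cderM => //; apply: cderB; [exact: cder_id|exact: cder_cst].
Qed.

Lemma roots_poly_neq0 l z : z \notin l -> roots_poly l z != 0.
Proof.
rewrite /roots_poly; elim: l => [_|x l IH]; first by rewrite big_nil oner_neq0.
rewrite inE negb_or big_cons => /andP[zx /IH ?].
by rewrite mulf_neq0// subr_eq0.
Qed.

(** A simple zero absorbs the lack of a derivative: [F] itself is the Caratheodory factor of the
    product. *)
Lemma cder_mul_root F p : cont_at F p -> cder (fun z => (z - p) * F z) p (F p).
Proof.
by move=> cF; exists F; split => // w; rewrite subrr mul0r subr0 mulrC.
Qed.

Lemma avoid_seq l z : exists2 r : R, 0 < r &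
  forall w, w != z -> nm (w - z) < r -> w \notin l.
Proof.
elim: l => [|x l [r r0 rH]]; first by exists 1.
have [->|xz] := eqVneq x z.
  by exists r => // w wz /(rH _ wz); rewrite inE negb_or wz.
exists (Num.min r (nm (x - z))); first by rewrite lt_min r0 nm_gt0 subr_eq0.
move=> w wz; rewrite lt_min => /andP[/(rH _ wz) wl wx].
by rewrite inE negb_or wl andbT; apply: contraTneq wx => ->; rewrite ltxx.
Qed.

(* The exceptional points are cancelled by applying the maximum principle to
   [F ^ n * roots_poly l] and letting [n] tend to infinity. *)
Lemma max_principle_off l F a r M : 0 < r ->
  (forall z, nm (z - a) <= r -> cont_at F z) ->
  (forall z, nm (z - a) < r -> z \notin l -> derivable F z 1) ->
  (forall z, nm (z - a) = r -> nm (F z) <= M) ->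
  forall z, nm (z - a) <= r -> nm (F z) <= M.
Proof.
move=> r0 cF dF FM; pose W := roots_poly l.
have cW z : cont_at W z by have [d /cder_cont] := roots_poly_cder l z.
pose b := \prod_(x <- l) (r + nm (x - a)).
have Wb z : nm (z - a) <= r -> nm (W z) <= b.
  move=> zr; rewrite /W /b /roots_poly; elim: l {dF W cW b} => [|x l IH].
    by rewrite !big_nil nm1.
  rewrite !big_cons nmM ler_pM ?nm_ge0//.
  by have := nm_distD a z x; rewrite (nm_distC a x); lra.
have M0 : 0 <= M.
  apply: le_trans (nm_ge0 _) (FM (a + r%:C) _).
  by rewrite addrAC subrr add0r nm_real gtr0_norm.
have power n z : nm (z - a) <= r -> nm (F z) ^+ n * nm (W z) <= M ^+ n * b.
  move=> zr; rewrite -nmX -nmM.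
  apply: (@max_principle (fun z => F z ^+ n * W z) a r) => //.
  - by move=> w wr; apply: contM => //; apply: contX; exact: cF.
  - move=> w wr; apply/derivable_cderP.
    have [wl|wl] := boolP (w \in l); last first.
      have /derivable_cderP[d Fd] := dF _ wr wl.
      have [d1 d1P] := cderX n Fd; have [d2 d2P] := roots_poly_cder l w.
      by eexists; exact: cderM d1P d2P.
    have -> : (fun z => F z ^+ n * W z) =
        (fun z => (z - w) * (F z ^+ n * roots_poly (rem w l) z)).
      by apply/funext => u; rewrite /W /roots_poly (big_rem w)//= mulrCA.
    eexists; apply: cder_mul_root; apply: contM.
      by apply: contX; apply: cF; exact: ltW.
    by have [d /cder_cont] := roots_poly_cder (rem w l) w.
  - move=> w wr; rewrite nmM nmX ler_pM ?exprn_ge0 ?nm_ge0//.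
      by rewrite lerXn2r ?nnegrE ?nm_ge0// FM.
    by apply: Wb; rewrite wr.
have off z : nm (z - a) <= r -> z \notin l -> nm (F z) <= M.
  move=> zr zl; rewrite leNgt; apply/negP => Mz.
  have Fz0 : 0 < nm (F z) by exact: le_lt_trans Mz.
  have Wz0 : 0 < nm (W z) by rewrite nm_gt0 roots_poly_neq0.
  have := @cvg_geometric R b (M / nm (F z)).
  rewrite ger0_norm; last by rewrite divr_ge0// ltW.
  rewrite ltr_pdivrMr// mul1r => /(_ Mz).
  move=> /cvgrPdist_lt /(_ _ Wz0) [N _ /(_ N (leqnn N))] /=.
  rewrite sub0r normrN /geometric /= => /(le_lt_trans (ler_norm _)).
  rewrite expr_div_n mulrA ltr_pdivrMr ?exprn_gt0// ltNge.
  by have := power N z zr; rewrite mulrC [nm (W z) * _]mulrC [b * _]mulrC => ->.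
move=> z; rewrite le_eqVlt => /orP[/eqP/FM//|zr].
rewrite leNgt; apply/negP => Mz.
have e0 : 0 < nm (F z) - M by rewrite subr_gt0.
have /continuous_nmP/(_ _ e0)[d d0 dH] := cF _ (ltW zr).
have [k k0 kH] := avoid_seq l z.
have m0 : 0 < Num.min d (Num.min k (r - nm (z - a))) by rewrite !lt_min d0 k0 subr_gt0.
have [w wz] := punctured_nonempty z m0; rewrite !lt_min => /and3P[/dH wd wk wr].
have : nm (F w) <= M.
  by apply: off; [have := nm_distD z w a; lra|exact: kH].
by have := nm_lerB (F z) (F w); rewrite nm_distC; lra.
Qed.

End maximum_principle.

(** * Bounds on divided differences and Riemann's removable singularities *)

Section divided_differences.
Variable R : realType.
Local Notation C := R[i].
Implicit Types (F G : C -> C) (a p q z w : C) (r M : R) (l : seq C).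

(** [l] collects the nodes of successive divided differences, where continuity is known before
    differentiability. *)
Definition holo_off l G a r := (forall z, nm (z - a) <= r -> cont_at G z) /\
  (forall z, nm (z - a) < r -> z \notin l -> derivable G z 1).

Lemma slope_holo_off l G a r q d : holo_off l G a r -> cder G q d ->
  holo_off (q :: l) (slope G q d) a r.
Proof.
move=> [cG dG] Gq; split=> [z zr|z zr].
  have [->|zq] := eqVneq z q; first exact/cderP.
  have zq0 : z - q != 0 by rewrite subr_eq0.
  have H : cont_at (fun w => (G w - G q) / (w - q)) z.
    apply: contM; first by apply: contB; [exact: cG|exact: cont_cst].
    apply: (@contV _ _ (fun w => w - q)) => //.
    exact: cont_subc.
  apply: cont_near H; apply/nbhs_nmP; exists (nm (z - q)); first by rewrite nm_gt0.
  move=> w wz; rewrite /slope ifN//; apply: contraTneq wz => ->.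
  by rewrite nm_distC ltxx.
rewrite inE negb_or => /andP[zq zl]; apply: slope_derivable => //; exact: dG.
Qed.

(** By the maximum principle only the boundary circle matters; there the numerator is at most
    [2 * M] and the denominator at least [k]. *)
Lemma slope_bound l G a r (k : R) M q d : 0 < k -> 0 < r -> holo_off l G a r ->
  (forall z, nm (z - a) <= r -> nm (G z) <= M) -> nm (q - a) <= r - k -> cder G q d ->
  forall z, nm (z - a) <= r -> nm (slope G q d z) <= 2 * M / k.
Proof.
move=> k0 r0 hG GM qr Gq; have [cS dS] := slope_holo_off hG Gq.
apply: (max_principle_off r0 cS dS) => z zr.
have M0 : 0 <= M by apply: le_trans (nm_ge0 _) (GM z _); rewrite zr.
have kzq : k <= nm (z - q).
  by have := nm_distD q z a; rewrite zr; lra.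
have zq : z != q by apply: contraTneq kzq => ->; rewrite subrr nm0 -ltNge.
rewrite /slope ifN// nmf ler_pdivrMr ?nm_gt0 ?subr_eq0//.
apply: (@le_trans _ _ (2 * M)).
  have := nmB (G z) (G q); have : nm (G z) <= M by apply: GM; rewrite zr.
  have : nm (G q) <= M by apply: GM; lra.
  by lra.
by rewrite mulrAC ler_pdivlMr// ler_wpM2l// mulr_ge0.
Qed.

(** [slope_bound] applied to the slope itself bounds the second divided difference by
    [2 * (2 * M / k) / k]. *)
Lemma slope_lipschitz l G a r (k : R) M q p d d' z : 0 < k -> 0 < r -> holo_off l G a r ->
  (forall z, nm (z - a) <= r -> nm (G z) <= M) ->
  nm (q - a) <= r - k -> cder G q d -> nm (p - a) <= r - k -> cder G p d' -> p != q ->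
  nm (z - a) <= r -> nm (slope G q d z - slope G q d p) <= 4 * M / k ^+ 2 * nm (z - p).
Proof.
move=> k0 r0 hG GM qr Gq pr Gp pq zr.
have hS := slope_holo_off hG Gq; have SM := slope_bound k0 r0 hG GM qr Gq.
have /derivable_cderP[e Se] : derivable (slope G q d) p 1.
  by apply: slope_derivable => //; apply/derivable_cderP; exists d'.
have H := slope_bound k0 r0 hS SM pr Se zr.
rewrite (slope_eq (slope G q d) p e z) nmM ler_wpM2r ?nm_ge0//; apply: le_trans H _.
by rewrite le_eqVlt; apply/orP; left; apply/eqP; field; rewrite gt_eqF.
Qed.

(** A Lipschitz difference quotient has a limit at [p]. The explicit rate in the conclusion is what
    lets derivatives pass through pointwise limits. *)
Lemma lipschitz_slope_cder F p r (K : R) : 0 < r -> 0 <= K ->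
  (forall s t, s != p -> t != p -> nm (s - p) < r -> nm (t - p) < r ->
    nm ((F s - F p) / (s - p) - (F t - F p) / (t - p)) <= K * nm (s - t)) ->
  exists2 d, cder F p d & forall s, s != p -> nm (s - p) < r ->
    nm ((F s - F p) / (s - p) - d) <= K * nm (s - p).
Proof.
(* The shift by two puts every point, including the one of index 0, strictly inside the ball. *)
move=> r0 K0 H; pose x (n : nat) : C := p + (r / n.+2%:R)%:C.
have x_r n : 0 < r / n.+2%:R by rewrite divr_gt0.
have xn n : nm (x n - p) = r / n.+2%:R by rewrite addrAC subrr add0r nm_real gtr0_norm.
have xr n : nm (x n - p) < r by rewrite xn ltr_pdivrMr// ltr_pMr// ltr1n.
have xp n : x n != p by rewrite -subr_eq0 -nm_gt0 xn.
have [U [UU UF UFf Uinf]] := ultra_nat.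
pose D t := (F t - F p) / (t - p).
have [|d dl] := @ultra_cvg R _ U UU (fun n => D (x n)) (nm (D (x 0%N)) + K * (2 * r)).
  apply: Uinf; exists 0%N => n _ /=; have := H _ _ (xp n) (xp 0%N) (xr n) (xr 0%N).
  rewrite -!/(D _) => Dn; have := nm_lerB (D (x n)) (D (x 0%N)).
  have : K * nm (x n - x 0%N) <= K * (2 * r).
    rewrite ler_wpM2l//; have := nm_distD p (x n) (x 0%N).
    by have := xr n; have := xr 0%N; rewrite (nm_distC p); lra.
  by lra.
have key s : s != p -> nm (s - p) < r -> nm (D s - d) <= K * nm (s - p).
  move=> sp sr; apply/ler_addgt0Pl => e e0; rewrite (nm_distC (D s)).
  have e'0 : 0 < e / (K + 1) by rewrite divr_gt0// ltr_wpDl.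
  apply: (cvg_nm_le _ dl); apply: Uinf.
  have [N Nr] := invS_small (divr_gt0 e'0 r0).
  exists N => n Nn; rewrite (nm_distC (D (x n))); apply: le_trans (H _ _ sp (xp n) sr (xr n)) _.
  apply: (@le_trans _ _ (K * (nm (s - p) + e / (K + 1)))).
    rewrite ler_wpM2l//; apply: le_trans (nm_distD p _ _) _; rewrite lerD2l nm_distC xn.
    by rewrite mulrC -ler_pdivlMr//; exact: ltW (Nr _ (leqW Nn)).
  rewrite mulrDr addrC lerD2r mulrCA ger_pMr// ler_pdivrMr ?ltr_wpDl// mul1r.
  by rewrite lerDl.
exists d => //; apply/cder_epsP => e e0.
have K1 : 0 < K + 1 by rewrite ltr_wpDl.
exists (Num.min r (e / (K + 1))); first by rewrite lt_min r0 divr_gt0.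
move=> w; rewrite lt_min => /andP[wr we].
have [->|wp] := eqVneq w p; first by rewrite !subrr mulr0 subr0 nm0 mulr0.
have wp0 : w - p != 0 by rewrite subr_eq0.
have -> : F w - F p - d * (w - p) = (D w - d) * (w - p) by rewrite /D; field.
rewrite nmM ler_wpM2r ?nm_ge0//; apply: le_trans (key _ wp wr) _.
move: we; rewrite ltr_pdivlMr// mulrDr mulr1 mulrC => we.
by have := nm_ge0 (w - p); lra.
Qed.

Lemma bounded_on_closed_ball F a r : (forall z, nm (z - a) <= r -> cont_at F z) ->
  exists2 M, 0 <= M & forall z, nm (z - a) <= r -> nm (F z) <= M.
Proof.
move=> cF; have [r0|r0] := ltP r 0.
  by exists 0 => // z zr; have := nm_ge0 (z - a); lra.
have [p Bp pmax] : exists2 p, nm (p - a) <= r &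
    forall z, nm (z - a) <= r -> nm (F z) <= nm (F p).
  apply: (@complex_EVT_max _ [set z | nm (z - a) <= r] (r + nm a) (fun z => nm (F z))).
  - by exists a; rewrite /= subrr nm0.
  - by move=> z /= zr; have := nm_lerB z a; lra.
  - by move=> c Bc; apply: (approached_le _ (@cont_nm_sub _ a c) Bc).
  - by move=> z /cF; exact: continuous_nm.
by exists (nm (F p)); rewrite ?nm_ge0.
Qed.

(** The Lipschitz bound for the difference quotient holds at every node [q] other than [p], where
    [F] is differentiable. By continuity of [F] it survives as [q] tends to [p]. *)
Lemma riemann_removable F p r : 0 < r -> (forall z, nm (z - p) < r -> cont_at F z) ->
  (forall z, nm (z - p) < r -> z != p -> derivable F z 1) -> derivable F p 1.
Proof.
move=> r0 cF dF; pose r' := r / 2; pose k := r' / 2.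
have r'0 : 0 < r' by rewrite divr_gt0.
have k0 : 0 < k by rewrite divr_gt0.
have r'r z : nm (z - p) <= r' -> nm (z - p) < r by rewrite /r' => ?; lra.
have hF : holo_off [:: p] F p r'.
  by split=> [z /r'r/cF//|z /ltW/r'r zr]; rewrite inE => zp; exact: dF.
have [M M0 FM] := @bounded_on_closed_ball F p r' (fun z zr => cF _ (r'r z zr)).
have k2 : 0 < k ^+ 2 by rewrite exprn_gt0.
apply/derivable_cderP; have [||//|d dP _] := @lipschitz_slope_cder F p k (4 * M / k ^+ 2).
- by [].
- by rewrite divr_ge0 ?mulr_ge0// ltW.
- move=> s t sp tp sr tr.
  have rk : r' - k = k by rewrite /k; lra.
  have kr z : nm (z - p) < k -> nm (z - p) <= r' - k by rewrite rk => /ltW.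
  have dd q : q != p -> q != s -> q != t -> nm (q - p) < k ->
      nm ((F s - F q) / (s - q) - (F t - F q) / (t - q)) <= 4 * M / k ^+ 2 * nm (s - t).
    move=> qp qs qt qr; have kr' z : nm (z - p) < k -> nm (z - p) < r.
      by rewrite /k /r' => ?; lra.
    have /derivable_cderP[d1 qd] := dF _ (kr' _ qr) qp.
    have /derivable_cderP[d2 td] := dF _ (kr' _ tr) tp.
    have tq : t != q by rewrite eq_sym.
    have sr' : nm (s - p) <= r' by rewrite /k in sr; lra.
    have := slope_lipschitz k0 r'0 hF FM (kr _ qr) qd (kr _ tr) td tq sr'.
    by rewrite /slope (negPf tq) eq_sym (negPf qs).
  have [st|st] := eqVneq s t.
    by rewrite st !subrr nm0 mulr0.
  rewrite leNgt; apply/negP => lt.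
  have sp0 : s - p != 0 by rewrite subr_eq0.
  have tp0 : t - p != 0 by rewrite subr_eq0.
  have [m m0 mH] := avoid_seq [:: s; t] p.
  have [n n0 nH] : exists2 n : R, 0 < n & forall q, nm (q - p) < n ->
      4 * M / k ^+ 2 * nm (s - t) < nm ((F s - F q) / (s - q) - (F t - F q) / (t - q)).
    have cq : cont_at (fun q => (F s - F q) / (s - q) - (F t - F q) / (t - q)) p.
      have cFp : cont_at F p by apply: cF; rewrite subrr nm0.
      apply: contB; apply: contM; (try by apply: contB => //; exact: cont_cst).
        by apply: (@contV _ _ (fun q => s - q)) => //; apply: contB; [exact: cont_cst|exact: cont_id].
      by apply: (@contV _ _ (fun q => t - q)) => //; apply: contB; [exact: cont_cst|exact: cont_id].
    move: lt; move/continuous_nmP : cq.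
    set Y := 4 * M / _ * _; set Z' := (F s - F p) / _ - _ => cq lt.
    have [|n n0 nH] := cq (nm Z' - Y); first by rewrite subr_gt0.
    exists n => // q /nH; set Z := (F s - F q) / _ - _.
    by have := nm_lerB Z' Z; rewrite (nm_distC Z'); lra.
  have e0 : 0 < Num.min m (Num.min n k) by rewrite !lt_min m0 n0.
  have [q qp] := punctured_nonempty p e0; rewrite !lt_min => /and3P[qm qn qk].
  have := mH _ qp qm; rewrite !inE negb_or => /andP[qs qt].
  by have := nH _ qn; rewrite ltNge dd.
by exists d.
Qed.

End divided_differences.

(** * Uniform estimates on balls and their passage to the limit *)

Section local_theory.
Variable R : realType.
Local Notation C := R[i].
Implicit Types (F G f g : C -> C) (a p q z w d : C) (r M : R).

Definition holo_ball f a r := forall z, nm (z - a) < r -> derivable f z 1.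

Lemma holo_ball_off f a r rho : holo_ball f a r -> rho < r -> holo_off [::] f a rho.
Proof.
move=> hf rr; split=> [z zr|z zr _]; last by apply: hf; lra.
by apply: derivable_cont; apply: hf; lra.
Qed.

Lemma slope_derivable_at f p r d : 0 < r -> holo_ball f p r -> cder f p d ->
  holo_ball (slope f p d) p r.
Proof.
move=> r0 hf fp z zr; have [->|zp] := eqVneq z p; last by apply: slope_derivable => //; exact: hf.
have dS w : nm (w - p) < r -> w != p -> derivable (slope f p d) w 1.
  by move=> /hf fw wp; exact: slope_derivable.
apply: (riemann_removable r0) => // w wr.
have [->|wp] := eqVneq w p; first exact/cderP.
by apply: derivable_cont; exact: dS.
Qed.

Section uniform_estimates.
Variables (f : C -> C) (a : C) (r M : R).
Hypotheses (r0 : 0 < r) (hf : holo_ball f a r) (fM : forall z, nm (z - a) < r -> nm (f z) <= M).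

Let fM' z : nm (z - a) <= r / 2 -> nm (f z) <= M.
Proof. by move=> zr; apply: fM; have := r0; lra. Qed.

Let hf' : holo_off [::] f a (r / 2).
Proof. by apply: holo_ball_off hf _; have := r0; lra. Qed.

(** Everything is done on the ball of radius [r / 2] with margin [r / 4]: the constants here and
    below are [2 * M / (r / 4)] and [4 * M / (r / 4) ^+ 2]. *)
Lemma bounded_holo_lipschitz z w : nm (z - a) < r / 4 -> nm (w - a) < r / 4 ->
  nm (f z - f w) <= 8 * M / r * nm (z - w).
Proof.
move=> zr wr; have k0 : 0 < r / 4 by rewrite divr_gt0.
have r20 : 0 < r / 2 by rewrite divr_gt0.
have /derivable_cderP[d fw] : derivable f w 1 by apply: hf; lra.
rewrite (slope_eq f w d z) nmM ler_wpM2r ?nm_ge0//.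
apply: le_trans (slope_bound k0 r20 hf' fM' _ fw _) _; [lra|lra|].
by rewrite le_eqVlt; apply/orP; left; apply/eqP; field; rewrite gt_eqF.
Qed.

Lemma bounded_holo_dd s t q : q != s -> q != t -> nm (q - a) < r / 4 ->
  nm (s - a) < r / 4 -> nm (t - a) < r / 4 ->
  nm ((f s - f q) / (s - q) - (f t - f q) / (t - q)) <= 64 * M / r ^+ 2 * nm (s - t).
Proof.
move=> qs qt qr sr tr; have k0 : 0 < r / 4 by rewrite divr_gt0.
have r20 : 0 < r / 2 by rewrite divr_gt0.
have /derivable_cderP[d1 qd] : derivable f q 1 by apply: hf; lra.
have /derivable_cderP[d2 td] : derivable f t 1 by apply: hf; lra.
have tq : t != q by rewrite eq_sym.
have := @slope_lipschitz _ [::] f a (r / 2) (r / 4) M q t d1 d2 s k0 r20 hf' fM' _ qd _ td tq _.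
rewrite /slope (negPf tq) eq_sym (negPf qs) => H; apply: le_trans (H _ _ _) _; [lra..|].
rewrite ler_wpM2r ?nm_ge0// le_eqVlt; apply/orP; left; apply/eqP.
by field; rewrite gt_eqF.
Qed.

Lemma bounded_holo_derivative d s : cder f a d -> s != a -> nm (s - a) < r / 4 ->
  nm ((f s - f a) / (s - a) - d) <= 64 * M / r ^+ 2 * nm (s - a).
Proof.
move=> fa sa sr; have M0 : 0 <= M.
  by apply: le_trans (nm_ge0 _) (fM (z := a) _); rewrite subrr nm0.
have K0 : 0 <= 64 * M / r ^+ 2 by rewrite divr_ge0 ?exprn_ge0 ?mulr_ge0// ltW.
have r40 : 0 < r / 4 by rewrite divr_gt0.
have [|d' fd' H] := @lipschitz_slope_cder _ f a (r / 4) _ r40 K0.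
  by move=> u v ua va ur vr; apply: bounded_holo_dd => //; rewrite 1?eq_sym// subrr nm0.
by rewrite (cder_unique fa fd'); exact: H.
Qed.

End uniform_estimates.

Section ultralimits.
Variables (T : Type) (U : set_system T) (f : T -> C -> C) (g : C -> C) (a : C) (r M : R).
Hypotheses (UU : UltraFilter U) (r0 : 0 < r).
Hypothesis hf : U [set i | holo_ball (f i) a r /\ forall z, nm (z - a) < r -> nm (f i z) <= M].
Hypothesis fg : forall z, nm (z - a) < r -> f i z @[i --> U] --> g z.

Let UF : ProperFilter U. Proof. exact: ultra_proper. Qed.
Let UFf : Filter U. Proof. exact: filter_filter. Qed.

(** The rate at which difference quotients approach the derivative does not depend on [i], so the
    limits over [i] and over the increment can be exchanged. *)
Lemma ultralimit_cder (D : T -> C) : U [set i | cder (f i) a (D i)] ->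
  exists2 d, cder g a d & D i @[i --> U] --> d.
Proof.
move=> fD; have M0 : 0 <= M.
  have [i [_ iM]] := filter_ex hf.
  by apply: le_trans (nm_ge0 _) (iM a _); rewrite subrr nm0.
have r40 : 0 < r / 4 by rewrite divr_gt0.
have r4r z : nm (z - a) < r / 4 -> nm (z - a) < r by have := r0; lra.
set K := 64 * M / r ^+ 2.
have K0 : 0 <= K by rewrite divr_ge0 ?exprn_ge0 ?mulr_ge0// ltW.
have Ba : nm (a - a) < r / 4 by rewrite subrr nm0.
pose dd F s := (F s - F a) / (s - a).
have ddl s : s != a -> nm (s - a) < r / 4 -> dd (f i) s @[i --> U] --> dd g s.
  move=> sa sr; apply: cvgM; last exact: cvg_cst.
  by apply: cvgB; apply: fg; exact: r4r.
have [|d gd gH] := @lipschitz_slope_cder _ g a (r / 4) K r40 K0.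
  move=> s t sa ta sr tr; rewrite -/(dd g s) -/(dd g t) -[X in nm X]subr0.
  apply: (@cvg_nm_le _ _ U _ (fun i => dd (f i) s - dd (f i) t)).
    exact (cvgB (ddl s sa sr) (ddl t ta tr)).
  apply: filterS hf => i [hi iM]; rewrite subr0 /=.
  by apply: (bounded_holo_dd r0 hi iM) => //; rewrite eq_sym.
exists d => //; apply/cvg_nmP => e e0.
have K1 : 0 < 3 * (K + 1) by rewrite mulr_gt0// ltr_wpDl.
have m0 : 0 < Num.min (r / 4) (e / (3 * (K + 1))) by rewrite lt_min r40 divr_gt0.
have [s sa] := punctured_nonempty a m0; rewrite lt_min => /andP[sr se].
have e30 : 0 < e / 3 by rewrite divr_gt0.
have Ks : K * nm (s - a) <= e / 3.
  move: se; rewrite ltr_pdivlMr// => se.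
  by have := nm_ge0 (s - a); lra.
move/cvg_nmP : (ddl s sa sr) => /(_ _ e30) ddU.
apply: filterS (filterI hf (filterI fD ddU)) => i [[hi iM] [/= iD ids]].
have H1 := bounded_holo_derivative r0 hi iM iD sa sr.
have H2 := gH _ sa sr.
have H3 := nm_distD (dd (f i) s) (D i) d; have H4 := nm_distD (dd g s) (dd (f i) s) d.
rewrite -/(dd (f i) s) -/K in H1; rewrite -/(dd g s) in H2.
by rewrite (nm_distC (D i) (dd (f i) s)) in H3; lra.
Qed.

Lemma ultralimit_derivable : derivable g a 1.
Proof.
have H i : exists d, derivable (f i) a 1 -> cder (f i) a d.
  by have [/derivable_cderP[d ?]|?] := pselect (derivable (f i) a 1); [exists d|exists 0].
have [D DP] := choice H; have [|d gd _] := @ultralimit_cder D.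
  apply: filterS hf => i [hi _]; apply: DP; apply: hi.
  by rewrite subrr nm0.
by apply/derivable_cderP; exists d.
Qed.

End ultralimits.

End local_theory.

(** * Zeros, open mapping, inverse functions and Hurwitz's theorem *)

Section zeros_and_open_maps.
Variable R : realType.
Local Notation C := R[i].
Implicit Types (F G f g h : C -> C) (a p q z w d : C) (r M : R).

(** In place of a power series: if the zeros accumulate at [a], the root [z - a] can be factored out
    any number of times. The maximum principle for the cofactor then bounds [f] by
    [M * (nm (z - a) / rho) ^+ n] for all [n]. *)
Lemma isolated_zeros f a r : 0 < r -> holo_ball f a r ->
  (forall z, nm (z - a) < r -> f z = 0) \/
  exists2 e, 0 < e & forall z, z != a -> nm (z - a) < e -> f z != 0.
Proof.
move=> r0 hf; set P := (X in _ \/ X); have [?|nP] := pselect P; first by right.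
left; have pow n : exists2 g, holo_ball g a r & forall z, nm (z - a) < r -> f z = (z - a) ^+ n * g z.
  elim: n => [|n [g hg fg]]; first by exists f => // z _; rewrite expr0 mul1r.
  have Ba : nm (a - a) < r by rewrite subrr nm0.
  have [ga0|ga0] := eqVneq (g a) 0; last first.
    exfalso; apply: nP; have /continuous_nmP/(_ (nm (g a))) := derivable_cont (hg _ Ba).
    rewrite nm_gt0 => /(_ ga0)[e e0 eH]; exists (Num.min r e); first by rewrite lt_min r0.
    move=> z za; rewrite lt_min => /andP[zr /eH ze]; rewrite fg// mulf_neq0//.
      by rewrite expf_neq0// subr_eq0.
    by apply: contraTneq ze => ->; rewrite sub0r nmN ltxx.
  have /derivable_cderP[d gd] := hg _ Ba.
  exists (slope g a d); first exact: slope_derivable_at.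
  by move=> z zr; rewrite fg// exprSr -mulrA [_ * slope _ _ _ _]mulrC -slope_eq ga0 subr0.
move=> z zr; apply: nm0_eq0; apply/eqP; rewrite eq_le nm_ge0 andbT; apply/ler_addgt0Pl => e e0.
rewrite addr0; pose rho := (nm (z - a) + r) / 2.
have zrho : nm (z - a) < rho by rewrite /rho; lra.
have rhor : rho < r by rewrite /rho; lra.
have rho0 : 0 < rho by apply: le_lt_trans zrho; exact: nm_ge0.
have [cf _] := holo_ball_off hf rhor.
have [M M0 fM] := bounded_on_closed_ball cf.
have bound n : nm (f z) <= M * (nm (z - a) / rho) ^+ n.
  have [g hg fg] := pow n; rewrite fg// nmM nmX expr_div_n mulrCA ler_wpM2l ?exprn_ge0 ?nm_ge0//.
  have [cg _] := holo_ball_off hg rhor.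
  apply: (@max_principle _ g a rho) => //; last exact: ltW.
    by move=> w wr; apply: hg; lra.
  move=> w wr; rewrite ler_pdivlMr ?exprn_gt0// mulrC -{1}wr -nmX -nmM -fg ?fM ?wr//.
have := @cvg_geometric R M (nm (z - a) / rho).
rewrite ger0_norm; last by rewrite divr_ge0 ?nm_ge0// ltW.
rewrite ltr_pdivrMr// mul1r => /(_ zrho).
move=> /cvgrPdist_lt /(_ _ e0) [N _ /(_ N (leqnn N))] /=.
rewrite sub0r normrN /geometric /= => /(le_lt_trans (ler_norm _)) /ltW.
exact: le_trans (bound N).
Qed.

Lemma identity_principle f (U : set C) p : open U -> connected U -> holomorphic_on U f ->
  U p -> (exists2 r, 0 < r & forall z, nm (z - p) < r -> f z = 0) ->
  forall z, U z -> f z = 0.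
Proof.
move=> oU cU hf Up fp0; pose B := [set z | U z /\ exists2 r, 0 < r & forall w, nm (w - z) < r -> f w = 0].
have ball0 z r : nm (z - z) < r -> 0 < r by rewrite subrr nm0.
have zero z : B z -> f z = 0 by move=> [_ [r r0]]; apply; rewrite subrr nm0.
suff : B = U by move=> <-.
apply: cU.
- by exists p.
- exists B; last by rewrite setIC; apply/seteqP; split=> [z Bz|z []//]; split => //; case: Bz.
  apply/open_nmP => z [Uz [r r0 rH]].
  have [e e0 eH] := (open_nmP U).1 oU z Uz.
  exists (Num.min e (r / 2)); first by rewrite lt_min e0 divr_gt0.
  move=> w; rewrite lt_min => /andP[/eH Uw wr]; split => //.
  exists (r / 2); first by rewrite divr_gt0.
  by move=> v vw; apply: rH; have := nm_distD w v z; lra.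
- exists (closure B); first exact: closed_closure.
  apply/seteqP; split=> [z Bz|z [Uz Bz]].
    by split; [case: Bz|exact: subset_closure].
  have [e e0 eH] := (open_nmP U).1 oU z Uz.
  have hz : holo_ball f z e by move=> w /eH/hf.
  have [f0|[r r0 rH]] := isolated_zeros e0 hz; first by split => //; exists e.
  have [|w [Bw wr]] := Bz [set w | nm (w - z) < r]; first by apply/nbhs_nmP; exists r.
  have [wz|wz] := eqVneq w z; first by rewrite -wz.
  by have := rH _ wz wr; rewrite zero// eqxx.
Qed.

Lemma circle_min F a r : 0 < r -> (forall z, nm (z - a) = r -> cont_at F z) ->
  (forall z, nm (z - a) = r -> F z != 0) ->
  exists2 c, 0 < c & forall z, nm (z - a) = r -> c <= nm (F z).
Proof.
move=> r0 cF F0; have [p pr pmin] : exists2 p, nm (p - a) = r &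
    forall z, nm (z - a) = r -> - nm (F z) <= - nm (F p).
  apply: (@complex_EVT_max _ [set z | nm (z - a) = r] (r + nm a) (fun z => - nm (F z))).
  - by exists (a + r%:C); rewrite /= addrAC subrr add0r nm_real gtr0_norm.
  - by move=> z /= zr; have := nm_lerB z a; lra.
  - move=> c Bc; apply/eqP; rewrite eq_le.
    rewrite (approached_le _ (@cont_nm_sub _ a c) Bc); last by move=> z /= ->.
    rewrite -lerN2; apply: (@approached_le _ _ (fun z => - nm (z - a)) _ _ _ _ Bc).
      by move=> z /= ->.
    by apply: continuousN; exact: cont_nm_sub.
  - by move=> z /cF cFz; apply: continuousN; exact: continuous_nm.
exists (nm (F p)); first by rewrite nm_gt0 F0.
by move=> z /pmin; rewrite lerN2.
Qed.

(* If [f] omitted the value [v] near [f p], then [1 / (f - v)] would violate the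
   maximum principle. *)
Lemma open_map f p r rho : 0 < r -> r < rho -> holo_ball f p rho ->
  (forall z, nm (z - p) = r -> f z != f p) ->
  exists2 m, 0 < m & forall v, nm (v - f p) < m -> exists2 z, nm (z - p) < r & f z = v.
Proof.
move=> r0 rrho hf fp; have [cf _] := holo_ball_off hf rrho.
have [||c c0 cH] := @circle_min (fun z => f z - f p) p r r0.
- by move=> z zr; apply: contB; [apply: cf; rewrite zr|exact: cont_cst].
- by move=> z /fp; rewrite subr_eq0.
exists (c / 2); first by rewrite divr_gt0.
move=> v vm; have vc z : nm (z - p) = r -> c / 2 <= nm (f z - v).
  by move=> /cH; have := nm_distD v (f z) (f p); lra.
have [//|noz] := pselect (exists2 z, nm (z - p) < r & f z = v); exfalso.
have fv z : nm (z - p) <= r -> f z - v != 0.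
  rewrite le_eqVlt => /orP[/eqP/vc|zr].
    by apply: contraTneq => ->; rewrite nm0 -ltNge divr_gt0.
  by rewrite subr_eq0; apply/eqP => E; apply: noz; exists z.
have H := @max_principle _ (fun z => (f z - v)^-1) p r (2 / c) r0.
have : nm (f p - v)^-1 <= 2 / c.
  apply: H; last by rewrite subrr nm0 ltW.
  - move=> z zr; apply: (@contV _ _ (fun z => f z - v)); first exact: fv.
    by apply: contB; [exact: cf|exact: cont_cst].
  - move=> z zr; have /(derivable_subc (c := v))/derivable_cderP[d fd] := hf _ (lt_trans zr rrho).
    by apply/derivable_cderP; eexists; apply: (cderV _ fd); exact/fv/ltW.
  - move=> z zr; rewrite nmV -[2 / c]invrK invf_div lef_pV2 ?posrE ?divr_gt0//; first exact: vc.
    by rewrite nm_gt0 fv// zr.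
rewrite nmV -[2 / c]invrK invf_div lef_pV2 ?posrE ?divr_gt0 ?nm_gt0//; last first.
  by apply: fv; rewrite subrr nm0 ltW.
by rewrite nm_distC; lra.
Qed.

(** Openness of [f] on small balls: values close to [f p] are taken at points close to [p], and [g]
    returns those points. *)
Lemma inverse_cont f g p r : 0 < r -> holo_ball f p r ->
  (forall z, nm (z - p) < r -> g (f z) = z) -> cont_at g (f p).
Proof.
move=> r0 hf gf; have Bp : nm (p - p) < r by rewrite subrr nm0.
apply/continuous_nmP => e e0; pose s := Num.min (r / 2) (e / 2).
have s0 : 0 < s by rewrite lt_min !divr_gt0.
have sr : s < r.
  have : s <= r / 2 by rewrite ge_min lexx.
  by lra.
have se : s < e.
  have : s <= e / 2 by rewrite ge_min lexx orbT.
  by lra.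
have [z zs|m m0 mH] := @open_map f p s r s0 sr hf.
  apply: contraTneq s0 => fzp; have := gf z; rewrite fzp gf// zs => /(_ sr) zp.
  by rewrite -zs zp subrr nm0 ltxx.
exists m => // v /mH[z zs <-]; rewrite !gf//; [exact: lt_trans se|exact: lt_trans sr].
Qed.

(** If [phi] is the factor of [f], the factor of [g] is the inverse of [phi] composed with [g]. *)
Lemma inverse_cder f g p r d : 0 < r -> holo_ball f p r ->
  (forall z, nm (z - p) < r -> g (f z) = z) -> cder f p d -> d != 0 ->
  cder g (f p) d^-1.
Proof.
move=> r0 hf gf [phi [cphi phip E]] d0.
have Bp : nm (p - p) < r by rewrite subrr nm0.
have cg : cont_at g (f p) by exact: inverse_cont hf gf.
have phi0 : phi (g (f p)) != 0 by rewrite gf// phip.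
have cphig : cont_at (fun v => phi (g v)) (f p) by apply: cont_compC => //; rewrite gf.
have [m m0 mH] : exists2 m : R, 0 < m & forall v, nm (v - f p) < m ->
    exists2 z, nm (z - p) < r & f z = v.
  have r20 : 0 < r / 2 by rewrite divr_gt0.
  have r2r : r / 2 < r by lra.
  have [z zs|m m0 mH] := @open_map f p (r / 2) r r20 r2r hf.
    apply: contraTneq r20 => fzp; have := gf z; rewrite fzp gf// zs => /(_ r2r) zp.
    by rewrite -zs zp subrr nm0 ltxx.
  by exists m => // v /mH[z zs <-]; exists z => //; apply: lt_trans r2r.
apply/cderP; apply: (@cont_near _ _ (fun v => (phi (g v))^-1)); last exact: contV.
apply/nbhs_nmP; exists m => // v /mH[z zr <-]; rewrite /slope gf// (gf p)//.
have [fzp|fzp] := eqVneq (f z) (f p).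
  by have := gf z zr; rewrite fzp gf// => <-; rewrite phip.
have := E z; have fzp0 : f z - f p != 0 by rewrite subr_eq0.
move=> Ez; have : phi z * (z - p) != 0 by rewrite -Ez.
by rewrite mulf_eq0 negb_or => /andP[? zp]; rewrite Ez; field; apply/andP.
Qed.

(** Since [(s w - s z) * (s w + s z)] is the increment of [f], the factor of [s] is that of [f]
    divided by [s w + s z]. *)
Lemma sqrt_cder f s z d r : 0 < r -> (forall w, nm (w - z) < r -> s w ^+ 2 = f w) ->
  cont_at s z -> s z != 0 -> cder f z d -> cder s z (d / (2 * s z)).
Proof.
move=> r0 sf cs sz0 [phi [cphi phiz E]].
have ss0 : s z + s z != 0 by rewrite -mulr2n mulrn_eq0.
have css : cont_at (fun w => s w + s z) z by apply: contD => //; exact: cont_cst.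
have [e e0 eH] : exists2 e, 0 < e & forall w, nm (w - z) < e -> s w + s z != 0.
  have /continuous_nmP/(_ (nm (s z + s z))) := css; rewrite nm_gt0 => /(_ ss0)[e e0 eH].
  exists e => // w /eH; apply: contraTneq => ->; by rewrite sub0r nmN ltxx.
apply/cderP; apply: (@cont_near _ _ (fun w => phi w / (s w + s z))); last first.
  by apply: contM => //; exact: (@contV _ _ (fun w => s w + s z)).
apply/nbhs_nmP; exists (Num.min r e); first by rewrite lt_min r0.
move=> w; rewrite lt_min => /andP[wr /eH we]; rewrite /slope.
case: eqVneq => [->|wz]; first by rewrite phiz; field; apply/andP.
have wz0 : w - z != 0 by rewrite subr_eq0.
have sE : (s w - s z) * (s w + s z) = phi w * (w - z).
  by rewrite -E -!sf ?subrr ?nm0//; ring.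
have -> : phi w = (s w - s z) * (s w + s z) / (w - z) by rewrite sE mulfK.
by field; apply/andP.
Qed.

Section hurwitz.
Variables (T : Type) (U : set_system T) (f : T -> C -> C) (g : C -> C) (a : C) (r M : R).
Hypotheses (UU : UltraFilter U) (r0 : 0 < r).
Hypothesis hf : U [set i | [/\ holo_ball (f i) a r, forall z, nm (z - a) < r -> nm (f i z) <= M
  & forall z, nm (z - a) < r -> f i z != 0]].
Hypothesis fg : forall z, nm (z - a) < r -> f i z @[i --> U] --> g z.

Let UF : ProperFilter U. Proof. exact: ultra_proper. Qed.
Let UFf : Filter U. Proof. exact: filter_filter. Qed.

(** If [g a] were zero, the inverses of the [f i] would be large at [a] while bounded on a circle,
    against the maximum principle. *)
Lemma hurwitz : (exists2 e, 0 < e & forall z, z != a -> nm (z - a) < e -> g z != 0) ->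
  (forall z, nm (z - a) < r / 2 -> cont_at g z) -> g a != 0.
Proof.
move=> [e e0 eH] cg; pose s := Num.min (r / 8) (e / 2).
have s0 : 0 < s by rewrite lt_min !divr_gt0.
have sr : s <= r / 8 by rewrite ge_min lexx.
have se : s <= e / 2 by rewrite ge_min lexx orbT.
have [||c c0 cH] := @circle_min g a s s0.
- by move=> z zs; apply: cg; rewrite zs; have := r0; lra.
- move=> z zs; apply: eH; last by rewrite zs; lra.
  by rewrite -subr_eq0 -nm_gt0 zs.
(* a uniform lower bound on the circle, along the ultrafilter *)
have low : U [set i | forall z, nm (z - a) = s -> c / 2 <= nm (f i z)].
  have [//|] := in_ultra_setVsetC [set i | forall z, nm (z - a) = s -> c / 2 <= nm (f i z)] UU.
  move=> bad; have H i : exists z, (~ forall z, nm (z - a) = s -> c / 2 <= nm (f i z)) ->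
      nm (z - a) = s /\ nm (f i z) < c / 2.
    have [?|] := pselect (forall z, nm (z - a) = s -> c / 2 <= nm (f i z)); first by exists 0.
    by move=> /existsNP[z /not_implyP[zs /negP]]; rewrite -ltNge => fz; exists z.
  have [x xP] := choice H.
  have xbad : U [set i | nm (x i - a) = s /\ nm (f i (x i)) < c / 2].
    by apply: filterS bad => i /xP.
  have [|l xl] := @ultra_cvg R _ U UU x (s + nm a).
    by apply: filterS xbad => i /= [xs _]; have := nm_lerB (x i) a; lra.
  have ls : nm (l - a) <= s.
    by apply: (cvg_nm_le _ xl); apply: filterS xbad => i /= [-> _].
  have ls' : s <= nm (l - a).
    apply/ler_addgt0Pl => k k0; move/cvg_nmP : xl => /(_ _ k0) xl.
    have [i [[xs _] /= xk]] := filter_ex (filterI xbad xl).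
    by have := nm_distD l (x i) a; lra.
  have lE : nm (l - a) = s by apply/eqP; rewrite eq_le ls.
  have lr : nm (l - a) < r by rewrite lE; have := r0; lra.
  have := cH _ lE; have : nm (g l - 0) <= 3 / 4 * c; last by rewrite subr0; lra.
  apply: (cvg_nm_le _ (fg lr)).
  (* Within this distance the Lipschitz bound allows a change below [c / 4]; added to [c / 2] it
     stays below the minimum [c] of [g] on the circle. *)
  have k0 : 0 < c / 4 / (8 * `|M| / r + 1).
    by rewrite divr_gt0 ?divr_gt0// ltr_wpDl// divr_ge0 ?mulr_ge0// ltW.
  move/cvg_nmP : xl => /(_ _ k0) xl.
  apply: filterS (filterI hf (filterI xbad xl)) => i [[hi iM _] [[xs fx] /= xk]].
  rewrite subr0; have iM' z : nm (z - a) < r -> nm (f i z) <= `|M|.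
    by move=> /iM; move/le_trans; apply; exact: ler_norm.
  have r4 w : nm (w - a) = s -> nm (w - a) < r / 4 by move=> ->; have := r0; lra.
  have := bounded_holo_lipschitz r0 hi iM' (r4 _ xs) (r4 _ lE).
  move: xk; rewrite ltr_pdivlMr; last first.
    by rewrite ltr_wpDl// divr_ge0 ?mulr_ge0// ltW.
  have := nm_lerB (f i l) (f i (x i)); rewrite (nm_distC (f i l)).
  have := nm_ge0 (x i - l); rewrite mulrDr mulr1 [nm (x i - l) * _]mulrC.
  by lra.
apply/eqP => ga0; have := c0; have Ba : nm (a - a) < r by rewrite subrr nm0.
move/cvg_nmP : (fg Ba) => /(_ (c / 2)); rewrite divr_gt0// => /(_ isT) fa.
have [i [[hi _ i0] [lo /=]]] := filter_ex (filterI hf (filterI low fa)).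
rewrite ga0 subr0 => fia _.
have sr' : s < r by have := r0; lra.
have [ci _] := holo_ball_off hi sr'.
have fi0 z : nm (z - a) <= s -> f i z != 0 by move=> zs; apply: i0; lra.
have : nm (f i a)^-1 <= (c / 2)^-1.
  apply: (@max_principle _ (fun z => (f i z)^-1) a s) => //; last by rewrite subrr nm0 ltW.
  - by move=> z zs; apply: contV; [exact: fi0|exact: ci].
  - move=> z zs; have /derivable_cderP[d fd] : derivable (f i) z 1 by apply: hi; lra.
    by apply/derivable_cderP; eexists; apply: cderV fd; apply/fi0/ltW.
  - by move=> z zs; rewrite nmV lef_pV2 ?posrE ?divr_gt0 ?nm_gt0 ?lo// fi0 ?zs.
rewrite nmV lef_pV2 ?posrE ?divr_gt0 ?nm_gt0 ?fi0//; last by rewrite subrr nm0 ltW.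
by lra.
Qed.

End hurwitz.

End zeros_and_open_maps.

(** * The principal square root on the right half-plane *)

Section principal_square_root.
Variable R : realType.
Local Notation C := R[i].
Implicit Types (q z w : C).

(** Half-angle formula: [q + nm q] bisects the angle between [q] and the positive axis, and its
    squared modulus is [2 * nm q * (nm q + Re q)]. *)
Definition psqrt q : C := (q + (nm q)%:C) / (Num.sqrt (2 * (nm q + Re q)))%:C.

Lemma psqrt_den_gt0 q : 0 < Re q -> 0 < 2 * (nm q + Re q).
Proof. by move=> q0; rewrite mulr_gt0// ltr_wpDl// nm_ge0. Qed.

Lemma psqrtK q : 0 < Re q -> psqrt q ^+ 2 = q.
Proof.
move=> q0; have d0 := psqrt_den_gt0 q0.
have sE : (Num.sqrt (2 * (nm q + Re q)))%:C ^+ 2 = (2 * (nm q + Re q))%:C :> C.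
  by rewrite expr2 -rcM -expr2 sqr_sqrtr// ltW.
have d0' : (2 * (nm q + Re q))%:C != 0 :> C by rewrite -nm_gt0 nm_real gtr0_norm.
rewrite /psqrt expr_div_n sE; apply: (mulIf d0'); rewrite divfK//.
have nq : (nm q)%:C ^+ 2 = q * q^*%C by rewrite -sqr_normc normcE_nm.
have rq : q^*%C = (Re q)%:C + (Re q)%:C - q.
  rewrite -rcD; case: q {q0 d0 sE d0' nq} => a b.
  by apply/eqP; rewrite eq_complex /= addrK sub0r !eqxx.
have r2 : (2 : R)%:C = 2 :> C by rewrite -[2]/(1 + 1) rcD.
by rewrite rcM rcD r2 sqrrD nq rq; ring.
Qed.

Lemma Re_psqrt q : 0 < Re q -> 0 < Re (psqrt q).
Proof.
move=> q0; rewrite /psqrt -rcV mulrC ReZ ReD /=.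
by rewrite mulr_gt0 ?invr_gt0 ?sqrtr_gt0 ?psqrt_den_gt0// ltr_wpDr// nm_ge0.
Qed.

Lemma psqrt_cont q : 0 < Re q -> cont_at psqrt q.
Proof.
move=> q0; have cnm : cont_at (fun z => (nm z)%:C) q.
  by apply: continuous_real; apply: (@continuous_nm _ _ (fun z : C => z)); exact: cont_id.
apply: contM; first by apply: contD => //; exact: cont_id.
apply: (@contV _ _ (fun z => (Num.sqrt (2 * (nm z + Re z)))%:C)).
  by rewrite -nm_gt0 nm_real gtr0_norm sqrtr_gt0 psqrt_den_gt0.
apply: continuous_real.
apply: (@continuous_comp _ _ _ (fun z : C => 2 * (nm z + Re z)) Num.sqrt); last exact: sqrt_continuous.
have -> : (fun z : C => 2 * (nm z + Re z)) = fun z => Re ((2 : R)%:C * ((nm z)%:C + z)).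
  by apply/funext => z; rewrite ReZ ReD.
apply: continuous_Re; apply: contM; first exact: cont_cst.
by apply: contD => //; exact: cont_id.
Qed.

Lemma psqrt1 : psqrt 1 = 1.
Proof.
have q0 : 0 < Re (1 : C) by rewrite /= ltr01.
have /eqP := psqrtK q0; rewrite -[X in _ == X](expr1n _ 2) eqf_sqr => /orP[/eqP//|/eqP E].
by have := Re_psqrt q0; rewrite E /= ltr0N1.
Qed.

Lemma Re_near1 q : nm (q - 1) < 1 -> 0 < Re q.
Proof.
by move=> q1; have := nm_Re (q - 1); rewrite ReB /= ler_norml => /andP[]; lra.
Qed.

(** The criterion behind every continuation of a root: after a step this short, the ratio of the two
    values is in the range of [psqrtK] and [psqrt_cont]. *)
Lemma Re_ratio z w : nm (z - w) < nm w -> 0 < Re (z / w).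
Proof.
move=> zw; have w0 : w != 0 by rewrite -nm_gt0; apply: le_lt_trans zw; exact: nm_ge0.
apply: Re_near1; have -> : z / w - 1 = (z - w) / w by field.
by rewrite nmf ltr_pdivrMr ?mul1r// nm_gt0.
Qed.

End principal_square_root.

(** * Lifting paths and squares through the squaring map *)

Section lifting.
Variable R : realType.
Local Notation C := R[i].

Lemma cont_comp_within (T V : topologicalType) (A : set V) (h : V -> C) (k : T -> V) :
  {within A, continuous h} -> (forall x, A (k x)) -> continuous k ->
  forall x, cont_at (fun y => h (k y)) x.
Proof.
move=> /subspace_continuousP hA Ak ck x; apply/cont_atP.
apply: (@cvg_comp _ _ _ k h _ (within A (nbhs (k x)))); last exact: hA.
move=> B /= BA; by apply: (@filterS _ (nbhs x) _ _ _ _ (ck x _ BA)) => y /= AB; exact: AB (Ak y).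
Qed.

Lemma continuous_pair (T : topologicalType) (f g : T -> R) (t : T) :
  {for t, continuous f} -> {for t, continuous g} ->
  {for t, continuous (fun s => (f s, g s))}.
Proof. move=> cf cg; exact (cvg_pair cf cg). Qed.

(** Uniform continuity along the rays from the corner [(0, 0)]. If every subdivision failed, the two
    ends of the failing steps would have the same limit along an ultrafilter, where [X] is
    nonzero. *)
Lemma square_subdivision (X : R * R -> C) : (forall u, cont_at X u) -> (forall u, X u != 0) ->
  exists2 N : nat, (0 < N)%N & forall (k : nat) s t, (k < N)%N -> 0 <= s <= 1 -> 0 <= t <= 1 ->
    nm (X (k.+1%:R / N%:R * s, k.+1%:R / N%:R * t) - X (k%:R / N%:R * s, k%:R / N%:R * t))
      < nm (X (k%:R / N%:R * s, k%:R / N%:R * t)).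
Proof.
move=> cX X0; apply: contrapT => noN.
have bad (N : nat) : exists x : nat * (R * R), [/\ (x.1 < N.+1)%N, 0 <= x.2.1 <= 1, 0 <= x.2.2 <= 1 &
    nm (X (x.1%:R / N.+1%:R * x.2.1, x.1%:R / N.+1%:R * x.2.2)) <=
    nm (X (x.1.+1%:R / N.+1%:R * x.2.1, x.1.+1%:R / N.+1%:R * x.2.2) -
        X (x.1%:R / N.+1%:R * x.2.1, x.1%:R / N.+1%:R * x.2.2))].
  apply: contrapT => nbad; apply: noN; exists N.+1 => // k s t kN s01 t01.
  by rewrite ltNge; apply/negP => H; apply: nbad; exists (k, (s, t)).
have [x xP] := choice bad.
have [U [UU UF UFf Uinf]] := ultra_nat.
pose l N := (x N).1%:R / N.+1%:R : R; pose l' N := (x N).1.+1%:R / N.+1%:R : R.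
have l01 N : 0 <= l N <= 1.
  have [k1 _ _ _] := xP N; rewrite /l divr_ge0//= ler_pdivrMr// mul1r ler_nat.
  exact: ltnW.
have lim01 (y : nat -> R) : (forall N, 0 <= y N <= 1) ->
    exists a : R, l N * y N @[N --> U] --> a /\ l' N * y N @[N --> U] --> a.
  move=> y01; have [|a la] := @ultra_realcvg R _ U UU (fun N => l N * y N) 1.
    apply: Uinf; exists 0%N => N _ /=; have /andP[l0 l1] := l01 N.
    have /andP[y0 y1] := y01 N.
    by rewrite ger0_norm ?mulr_ge0// mulr_ile1.
  exists a; split => //; apply/cvgrPdist_lt => e e0.
  have e20 : 0 < e / 2 by rewrite divr_gt0.
  move/cvgrPdist_lt : la => /(_ _ e20) la.
  have [n ne] := invS_small e20.
  have Un : U [set N | (n <= N)%N] by apply: Uinf; exists n.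
  apply: filterS (filterI la Un) => N [/= aN nN].
  have -> : a - l' N * y N = (a - l N * y N) - (N.+1%:R)^-1 * y N.
    by rewrite /l' /l -[(x N).1.+1%:R]natr1 mulrDl mul1r; ring.
  apply: le_lt_trans (ler_normB _ _) _.
  have /andP[y0 y1] := y01 N.
  have : `|N.+1%:R^-1 * y N| <= N.+1%:R^-1.
    by rewrite ger0_norm ?mulr_ge0 ?invr_ge0// ler_piMr ?invr_ge0.
  move=> H; rewrite [e]splitr; apply: ltrD aN _; exact: le_lt_trans H (ne _ nN).
have [a [la l'a]] := lim01 (fun N => (x N).2.1) (fun N => let: And4 _ h _ _ := xP N in h).
have [b [lb l'b]] := lim01 (fun N => (x N).2.2) (fun N => let: And4 _ _ h _ := xP N in h).
have cXU (f g : nat -> R) : f N @[N --> U] --> a -> g N @[N --> U] --> b ->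
    X (f N, g N) @[N --> U] --> X (a, b).
  move=> fa gb; have [cXab] := cX (a, b).
  exact: (@cvg_comp _ _ _ (fun N => (f N, g N)) X U (nbhs (a, b)) (nbhs (X (a, b))) (cvg_pair fa gb) cXab).
have e0 : 0 < nm (X (a, b)) / 3 by rewrite divr_gt0// nm_gt0.
move/cvg_nmP: (cXU _ _ la lb) => /(_ _ e0) H1.
move/cvg_nmP: (cXU _ _ l'a l'b) => /(_ _ e0) H2.
have [N [/= h1 h2]] := filter_ex (filterI H1 H2).
have [_ _ _] := xP N; rewrite -/(l N) -/(l' N).
move: h1 h2; set u := X _; set v := X (l' N * _, _); set w := X (a, b) => h1 h2.
have := nm_distD w v u; have := nm_lerB w u; rewrite (nm_distC w u).
by have := nm_gt0 w; rewrite /w X0 => ?; lra.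
Qed.

(** Starting from a root at the corner, the square is inflated in [N] steps by homotheties; each
    step multiplies the root by the principal root of a ratio. *)
Lemma square_lift (X : R * R -> C) : (forall u, cont_at X u) -> (forall u, X u != 0) ->
  exists2 S : R * R -> C, forall u, cont_at S u &
    forall s t, 0 <= s <= 1 -> 0 <= t <= 1 -> S (s, t) ^+ 2 = X (s, t).
Proof.
move=> cX X0; have [N N0 NH] := square_subdivision cX X0.
pose sc (k : nat) (u : R * R) : R * R := (k%:R / N%:R * clamp u.1, k%:R / N%:R * clamp u.2).
have csc k : continuous (sc k).
  move=> u.
  have c1 : {for u, continuous (fun v : R * R => clamp v.1)}.
    exact (@continuous_comp (R * R)%type R R fst (@clamp R) u (@cvg_fst _ _ _ _ _) (@clamp_cont R u.1)).
  have c2 : {for u, continuous (fun v : R * R => clamp v.2)}.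
    exact (@continuous_comp (R * R)%type R R snd (@clamp R) u (@cvg_snd _ _ _ _ _) (@clamp_cont R u.2)).
  have ck : {for u, continuous (fun=> k%:R / N%:R : R)} by exact: cst_continuous.
  exact (continuous_pair (continuousM ck c1) (continuousM ck c2)).
have cXs k u : cont_at (fun v => X (sc k v)) u.
  by apply: cont_comp; [exact: csc|exact: cX].
have step k : (k <= N)%N -> exists2 S : R * R -> C, forall u, cont_at S u &
    forall u, S u ^+ 2 = X (sc k u).
  elim: k => [_|k IH kN].
    exists (fun=> sqrtc (X (0, 0))) => u; first exact: cont_cst.
    by rewrite sqr_sqrtc /sc !mul0r.
  have [S cS SX] := IH (ltnW kN).
  have pos u : 0 < Re (X (sc k.+1 u) / X (sc k u)).
    by apply: Re_ratio; apply: NH => //; exact: clamp01.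
  exists (fun u => S u * psqrt (X (sc k.+1 u) / X (sc k u))) => u.
    apply: contM => //; apply: cont_compC; last exact: psqrt_cont.
    by apply: contM => //; exact: (@contV _ _ (fun v => X (sc k v))).
  by rewrite exprMn SX psqrtK// mulrC divfK.
have [S cS SX] := step N (leqnn N); exists S => // s t s01 t01.
by rewrite SX /sc /= divff ?pnatr_eq0 -?lt0n// !mul1r !clampE.
Qed.

Lemma path_lift (Y : R -> C) c0 : (forall t, cont_at Y t) -> (forall t, Y t != 0) ->
  c0 ^+ 2 = Y 0 -> exists2 S : R -> C, forall t, cont_at S t &
    (forall t, 0 <= t <= 1 -> S t ^+ 2 = Y t) /\ S 0 = c0.
Proof.
move=> cY Y0 c0E; have [|u|S cS SY] := @square_lift (fun u => Y u.2).
- by move=> u; apply: cont_comp; [exact: cvg_snd|exact: cY].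
- exact: Y0.
have z01 : 0 <= (0 : R) <= 1 by rewrite lexx ler01.
have cS0 t : cont_at (fun t => S (0, t)) t.
  apply: (@cont_comp _ _ _ S (fun t => (0, t))) => //.
  exact (continuous_pair (@cst_continuous _ _ 0 t) (@cvg_id _ (nbhs t))).
have /eqP : S (0, 0) ^+ 2 = c0 ^+ 2 by rewrite SY.
rewrite eqf_sqr => /orP[/eqP E|/eqP E].
  by exists (fun t => S (0, t)) => //; split => // t t01; rewrite SY.
exists (fun t => - S (0, t)); first by move=> t; exact: contN.
by split => [t t01|]; rewrite ?sqrrN ?SY// E opprK.
Qed.

(** The ratio of the two lifts is 1 or -1 everywhere; if it changed sign, its real part would vanish
    somewhere by the intermediate value theorem. *)
Lemma path_lift_unique (S T : R -> C) : (forall t, cont_at S t) -> (forall t, cont_at T t) ->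
  (forall t, 0 <= t <= 1 -> S t ^+ 2 = T t ^+ 2 /\ S t != 0) -> S 0 = T 0 ->
  forall t, 0 <= t <= 1 -> S t = T t.
Proof.
move=> cS cT ST ST0 t /andP[t0 t1].
have S0 x : 0 <= x <= 1 -> S x != 0 by move=> /ST[].
have pm x : 0 <= x <= 1 -> T x = S x \/ T x = - S x.
  move=> /ST[/eqP]; rewrite eq_sym eqf_sqr => /orP[]/eqP -> _; by [left|right].
have z01 : 0 <= (0 : R) <= 1 by rewrite lexx ler01.
have t01 : 0 <= t <= 1 by rewrite t0.
case: (pm _ t01) => // Tt; exfalso.
have cl x : 0 <= x <= t -> 0 <= x <= 1 by move=> /andP[-> /le_trans]; apply.
have [||x] := @IVT R (fun x => Re (T (clamp x) / S (clamp x))) 0 t 0 t0.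
- have H x : cont_at (fun y => T (clamp y) / S (clamp y)) x.
    apply: (@cont_comp _ _ _ (fun y => T y / S y) (@clamp R)); first exact: clamp_cont.
    by apply: contM => //; apply: contV => //; apply: S0; exact: clamp01.
  by apply: continuous_subspaceT => x; exact (continuous_Re (H x)).
- rewrite !clampE// -ST0 Tt mulNr !divff ?S0//= ge_min le_max ler01 lerN10 orbT.
  by [].
rewrite in_itv /= => /andP[x0 xt]; have x01 : 0 <= x <= 1 by rewrite x0 (le_trans xt).
rewrite clampE//; case: (pm _ x01) => ->; rewrite ?mulNr divff ?S0//=.
  by move/eqP; rewrite oner_eq0.
by move/eqP; rewrite oppr_eq0 oner_eq0.
Qed.

End lifting.

(** * Square roots of nonvanishing functions on simply connected sets *)

Section square_root_on_simply_connected_sets.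
Variable R : realType.
Local Notation C := R[i].
Implicit Types (z w : C).

Lemma clamp_within (A : set C) (p : R -> C) : {within `[0, 1], continuous p} ->
  p @` `[0, 1] `<=` A -> (forall t, cont_at (fun s => p (clamp s)) t) /\ (forall t, A (p (clamp t))).
Proof.
move=> cp pA; have c01 t : `[0, 1]%classic (clamp t : R) by rewrite /= in_itv /= clamp01.
split=> t; last by apply: pA; exists (clamp t).
exact: (cont_comp_within cp c01 (@clamp_cont R)).
Qed.

Lemma clamp_lo (t : R) : t <= 0 -> clamp t = 0.
Proof. by move=> t0; rewrite /clamp min_r ?max_l// (le_trans t0)// ler01. Qed.

Lemma clamp_hi (t : R) : 1 <= t -> clamp t = 1.
Proof. by move=> t1; rewrite /clamp min_l ?max_r// ler01. Qed.

Lemma clamp_affine_cont (a b : R) t : {for t, continuous (fun s => clamp (a * s + b))}.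
Proof.
apply: (@continuous_comp R R R (fun s => a * s + b) (@clamp R)); last exact: clamp_cont.
by apply: continuousD; [apply: continuousM; [exact: cvg_cst|exact: cvg_id]|exact: cvg_cst].
Qed.

Lemma cont_clamp_affine (p : R -> C) (a b : R) t : (forall t, cont_at p t) ->
  cont_at (fun s => p (clamp (a * s + b))) t.
Proof. by move=> cp; apply: cont_comp; [exact: clamp_affine_cont|]. Qed.

Section square_root.
Variables (A : set C) (F : C -> C) (x0 : C).
Hypotheses (oA : open A) (scA : simply_connected A) (Ax0 : A x0).
Hypotheses (cF : forall z, A z -> cont_at F z) (F0 : forall z, A z -> F z != 0).

(** [v] is the end value of the root continued along some path from [x0] to [z]; monodromy makes it
    a function of [z]. *)
Definition lift_to z v := exists p S : R -> C,
  [/\ (forall t, cont_at p t) /\ (forall t, A (p t)), p 0 = x0 /\ p 1 = z,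
      (forall t, cont_at S t), (forall t, 0 <= t <= 1 -> S t ^+ 2 = F (p t)) &
      S 0 = sqrtc (F x0) /\ S 1 = v].

Let i0 : 0 <= (0 : R) <= 1. Proof. by rewrite lexx ler01. Qed.
Let i1 : 0 <= (1 : R) <= 1. Proof. by rewrite lexx ler01. Qed.

Lemma lift_to_exists z : A z -> exists v, lift_to z v.
Proof.
move=> Az; have [p [cp pA p0 p1]] := scA.1 _ _ Ax0 Az.
have [cpc pcA] := clamp_within cp pA.
have [|||S cS [SF S0]] := @path_lift _ (fun t => F (p (clamp t))) (sqrtc (F x0)).
- by move=> t; apply: cont_compC => //; exact: cF.
- by move=> t; exact: F0.
- by rewrite sqr_sqrtc clampE// p0.
exists (S 1), (fun t => p (clamp t)), S; split => //.
by rewrite !clampE.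
Qed.

(* The lift of a homotopy contracting the loop [p1 p2^-1] is constant on three
   sides of the square, so the lift of the loop closes up. *)
Lemma lift_to_unique z v1 v2 : lift_to z v1 -> lift_to z v2 -> v1 = v2.
Proof.
move=> [p1 [S1 [[cp1 Ap1] [p10 p11] cS1 SF1 [S10 <-]]]].
move=> [p2 [S2 [[cp2 Ap2] [p20 p21] cS2 SF2 [S20 <-]]]].
(* The first path followed by the reverse of the second. At each time one of the two summands equals
   [z], so continuity needs no gluing. *)
pose c (t : R) : C := p1 (clamp (2 * t + 0)) + p2 (clamp (- 2 * t + 2)) - z.
have clow t : 0 <= t <= 2^-1 -> c t = p1 (2 * t).
  move=> /andP[t0 t1]; rewrite /c (@clamp_hi (- 2 * t + 2)); last by lra.
  by rewrite p21 addrK addr0 clampE//; apply/andP; split; lra.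
have chigh t : 2^-1 <= t <= 1 -> c t = p2 (2 - 2 * t).
  move=> /andP[t0 t1]; rewrite /c (@clamp_hi (2 * t + 0)); last by lra.
  rewrite p11 addrAC subrr add0r clampE; last by apply/andP; split; lra.
  by congr p2; ring.
have cc t : cont_at c t.
  by apply: contB; [apply: contD; exact: cont_clamp_affine|exact: cont_cst].
have Ac t : 0 <= t <= 1 -> A (c t).
  move=> /andP[t0 t1]; have [th|th] := lerP t 2^-1.
    by rewrite clow ?t0.
  by rewrite chigh ?t1 ?andbT//; exact: ltW.
have h01 : 0 <= (0 : R) <= 2^-1 by rewrite lexx invr_ge0 ler0n.
have h1' : 2^-1 <= (1 : R) <= 1 by rewrite lexx invf_le1// ler1n.
have c0 : c 0 = x0 by rewrite (clow _ h01) mulr0.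
have c1 : c 1 = x0 by rewrite (chigh _ h1') mulr1 subrr.
have [|||h [ch hA h0 h1 hs]] := scA.2 c.
- by apply: continuous_subspaceT => t; exact ((cont_atP _ _).1 (cc t)).
- by move=> _ [t /= t01 <-]; apply: Ac; rewrite in_itv in t01.
- by rewrite c0 c1.
pose H (u : R * R) := h (clamp u.1, clamp u.2).
have c01 (u : R * R) : (`[0, 1]%classic `*` `[0, 1]%classic) (clamp u.1, clamp u.2).
  by split; rewrite /= in_itv /= clamp01.
have cl2 : continuous (fun u : R * R => (clamp u.1, clamp u.2)).
  move=> u.
  have k1 : {for u, continuous (fun v : R * R => clamp v.1)}.
    exact (@continuous_comp (R * R)%type R R fst (@clamp R) u (@cvg_fst _ _ _ _ _) (@clamp_cont R u.1)).
  have k2 : {for u, continuous (fun v : R * R => clamp v.2)}.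
    exact (@continuous_comp (R * R)%type R R snd (@clamp R) u (@cvg_snd _ _ _ _ _) (@clamp_cont R u.2)).
  exact (continuous_pair k1 k2).
have cH u : cont_at H u := cont_comp_within ch c01 cl2 u.
have AH u : A (H u) by apply: hA; exists (clamp u.1, clamp u.2) => //; exact: c01.
have [||S cS SH] := @square_lift _ (fun u => F (H u)).
- by move=> u; apply: cont_compC => //; exact: cF.
- by move=> u; exact: F0.
have H0 t : 0 <= t <= 1 -> H (0, t) = c t.
  by move=> t01; rewrite /H /= !clampE// h0// inE /= in_itv.
have H1 t : 0 <= t <= 1 -> H (1, t) = x0.
  by move=> t01; rewrite /H /= !clampE// h1 ?c0// inE /= in_itv.
have Hs s : 0 <= s <= 1 -> H (s, 0) = x0 /\ H (s, 1) = x0.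
  by move=> s01; rewrite /H /= !clampE//; have := hs s; rewrite c0; apply; rewrite inE /= ?in_itv.
have cSf (f g : R -> R) (t : R) : {for t, continuous f} -> {for t, continuous g} ->
    cont_at (fun x => S (f x, g x)) t.
  by move=> cf cg; exact (cont_comp (continuous_pair cf cg) (cS _)).
have idc (t : R) : {for t, continuous (fun x : R => x)} by exact: cvg_id.
have cstc (t x : R) : {for t, continuous (fun _ : R => x)} by exact: cst_continuous.
have cS0 t : cont_at (fun t => S (0, t)) t := cSf _ _ _ (cstc t 0) (idc t).
have cS1' t : cont_at (fun t => S (1, t)) t := cSf _ _ _ (cstc t 1) (idc t).
have cSl t : cont_at (fun s => S (s, 0)) t := cSf _ _ _ (idc t) (cstc t 0).
have cSr t : cont_at (fun s => S (s, 1)) t := cSf _ _ _ (idc t) (cstc t 1).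
have cst (T : R -> C) : (forall t, cont_at T t) ->
    (forall t, 0 <= t <= 1 -> T t ^+ 2 = F x0) -> T 1 = T 0.
  move=> cT TF; apply/esym/(@path_lift_unique _ (fun=> T 0) T) => //; first by move=> t; exact: cont_cst.
  by move=> t t01; rewrite !TF// -sqrf_eq0 TF// F0.
have E1 : S (1, 0) = S (0, 0) by apply: (cst (fun s => S (s, 0))) => // s s01; rewrite SH// (Hs _ s01).1.
have E2 : S (1, 1) = S (0, 1) by apply: (cst (fun s => S (s, 1))) => // s s01; rewrite SH// (Hs _ s01).2.
have E3 : S (1, 1) = S (1, 0) by apply: (cst (fun t => S (1, t))) => // t t01; rewrite SH// H1.
(* The sign [k] makes the lifted homotopy start at the value prescribed for [S1] and [S2]. *)
have [k k2 kS] : exists2 k : C, k ^+ 2 = 1 & k * S (0, 0) = sqrtc (F x0).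
  have /eqP : S (0, 0) ^+ 2 = sqrtc (F x0) ^+ 2 by rewrite SH// sqr_sqrtc H0// c0.
  rewrite eqf_sqr => /orP[/eqP ->|/eqP ->].
    by exists 1; rewrite ?mul1r ?expr1n.
  by exists (-1); rewrite ?mulN1r ?opprK// sqrrN expr1n.
have kF t : 0 <= t <= 1 -> (k * S (0, t)) ^+ 2 = F (c t).
  by move=> t01; rewrite exprMn k2 mul1r SH// H0.
have half (t : R) : 0 <= t <= 1 -> 0 <= 2^-1 * t + 0 <= 2^-1.
  by move=> /andP[t0 t1]; apply/andP; split; lra.
have half' (t : R) : 0 <= t <= 1 -> 2^-1 <= - 2^-1 * t + 1 <= 1.
  by move=> /andP[t0 t1]; apply/andP; split; lra.
have in01 (t : R) : 0 <= t <= 2^-1 -> 0 <= t <= 1 by move=> /andP[t0 t1]; apply/andP; split; lra.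
have in01' (t : R) : 2^-1 <= t <= 1 -> 0 <= t <= 1 by move=> /andP[t0 t1]; apply/andP; split; lra.
have affc (a b : R) t : cont_at (fun t => k * S (0, a * t + b)) t.
  apply: contM; first exact: cont_cst.
  apply: (cSf _ _ _ (cstc t 0)).
  by apply: continuousD; [apply: continuousM; [exact: cvg_cst|exact: cvg_id]|exact: cvg_cst].
have -> : S1 1 = k * S (0, 2^-1 * 1 + 0).
  apply: (@path_lift_unique _ S1 (fun t => k * S (0, 2^-1 * t + 0))) => //.
    move=> t t01; rewrite kF; last exact/in01/half.
    rewrite clow ?half// SF1// -sqrf_eq0 SF1// F0//; split => //; congr (F (p1 _)).
    by field.
  by rewrite mulr0 addr0 kS.
have -> : S2 1 = k * S (0, - 2^-1 * 1 + 1).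
  apply: (@path_lift_unique _ S2 (fun t => k * S (0, - 2^-1 * t + 1))) => //.
    move=> t t01; rewrite kF; last exact/in01'/half'.
    rewrite chigh ?half'// SF2// -sqrf_eq0 SF2// F0//; split => //; congr (F (p2 _)).
    by field.
  by rewrite mulr0 add0r -E2 E3 E1 kS.
by congr (_ * S (_, _)); field.
Qed.

(** Continuing a path to [z] by a segment to [w] multiplies the end value by a principal root. This
    makes the global root continuous. *)
Lemma lift_to_local z v (r : R) w : lift_to z v -> 0 < r ->
  (forall w, nm (w - z) < r -> A w /\ nm (F w - F z) < nm (F z)) -> nm (w - z) < r ->
  lift_to w (v * psqrt (F w / F z)).
Proof.
move=> [p [S [[cp Ap] [p0 p1] cS SF [S0 S1]]]] r0 rH wr.
pose q (t : R) := seg z w (clamp (2 * t + (- 1))).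
have qr t : nm (q t - z) < r.
  apply: (@convex_ball _ z r z w _ wr); last exact: clamp01.
  by rewrite /= subrr nm0.
have cq t : cont_at q t by apply: cont_clamp_affine => s; exact: seg_cont.
have Fz0 : F z != 0 by apply: F0; rewrite -p1.
have qpos t : 0 < Re (F (q t) / F z) by apply: Re_ratio; exact: (rH _ (qr t)).2.
have qlow t : 0 <= t <= 2^-1 -> q t = z.
  by move=> /andP[t0 t1]; rewrite /q clamp_lo ?seg0//; lra.
have plow t : 0 <= t <= 2^-1 -> p (clamp (2 * t + 0)) = p (2 * t) /\ S (clamp (2 * t + 0)) = S (2 * t).
  by move=> /andP[t0 t1]; rewrite addr0 clampE//; apply/andP; split; lra.
have phigh t : 2^-1 <= t -> p (clamp (2 * t + 0)) = z /\ S (clamp (2 * t + 0)) = v.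
  by move=> t0; rewrite clamp_hi ?S1//; lra.
exists (fun t => p (clamp (2 * t + 0)) + q t - z).
exists (fun t => S (clamp (2 * t + 0)) * psqrt (F (q t) / F z)).
have h01 : 0 <= (0 : R) <= 2^-1 by rewrite lexx invr_ge0 ler0n.
have h1 : (2^-1 : R) <= 1 by rewrite invf_le1// ler1n.
split.
- split=> t.
    by apply: contB; [apply: contD => //; exact: cont_clamp_affine|exact: cont_cst].
  have [t1|t1] := lerP t 2^-1.
    by rewrite /q (@clamp_lo (2 * t + -1)) ?seg0 ?addrK//; lra.
  by rewrite (phigh _ (ltW t1)).1 addrAC subrr add0r; exact: (rH _ (qr t)).1.
- rewrite qlow// (plow _ h01).1 mulr0 p0 addrK; split => //.
  by rewrite (phigh _ h1).1 addrAC subrr add0r /q clamp_hi ?seg1//; lra.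
- move=> t; apply: contM; first exact: cont_clamp_affine.
  apply: cont_compC; last exact: psqrt_cont.
  apply: contM; last exact: cont_cst.
  by apply: cont_compC => //; apply: cF; exact: (rH _ (qr t)).1.
- move=> t /andP[t0 t1]; rewrite exprMn psqrtK//; have [th|th] := lerP t 2^-1.
    have t2 : 0 <= t <= 2^-1 by rewrite t0.
    rewrite qlow// (plow _ t2).1 (plow _ t2).2 addrK divff// mulr1 SF//.
    by apply/andP; split; lra.
  rewrite (phigh _ (ltW th)).1 (phigh _ (ltW th)).2 addrAC subrr add0r -S1 SF// p1.
  by rewrite mulrC divfK.
- rewrite qlow// (plow _ h01).2 mulr0 S0 divff// psqrt1 mulr1; split => //.
  by rewrite (phigh _ h1).2 /q clamp_hi ?seg1//; lra.
Qed.

Lemma sqrt_simply_connected : exists s : C -> C, forall z, A z -> cont_at s z /\ s z ^+ 2 = F z.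
Proof.
exists (fun z => xget 0 [set v | lift_to z v]) => z Az.
have sP w : A w -> lift_to w (xget 0 [set v | lift_to w v]).
  move=> Aw; have [v vP] := lift_to_exists Aw.
  by case: xgetP => [u -> //|/(_ v)]; case.
split; last first.
  by have [p [S [_ [_ <-] _ SF [_ <-]]]] := sP _ Az; rewrite SF.
have [e e0 eH] := (open_nmP A).1 oA z Az.
have /continuous_nmP/(_ (nm (F z))) := cF Az; rewrite nm_gt0 F0// => /(_ isT)[d d0 dH].
pose r := Num.min e d; have r0 : 0 < r by rewrite lt_min e0.
have rH w : nm (w - z) < r -> A w /\ nm (F w - F z) < nm (F z).
  by rewrite lt_min => /andP[/eH ? /dH].
set sz := xget 0 [set v | lift_to z v].
apply: (@cont_near _ _ (fun w => sz * psqrt (F w / F z))).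
  apply/nbhs_nmP; exists r => // w wr.
  apply: (lift_to_unique (z := w)); last by apply: sP; exact: (rH _ wr).1.
  by apply: lift_to_local wr => //; exact: sP.
apply: contM; first exact: cont_cst.
apply: cont_compC; first by apply: contM; [exact: cF|exact: cont_cst].
by apply: psqrt_cont; apply: Re_near1; rewrite divff ?F0// subrr nm0.
Qed.

End square_root.

Lemma sqrt_branch (A : set C) (F : C -> C) : open A -> simply_connected A ->
  (forall z, A z -> cont_at F z) -> (forall z, A z -> F z != 0) ->
  exists s : C -> C, forall z, A z -> cont_at s z /\ s z ^+ 2 = F z.
Proof.
move=> oA scA cF F0; have [[x Ax]|A0] := pselect (A !=set0).
  exact: sqrt_simply_connected Ax cF F0.
by exists id => z Az; exfalso; apply: A0; exists z.
Qed.

Lemma simply_connected_ball (a : C) (r : R) : simply_connected [set z : C | nm (z - a) < r].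
Proof.
split=> [x y xr yr|p cp pA p01].
  exists (seg x y); split; rewrite ?seg0 ?seg1//.
    by apply: continuous_subspaceT => t; exact ((cont_atP _ _).1 (seg_cont x y t)).
  by move=> _ [t /= t01 <-]; rewrite in_itv in t01; exact: (convex_ball xr yr t01).
have [cpc pcA] := clamp_within cp pA.
have i0 : 0 <= (0 : R) <= 1 by rewrite lexx ler01.
have i1 : 0 <= (1 : R) <= 1 by rewrite lexx ler01.
exists (fun u => seg (p (clamp u.2)) (p 0) u.1); split.
- apply: continuous_subspaceT => u.
  have c2 : cont_at (fun u : R * R => p (clamp u.2)) u.
    exact (@cont_comp R (R * R)%type R (fun t => p (clamp t)) snd u (@cvg_snd _ _ _ _ _) (cpc u.2)).
  apply: (cont_atP _ _).1.
  apply: contD => //; apply: contM; last by apply: contB => //; exact: cont_cst.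
  by apply: continuous_real; exact: cvg_fst.
- move=> _ [[s t] [/= s01 t01] <-]; rewrite in_itv in s01; rewrite in_itv in t01.
  have := pcA 0; rewrite clampE// => p0A.
  exact: (convex_ball (pcA t) p0A s01).
- by move=> t; rewrite inE /= ?in_itv /= => t01; rewrite seg0 clampE.
- by move=> t _; rewrite /= seg1.
- move=> s _ /=; rewrite !clampE// -p01; split; by rewrite /seg subrr mulr0 addr0.
Qed.

End square_root_on_simply_connected_sets.

(** * Automorphisms of the disc *)

Section disc_automorphisms.
Variable R : realType.
Local Notation C := R[i].
Implicit Types (a x y z d : C).

Lemma unit_discP z : unit_disc z <-> nm z < 1.
Proof. by rewrite /unit_disc /mkset normcE_nm ltcR. Qed.

Lemma nm_sqr z : nm z ^+ 2 = Re z ^+ 2 + Im z ^+ 2.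
Proof. by case: z => a b; rewrite /nm /= sqr_sqrtr// addr_ge0 ?sqr_ge0. Qed.

Definition mobius a x : C := (x - a) / (1 - a^*%C * x).

Lemma mobius_den a x : nm a < 1 -> nm x < 1 -> 1 - a^*%C * x != 0.
Proof.
move=> a1 x1; apply/eqP => /eqP; rewrite subr_eq0 => /eqP E.
have : nm (a^*%C * x) < 1 by rewrite nmM nm_conj mulr_ilt1 ?nm_ge0.
by rewrite -E nm1 ltxx.
Qed.

Lemma mobius_lt1 a x : nm a < 1 -> nm x < 1 -> nm (mobius a x) < 1.
Proof.
move=> a1 x1; rewrite nmf ltr_pdivrMr ?nm_gt0 ?mobius_den// mul1r.
rewrite -(ltr_pXn2r (n := 2))// ?nnegrE ?nm_ge0// -subr_gt0.
have -> : nm (1 - a^*%C * x) ^+ 2 - nm (x - a) ^+ 2 = (1 - nm a ^+ 2) * (1 - nm x ^+ 2).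
  by rewrite !nm_sqr; case: a x {a1 x1} => [p q] [r s] /=; ring.
by rewrite mulr_gt0// subr_gt0 expr_lt1// nm_ge0.
Qed.

Lemma mobius_inj a x y : nm a < 1 -> nm x < 1 -> nm y < 1 -> mobius a x = mobius a y -> x = y.
Proof.
move=> a1 x1 y1 /eqP; rewrite /mobius eqr_div ?mobius_den// => /eqP E.
have E' : (x - y) * (1 - a^*%C * a) = 0.
  have -> : (x - y) * (1 - a^*%C * a) = (x - a) * (1 - a^*%C * y) - (y - a) * (1 - a^*%C * x).
    by ring.
  by rewrite E subrr.
move/eqP : E'; rewrite mulf_eq0 (negPf (mobius_den a1 a1)) orbF subr_eq0.
by move/eqP.
Qed.

Lemma mobius_cder a x : nm a < 1 -> nm x < 1 ->
  cder (mobius a) x ((1 - a^*%C * a) / (1 - a^*%C * x) ^+ 2).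
Proof.
move=> a1 x1; have D0 := mobius_den a1 x1.
have cD : cder (fun x => 1 - a^*%C * x) x (0 - (0 * x + a^*%C * 1)).
  by apply: cderB; [exact: cder_cst|apply: cderM; [exact: cder_cst|exact: cder_id]].
have := cderM (cderB (cder_id x) (cder_cst a x)) (@cderV _ (fun x => 1 - a^*%C * x) x _ D0 cD).
by congr cder; field.
Qed.

Lemma mobius_cder_neq0 a x : nm a < 1 -> nm x < 1 ->
  (1 - a^*%C * a) / (1 - a^*%C * x) ^+ 2 != 0.
Proof.
by move=> a1 x1; rewrite mulf_neq0 ?invr_eq0 ?expf_neq0// mobius_den.
Qed.

Lemma conjM_nm a : a^*%C * a = (nm a ^+ 2)%:C.
Proof. by rewrite mulrC -sqr_normc normcE_nm [in LHS]expr2 -rcM -expr2. Qed.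

End disc_automorphisms.

(** * Holomorphy of the derivative *)

Section derivative_is_holomorphic.
Variable R : realType.
Local Notation C := R[i].

(** The derivative is a pointwise limit of difference quotients with fixed increments; these are
    holomorphic and uniformly bounded by the Lipschitz estimate. *)
Lemma derivative_derivable (f f1 : C -> C) (a : C) (r : R) : 0 < r -> holo_ball f a r ->
  (forall z, nm (z - a) < r -> cder f z (f1 z)) -> derivable f1 a 1.
Proof.
move=> r0 hf ff1; pose rho := r / 2; have rho0 : 0 < rho by rewrite divr_gt0.
have rhor : rho < r by rewrite /rho; lra.
have [cf _] := holo_ball_off hf rhor; have [M M0 fM] := bounded_on_closed_ball cf.
have [U [UU UF UFf Uinf]] := ultra_nat.
(* From the ball of radius [rho / 8], such an increment stays within [rho / 4], where the Lipschitz
   estimate holds. *)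
pose h (n : nat) : C := (rho / 8 / n.+1%:R)%:C.
have h0 n : 0 < rho / 8 / n.+1%:R by rewrite !divr_gt0.
have nmh n : nm (h n) = rho / 8 / n.+1%:R by rewrite nm_real gtr0_norm.
have hn0 n : h n != 0 by rewrite -nm_gt0 nmh.
have hle n : nm (h n) <= rho / 8.
  by rewrite nmh ler_pdivrMr// ler_peMr ?ler1n// divr_ge0// ltW.
have hf' : holo_ball f a rho by move=> z zr; apply: hf; exact: lt_trans rhor.
have fM' z : nm (z - a) < rho -> nm (f z) <= M by move=> /ltW/fM.
apply: (@ultralimit_derivable _ _ U (fun n z => (f (z + h n) - f z) / h n) f1 a (rho / 8) (8 * M / rho)) => //.
- by rewrite divr_gt0.
- apply: Uinf; exists 0%N => n _; split=> [z zr|z zr].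
    have hz : nm (z + h n - a) < r.
      by have := nmD (z - a) (h n); have := hle n; rewrite addrAC; lra.
    have zr' : nm (z - a) < r by lra.
    apply/derivable_cderP; eexists; apply: cderM; last exact: cder_cst.
    apply: cderB; last exact: ff1.
    apply: (cder_comp (f := fun z => z + h n)); last exact: ff1.
    by apply: cderD; [exact: cder_id|exact: cder_cst].
  have zr4 : nm (z - a) < rho / 4 by lra.
  have hz4 : nm (z + h n - a) < rho / 4.
    by have := nmD (z - a) (h n); have := hle n; rewrite addrAC; lra.
  have := bounded_holo_lipschitz rho0 hf' fM' hz4 zr4.
  by rewrite addrAC subrr add0r nmf ler_pdivrMr ?nm_gt0.
- move=> z zr; apply/cvg_nmP => e e0.
  have zr' : nm (z - a) < r by lra.
  have e20 : 0 < e / 2 by rewrite divr_gt0.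
  have /cder_epsP/(_ _ e20)[s s0 sH] := ff1 _ zr'.
  have p8 : 0 < rho / 8 by rewrite divr_gt0.
  have [N Ns] := invS_small (divr_gt0 s0 p8); apply: Uinf; exists N => n /Ns nb.
  have hs : nm (h n) < s by rewrite nmh mulrC -ltr_pdivlMr.
  have := sH (z + h n); rewrite addrAC subrr add0r => /(_ hs) H.
  have -> : (f (z + h n) - f z) / h n - f1 z = (f (z + h n) - f z - f1 z * h n) / h n.
    by move: (h n) (hn0 n) => k k0; field.
  rewrite nmf ltr_pdivrMr ?nm_gt0//; apply: le_lt_trans H _.
  by rewrite ltr_pM2r ?nm_gt0//; lra.
Qed.

End derivative_is_holomorphic.

(** * Normalized injections into the disc and their limits *)

Section riemann_mapping.
Variable R : realType.
Local Notation C := R[i].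
Implicit Types (g f : C -> C) (z w d : C).

Variables (B : set C) (z0 : C).
Hypotheses (oB : open B) (scB : simply_connected B) (Bz0 : B z0).

(** The nonvanishing derivative is carried along with injectivity rather than deduced from it: it
    makes the inverse holomorphic, and it passes to square roots and, by Hurwitz, to limits. *)
Definition regular_injection g := (forall z, B z -> exists2 d, cder g z d & d != 0) /\
  (forall x y, B x -> B y -> g x = g y -> x = y).

Definition normalized g := [/\ regular_injection g, forall z, B z -> nm (g z) < 1 & g z0 = 0].

Lemma regular_injection_holo g z : regular_injection g -> B z -> derivable g z 1.
Proof. by move=> [rg _] /rg[d gd _]; apply/derivable_cderP; exists d. Qed.

Lemma connectedB : connected B.
Proof.
have -> : B = \bigcup_(A in [set A : set C | [/\ A `<=` B, A z0 & connected A]]) A.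
  apply/seteqP; split=> [w Bw|w [A [AB _ _] Aw]]; last exact: AB.
  have [p [cp pB p0 p1]] := scB.1 _ _ Bz0 Bw.
  exists (p @` `[0, 1]); last by exists 1; rewrite //= in_itv /= lexx ler01.
  split => //; first by exists 0; rewrite //= in_itv /= lexx ler01.
  apply: connected_continuous_connected => //; exact: segment_connected.
apply: bigcup_connected; last by move=> A [].
by exists z0 => A [].
Qed.

Lemma ballB z : B z -> exists2 r : R, 0 < r & forall w, nm (w - z) < r -> B w.
Proof. exact: (open_nmP B).1. Qed.

Lemma regular_comp g (k k1 : C -> C) (D : set C) : regular_injection g ->
  (forall z, B z -> D (g z)) -> (forall x, D x -> cder k x (k1 x) /\ k1 x != 0) ->
  (forall x y, D x -> D y -> k x = k y -> x = y) -> regular_injection (fun z => k (g z)).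
Proof.
move=> [rg ig] gD rk ik; split=> [z Bz|x y Bx By E]; last first.
  by apply: ig => //; apply: ik; rewrite ?E; try exact: gD.
have [d gd d0] := rg _ Bz; have [kd k0] := rk _ (gD _ Bz).
by exists (k1 (g z) * d); [exact: cder_comp|exact: mulf_neq0].
Qed.

Lemma sqrt_regular g : regular_injection g -> (forall z, B z -> g z != 0) ->
  exists2 s : C -> C, regular_injection s & forall z, B z -> s z ^+ 2 = g z.
Proof.
move=> rg g0; have [s sP] := @sqrt_branch _ B g oB scB
  (fun z Bz => derivable_cont (regular_injection_holo rg Bz)) g0.
have sE z : B z -> s z ^+ 2 = g z by move=> /sP[].
exists s => //; case: rg => rg ig; split=> [z Bz|x y Bx By E]; last first.
  by apply: ig => //; rewrite -!sE// E.
have [r r0 rB] := ballB Bz; have [d gd d0] := rg _ Bz.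
have sz0 : s z != 0 by rewrite -sqrf_eq0 sE// g0.
exists (d / (2 * s z)); last by rewrite mulf_neq0// invr_eq0 mulf_neq0// pnatr_eq0.
have [csz _] := sP _ Bz.
by apply: (sqrt_cder r0 _ csz sz0 gd) => w /rB; exact: sE.
Qed.

Lemma regular_open g z : regular_injection g -> B z ->
  exists2 m : R, 0 < m & forall v, nm (v - g z) < m -> exists2 w, B w & g w = v.
Proof.
move=> rg Bz; have [r r0 rB] := ballB Bz.
have r20 : 0 < r / 2 by rewrite divr_gt0.
have r2r : r / 2 < r by lra.
have [|w wr|m m0 mH] := @open_map _ g z (r / 2) r r20 r2r.
- by move=> w /rB; exact: regular_injection_holo.
- apply: contraTneq r20 => /rg.2 E; have Bw : B w by apply: rB; rewrite wr.
  by rewrite -wr (E Bw Bz) subrr nm0 ltxx.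
by exists m => // v /mH[w wr <-]; exists w => //; apply: rB; exact: lt_trans r2r.
Qed.

(** A root [h] of [z - w0] never takes two opposite values, so it omits a ball around [- h z0]; an
    inversion at that point is bounded. *)
Lemma normalized_exists : (exists w, ~ B w) -> exists g, normalized g.
Proof.
move=> [w0 nw0].
have r1 : regular_injection (fun z => z - w0).
  split=> [z _|x y _ _ /addIr//]; exists (1 - 0); last by rewrite subr0 oner_neq0.
  by apply: cderB; [exact: cder_id|exact: cder_cst].
have [|h rh hE] := sqrt_regular r1.
  by move=> z Bz; rewrite subr_eq0; apply: contra_notN nw0 => /eqP <-.
have [m m0 mH] := regular_open rh Bz0.
have far z : B z -> m <= nm (h z + h z0).
  move=> Bz; rewrite leNgt; apply/negP => lt.
  have [|w Bw hw] := mH (- h z); first by rewrite -opprD nmN.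
  have : w - w0 = z - w0 by rewrite -!hE// hw sqrrN.
  move/addIr => wz; move: hw; rewrite wz => /eqP; rewrite -addr_eq0 -mulr2n mulrn_eq0 /=.
  rewrite -sqrf_eq0 hE// subr_eq0 => /eqP zw; apply: nw0; by rewrite -zw.
have far0 z : B z -> h z + h z0 != 0.
  by move=> Bz; rewrite -nm_gt0; apply: lt_le_trans (far _ Bz).
(* The inverses have modulus at most [1 / m], so their difference, scaled by [m / 3], has modulus at
   most [2 / 3]. *)
pose c : C := (m / 3)%:C; have m3 : 0 < m / 3 by rewrite divr_gt0.
have c0 : c != 0 by rewrite -nm_gt0 nm_real gtr0_norm.
pose e := (h z0 + h z0)^-1.
exists (fun z => c * ((h z + h z0)^-1 - e)); split; last by rewrite subrr mulr0.
- apply: (@regular_comp h (fun u => c * ((u + h z0)^-1 - e))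
    (fun u => c * (- 1 / (u + h z0) ^+ 2)) [set u | u + h z0 != 0] rh).
  + by move=> z Bz; exact: far0.
  + move=> u /= u0; split; last first.
      by rewrite mulf_neq0// mulN1r oppr_eq0 invr_eq0 expf_neq0.
    have := cderM (cder_cst c u) (cderB (@cderV _ (fun u => u + h z0) u _ u0
      (cderD (cder_id u) (cder_cst (h z0) u))) (cder_cst e u)).
    by congr cder; rewrite mul0r add0r subr0 addr0.
  + move=> x y /= x0 y0 /(mulfI c0)/addIr/invr_inj/addIr; exact.
- move=> z Bz; rewrite nmM nm_real gtr0_norm//.
  have H x : B x -> nm (h x + h z0)^-1 <= m^-1.
    by move=> Bx; rewrite nmV lef_pV2 ?posrE ?far// nm_gt0 far0.
  have : nm ((h z + h z0)^-1 - e) <= 2 * m^-1.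
    by have := nmB (h z + h z0)^-1 e; have := H _ Bz; have := H _ Bz0; rewrite -/e; lra.
  rewrite -(ler_pM2l m3) => /le_lt_trans; apply.
  have -> : m / 3 * (2 * m^-1) = 2 / 3 by field; rewrite gt_eqF.
  by rewrite ltr_pdivrMr// mul1r ltr_nat.
Qed.

Lemma normalized_derivative_bound : exists K : R, forall g d, normalized g ->
  cder g z0 d -> nm d <= K.
Proof.
have [r r0 rB] := ballB Bz0; exists (2 * 1 / (r / 4)) => g d [rg g1 _] gd.
have r20 : 0 < r / 2 by rewrite divr_gt0.
have r40 : 0 < r / 4 by rewrite divr_gt0.
have hg : holo_off [::] g z0 (r / 2).
  apply: (@holo_ball_off _ g z0 r); last by lra.
  by move=> z /rB; exact: regular_injection_holo.
have := @slope_bound _ [::] g z0 (r / 2) (r / 4) 1 z0 d r40 r20 hg _ _ gd z0.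
rewrite /slope eqxx subrr nm0; apply; [|lra|lra].
by move=> z zr; apply/ltW/g1/rB; lra.
Qed.

Section limit_of_normalized.
Variables (U : set_system nat) (G : nat -> C -> C) (g : C -> C) (D : nat -> C) (d : C).
Hypotheses (UU : UltraFilter U) (nG : forall n, normalized (G n)).
Hypothesis Gg : forall z, B z -> G n z @[n --> U] --> g z.
Hypotheses (GD : forall n, cder (G n) z0 (D n)) (gd : cder g z0 d) (d0 : d != 0).

Let UF : ProperFilter U. Proof. exact: ultra_proper. Qed.
Let UFf : Filter U. Proof. exact: filter_filter. Qed.

Let G_holo n z : B z -> derivable (G n) z 1.
Proof. by have [rg _ _] := nG n; exact: regular_injection_holo. Qed.

Let G_lt1 n z : B z -> nm (G n z) < 1.
Proof. by have [_ h _] := nG n; exact: h. Qed.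

Let allU (P : nat -> Prop) : (forall n, P n) -> U [set n | P n].
Proof. by move=> H; apply: filterS filterT => n _. Qed.

Let g_holo z : B z -> derivable g z 1.
Proof.
move=> Bz; have [r r0 rB] := ballB Bz.
apply: (@ultralimit_derivable _ _ U G g z r 1) => //.
  apply: allU => n; split=> [w /rB|w /rB Bw]; first exact: G_holo.
  by apply/ltW/G_lt1.
by move=> w /rB; exact: Gg.
Qed.

(** The nonzero derivative at [z0] excludes the degenerate case of Hurwitz's theorem, a constant
    limit. *)
Let g_not_cst (c z : C) (r : R) : B z -> 0 < r -> ~ forall w, nm (w - z) < r -> g w = c.
Proof.
move=> Bz r0 gc; have : forall w, B w -> g w - c = 0.
  apply: (@identity_principle _ (fun w => g w - c) B z oB connectedB _ Bz).
    by move=> w /g_holo; exact: derivable_subc.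
  by exists r => // w /gc ->; rewrite subrr.
move=> gcB; have [s s0 sB] := ballB Bz0; move/negP: d0; apply; apply/eqP.
apply: (cder_unique gd); apply: cder_near (cder_cst c z0).
by exists s => // w /sB/gcB/eqP; rewrite subr_eq0 => /eqP.
Qed.

Let g_le1 z : B z -> nm (g z) <= 1.
Proof.
move=> Bz; rewrite -[g z]subr0; apply: (cvg_nm_le _ (Gg Bz)).
by apply: allU => n; rewrite subr0; apply/ltW/G_lt1.
Qed.

Let g_isolated z : B z ->
  exists2 e, 0 < e & forall w, w != z -> nm (w - z) < e -> g w - g z != 0.
Proof.
move=> Bz; have [r r0 rB] := ballB Bz.
have [|gz|//] := @isolated_zeros _ (fun w => g w - g z) z r r0.
  by move=> w /rB/g_holo; exact: derivable_subc.
exfalso; apply: (g_not_cst (c := g z) Bz r0) => w /gz/eqP.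
by rewrite subr_eq0 => /eqP.
Qed.

(** At a value of modulus 1, the open mapping theorem would produce a nearby value of larger
    modulus, in the same direction. *)
Let g_lt1 z : B z -> nm (g z) < 1.
Proof.
move=> Bz; rewrite lt_def g_le1// andbT; apply/eqP => g1.
have [r r0 rB] := ballB Bz; have [e e0 eH] := g_isolated Bz.
pose s := Num.min (r / 2) (e / 2); have s0 : 0 < s by rewrite lt_min !divr_gt0.
have sr : s <= r / 2 by rewrite ge_min lexx.
have se : s <= e / 2 by rewrite ge_min lexx orbT.
have sr' : s < r by lra.
have [|w ws|m m0 mH] := @open_map _ g z s r s0 sr'.
- by move=> w /rB; exact: g_holo.
- rewrite -subr_eq0; apply: eH; last by rewrite ws; lra.
  by rewrite -subr_eq0 -nm_gt0 ws.
have [|w ws wv] := mH ((1 + m / 2)%:C * g z).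
  have -> : (1 + m / 2)%:C * g z - g z = (m / 2)%:C * g z by rewrite rcD rc1; ring.
  by rewrite nmM -g1 mulr1 nm_real gtr0_norm ?divr_gt0//; lra.
have : nm (g w) <= 1 by apply/g_le1/rB; lra.
by rewrite wv nmM -g1 mulr1 nm_real gtr0_norm ?addr_gt0 ?divr_gt0//; lra.
Qed.

(** Hurwitz's theorem for [G n - G n x] on a ball around [y] too small to contain [x], where these
    functions do not vanish. *)
Let g_inj x y : B x -> B y -> g x = g y -> x = y.
Proof.
move=> Bx By gxy; apply/eqP; apply: contraT => xy.
have [r r0 rB] := ballB By; have [e e0 eH] := g_isolated By.
have yx0 : 0 < nm (x - y) by rewrite nm_gt0 subr_eq0.
pose s := Num.min r (nm (x - y)); have s0 : 0 < s by rewrite lt_min r0.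
have sB w : nm (w - y) < s -> B w by rewrite lt_min => /andP[/rB].
have := @hurwitz _ _ U (fun n w => G n w - G n x) (fun w => g w - g x) y s 2 UU s0.
rewrite gxy subrr => /(_ _ _ _ _)/eqP; case => //.
- apply: allU => n; split=> [w /sB/(G_holo (n := n))|w /sB Bw|w ws].
  + exact: derivable_subc.
  + have := nmB (G n w) (G n x); have := G_lt1 n Bw; have := G_lt1 n Bx; lra.
  + rewrite subr_eq0; apply/eqP => E; have [[_ ig] _ _] := nG n.
    by have wx := ig _ _ (sB _ ws) Bx E; move: ws; rewrite wx lt_min ltxx andbF.
- by move=> w /sB Bw; rewrite -gxy; exact: (cvgB (Gg Bw) (Gg Bx)).
- by exists e => // w wy we; rewrite eH.
- move=> w ws; apply: contB; last exact: cont_cst.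
  by apply/derivable_cont/g_holo/sB; lra.
Qed.

(** Hurwitz's theorem once more, for the derivatives: they are nonvanishing, bounded by [8 / r] near
    [z], and converge to the derivative of [g]. *)
Let g_cder_neq0 z c : B z -> cder g z c -> c != 0.
Proof.
move=> Bz gc; have [r r0 rB] := ballB Bz.
have H n w : exists e, B w -> cder (G n) w e.
  have [Bw|nBw] := pselect (B w); last by exists 0.
  by have /derivable_cderP[e we] := G_holo (n := n) Bw; exists e.
have H2 n : exists F1 : C -> C, forall w, B w -> cder (G n) w (F1 w).
  by have [F1 F1P] := choice (H n); exists F1.
have [D1 D1P] := choice H2.
have H' w : exists e, B w -> cder g w e.
  have [Bw|nBw] := pselect (B w); last by exists 0.
  by have /derivable_cderP[e we] := g_holo Bw; exists e.
have [g1 g1P] := choice H'.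
have hol (F F1 : C -> C) w : (forall u, B u -> derivable F u 1) ->
    (forall u, B u -> cder F u (F1 u)) -> B w -> derivable F1 w 1.
  move=> hF FF1 Bw; have [s s0 sB] := ballB Bw.
  by apply: (derivative_derivable s0) => u /sB; [exact: hF|exact: FF1].
have g1_holo w : B w -> derivable g1 w 1 by exact: hol g_holo g1P.
have g1_iso : exists2 e, 0 < e & forall w, w != z -> nm (w - z) < e -> g1 w != 0.
  have [|g10|//] := @isolated_zeros _ g1 z r r0; first by move=> w /rB; exact: g1_holo.
  have g1B : forall w, B w -> g1 w = 0.
    by apply: (identity_principle oB connectedB g1_holo Bz); exists r.
  by move/eqP: d0; case; rewrite -(g1B _ Bz0); apply: (cder_unique gd); exact: g1P.
rewrite (cder_unique gc (g1P _ Bz)).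
pose s := r / 2; have s0 : 0 < s by rewrite divr_gt0.
have bound n w : nm (w - z) < s -> nm (D1 n w) <= 8 / r.
  move=> ws; have r20 : 0 < r / 2 by rewrite divr_gt0.
  have r40 : 0 < r / 4 by rewrite divr_gt0.
  have wB u : nm (u - w) < r / 2 -> B u.
    by move=> uw; apply: rB; have := nm_distD w u z; rewrite /s in ws; lra.
  have Bw : B w by apply: rB; rewrite /s in ws; lra.
  have r83 : r / 4 < r / 2 by lra.
  have hG : holo_off [::] (G n) w (r / 4).
    by apply: (holo_ball_off (r := r / 2)) => // u /wB; exact: G_holo.
  have := @slope_bound _ [::] (G n) w (r / 4) (r / 4) 1 w (D1 n w) r40 r40 hG _ _ (D1P n w Bw) w.
  rewrite /slope eqxx subrr nm0 => /(_ _ _ _)/le_trans; apply; [|lra|lra|].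
    by move=> u uw; apply/ltW/G_lt1/wB; lra.
  by rewrite le_eqVlt; apply/orP; left; apply/eqP; field; rewrite gt_eqF.
have sB w : nm (w - z) < s -> B w by move=> ws; apply: rB; rewrite /s in ws; lra.
apply: (@hurwitz _ _ U D1 g1 z s (8 / r) UU s0) => //.
- apply: allU => n; split=> [w /sB|w|w /sB Bw]; [|exact: bound|].
    exact: hol (G_holo (n := n)) (D1P n).
  have [[rg _] _ _] := nG n; have [e we e0] := rg _ Bw.
  by rewrite (cder_unique (D1P n w Bw) we).
- move=> w /sB Bw; have [t t0 tB] := ballB Bw.
  have [|u /tB||e we eD] := @ultralimit_cder _ _ U G g w t 1 UU t0 _ _ (fun n => D1 n w).
  + by apply: allU => n; split=> [u /tB|u /tB Bu]; [exact: G_holo|apply/ltW/G_lt1].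
  + exact: Gg.
  + by apply: allU => n; exact: D1P.
  + by rewrite (cder_unique (g1P _ Bw) we).
- by move=> w ws; apply/derivable_cont/g1_holo/sB; lra.
Qed.

Lemma limit_normalized : normalized g.
Proof.
split; last first.
- apply: nm0_eq0; apply/eqP; rewrite eq_le nm_ge0 andbT -[g z0]subr0.
  apply: (cvg_nm_le _ (Gg Bz0)); apply: allU => n.
  by have [_ _ ->] := nG n; rewrite subrr nm0.
- exact: g_lt1.
split=> [z Bz|]; last exact: g_inj.
have /derivable_cderP[c gc] := g_holo Bz; exists c => //.
exact: g_cder_neq0 gc.
Qed.

End limit_of_normalized.

End riemann_mapping.

(** * The extremal problem and the Riemann mapping theorem *)

Section riemann_mapping_theorem.
Variable R : realType.
Local Notation C := R[i].
Implicit Types (g f : C -> C) (z w d v : C).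

Variables (B : set C) (z0 : C).
Hypotheses (oB : open B) (scB : simply_connected B) (Bz0 : B z0).

Lemma extremal_normalized : (exists w, ~ B w) -> exists g d,
  [/\ normalized B z0 g, cder g z0 d &
      forall g' d', normalized B z0 g' -> cder g' z0 d' -> nm d' <= nm d].
Proof.
move=> nB; have [g0 ng0] := normalized_exists oB scB Bz0 nB.
have [d0 gd0 d00] := (let: And3 rg _ _ := ng0 in rg).1 _ Bz0.
have [K KP] := normalized_derivative_bound oB Bz0.
pose E := [set x : R | exists g d, [/\ normalized B z0 g, cder g z0 d & x = nm d]].
have Ed g d : normalized B z0 g -> cder g z0 d -> E (nm d) by move=> ng gd; exists g, d.
have Eub : has_ubound E by exists K => _ [g [d [ng gd ->]]]; exact: KP gd.
have supE : has_sup E by split=> //; exists (nm d0); exact: Ed gd0.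
have Hn (n : nat) : exists x : (C -> C) * C, [/\ normalized B z0 x.1, cder x.1 z0 x.2 &
    sup E - (n.+1%:R)^-1 < nm x.2].
  have e0 : (0 : R) < (n.+1%:R)^-1 by rewrite invr_gt0.
  by have [_ [g [d [ng gd ->]]] dn] := sup_adherent e0 supE; exists (g, d).
have [x xP] := choice Hn.
have [U [UU UF UFf Uinf]] := ultra_nat.
have nG n : normalized B z0 (x n).1 by have [] := xP n.
have H z : exists l : C, B z -> (x n).1 z @[n --> U] --> l.
  have [Bz|nBz] := pselect (B z); last by exists 0.
  have [|l xl] := @ultra_cvg _ _ U UU (fun n => (x n).1 z) 1; last by exists l.
  by apply: Uinf; exists 0%N => n _ /=; have [_ lt1 _] := nG n; exact/ltW/lt1.
have [g gP] := choice H.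
have [r r0 rB] := ballB oB Bz0.
have [|w /rB||d gd dD] := @ultralimit_cder _ _ U (fun n => (x n).1) g z0 r 1 UU r0 _ _ (fun n => (x n).2).
- apply: Uinf; exists 0%N => n _; have [rg lt1 _] := nG n.
  by split=> [w /rB|w /rB Bw]; [exact: regular_injection_holo|exact/ltW/lt1].
- exact: gP.
- by apply: Uinf; exists 0%N => n _ /=; have [] := xP n.
have supd : sup E <= nm d.
  apply/ler_addgt0Pl => e e0; have e20 : 0 < e / 2 by rewrite divr_gt0.
  move/cvg_nmP : dD => /(_ _ e20) dD.
  have Ub : U [set n : nat | n.+1%:R^-1 < e / 2] by apply: Uinf; exact: invS_small.
  have [n [/= dn ne]] := filter_ex (filterI dD Ub); have [_ _ supn] := xP n.
  by move: (n.+1%:R^-1) ne supn => i ne supn; have := nm_lerB (x n).2 d; lra.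
have max g' d' : normalized B z0 g' -> cder g' z0 d' -> nm d' <= nm d.
  by move=> ng gd'; apply: le_trans supd; apply: sup_ubound => //; exact: Ed gd'.
exists g, d; split => //.
have GD n : cder (x n).1 z0 (x n).2 by have [] := xP n.
apply: (limit_normalized oB scB Bz0 UU nG gP gd).
(* The maximal derivative dominates that of [g0], hence does not vanish. *)
rewrite -nm_gt0; apply: lt_le_trans (max _ _ ng0 gd0).
by rewrite nm_gt0.
Qed.

(* Koebe's square root trick: a normalized map omitting [v] can be expanded. *)
Lemma koebe_expansion g d v : normalized B z0 g -> cder g z0 d -> nm v < 1 ->
  (forall z, B z -> g z != v) ->
  exists g' d', [/\ normalized B z0 g', cder g' z0 d' & nm d < nm d'].
Proof.
move=> [rg g1 g0] gd v1 gv; pose D := [set x : C | nm x < 1].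
have [d1 gd1 d10] := rg.1 _ Bz0; have d0 : d != 0 by rewrite (cder_unique gd gd1).
have rF : regular_injection B (fun z => mobius v (g z)).
  apply: (@regular_comp _ B g (mobius v) (fun x => (1 - v^*%C * v) / (1 - v^*%C * x) ^+ 2) D rg g1).
    by move=> x x1; split; [exact: mobius_cder|exact: mobius_cder_neq0].
  by move=> x y; exact: mobius_inj.
have [|s rs sE] := sqrt_regular oB scB rF.
  move=> z Bz; rewrite /mobius mulf_neq0 ?invr_eq0 ?mobius_den ?g1//.
  by rewrite subr_eq0 gv.
have s1 z : B z -> D (s z).
  move=> Bz; rewrite /D /= -(@expr_lt1 _ 2)// ?nm_ge0// -nmX sE//.
  by rewrite mobius_lt1// g1.
have t1 : nm (s z0) < 1 by exact: s1.
have t2 : s z0 ^+ 2 = - v by rewrite sE// /mobius g0 mulr0 subr0 divr1 sub0r.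
have v0 : v != 0 by have := gv _ Bz0; rewrite g0 eq_sym.
have t0 : s z0 != 0 by rewrite -sqrf_eq0 t2 oppr_eq0.
have [r r0 rB] := ballB oB Bz0.
have [ds sds _] := rs.1 _ Bz0.
have dsE : ds = d * (1 - v^*%C * v) / (2 * s z0).
  have gz1 : nm (g z0) < 1 by rewrite g0 nm0.
  have Fd := cder_comp gd (mobius_cder v1 gz1).
  have := sqrt_cder r0 (fun w wr => sE w (rB w wr)) (cder_cont sds) t0 Fd.
  move=> /(cder_unique sds) ->; rewrite g0 mulr0 subr0 expr1n divr1.
  by rewrite [d * _]mulrC.
exists (fun z => mobius (s z0) (s z)).
exists ((1 - (s z0)^*%C * s z0) / (1 - (s z0)^*%C * s z0) ^+ 2 * ds).
have den0 := mobius_den t1 t1.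
split.
- split; last by rewrite /mobius subrr mul0r.
    apply: (@regular_comp _ B s (mobius (s z0))
      (fun x => (1 - (s z0)^*%C * s z0) / (1 - (s z0)^*%C * x) ^+ 2) D rs s1).
      by move=> x x1; split; [exact: mobius_cder|exact: mobius_cder_neq0].
    by move=> x y; exact: mobius_inj.
  by move=> z Bz; rewrite mobius_lt1// s1.
- exact: (cder_comp sds (mobius_cder t1 t1)).
set t := nm (s z0) in t1 *.
have tgt0 : 0 < t by rewrite nm_gt0.
have vt : nm v = t ^+ 2 by rewrite -nmX t2 nmN.
have sub1 : 0 < 1 - t ^+ 2 by rewrite subr_gt0 expr_lt1// ltW.
have two : nm (2 : C) = 2.
  have <- : (2 : R)%:C = 2 :> C by rewrite -[2]/(1 + 1) rcD.
  by rewrite nm_real gtr0_norm.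
have onem (x : R) : nm (1 - x%:C : C) = `|1 - x| by rewrite -rc1 -rcB nm_real.
have XE (X : C) : X != 0 -> X / X ^+ 2 = X^-1 by move=> X0; field.
rewrite dsE XE// !conjM_nm -/t vt.
rewrite !nmM !nmV nmM two -/t !onem !gtr0_norm//; last first.
  by rewrite subr_gt0 expr_lt1 ?exprn_ge0 ?ltW// expr_lt1// ltW.
have dgt0 : 0 < nm d by rewrite nm_gt0.
(* The gain is [(1 + t ^+ 2) / (2 * t)], because [v] has modulus [t ^+ 2]; it exceeds 1 since
   [(1 - t) ^+ 2] is positive. *)
have -> : (1 - t ^+ 2)^-1 * (nm d * (1 - (t ^+ 2) ^+ 2) * (2 * t)^-1) =
    nm d * ((1 + t ^+ 2) / (2 * t)).
  by field; rewrite !gt_eqF.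
rewrite -[ltLHS]mulr1 ltr_pM2l// ltr_pdivlMr ?mulr_gt0// mul1r -subr_gt0.
have -> : 1 + t ^+ 2 - 2 * t = (1 - t) ^+ 2 by ring.
by rewrite exprn_gt0// subr_gt0.
Qed.

(** By maximality the extremal map omits no value of the disc; its inverse is the map sought. *)
Lemma riemann_mapping : (exists w, ~ B w) -> exists f : C -> C,
  [/\ holomorphic_on (@unit_disc R) f, set_inj (@unit_disc R) f & f @` (@unit_disc R) = B].
Proof.
move=> nB; have [g [d [ng gd gmax]]] := extremal_normalized nB.
have [rg g1 _] := ng.
have surj v : exists z, nm v < 1 -> B z /\ g z = v.
  have [v1|v1] := pselect (nm v < 1); last by exists 0.
  have [[z [Bz gz]]|no] := pselect (exists z, B z /\ g z = v); first by exists z.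
  have [|g' [d' [ng' gd' lt]]] := koebe_expansion ng gd v1.
    by move=> z Bz; apply: contra_notN no => /eqP gz; exists z.
  by have := gmax _ _ ng' gd'; rewrite leNgt lt.
have [f fP] := choice surj.
have fg z : B z -> f (g z) = z.
  by move=> Bz; have [Bf gf] := fP _ (g1 _ Bz); exact: rg.2.
exists f; split.
- move=> v /unit_discP/fP[Bf gf]; have [r r0 rB] := ballB oB Bf.
  have [c gc c0] := rg.1 _ Bf.
  apply/derivable_cderP; exists c^-1; rewrite -gf; apply: (inverse_cder r0) => //.
    by move=> w /rB; exact: regular_injection_holo.
  by move=> z /rB; exact: fg.
- by move=> x y; rewrite !inE => /unit_discP/fP[_ gx] /unit_discP/fP[_ gy] E; rewrite -gx E.
- apply/seteqP; split=> [_ [v /unit_discP/fP[Bf _] <-]//|z Bz].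
  by exists (g z); [exact/unit_discP/g1|exact: fg].
Qed.

End riemann_mapping_theorem.

(** * Removable sets: empty interior, and no two points joined by arbitrarily fine chains *)

Section removable_sets.
Variable R : realType.
Local Notation C := R[i].
Implicit Types (z w x y b : C).

Variable K : set C.
Hypothesis remK : removable K.

Lemma compact_nm_bounded (A : set C) : compact A -> exists2 M : R, 0 < M & forall z, A z -> nm z <= M.
Proof.
move=> cA; have [A0|A0] := pselect (A !=set0); last first.
  by exists 1 => // z Az; exfalso; apply: A0; exists z.
have [] := @compact_EVT_max C R (fun z => nm z) A A0 cA.
  apply: continuous_subspaceT => z; apply: (@continuous_nm _ _ (fun z : C => z)).
  exact: cont_id.
move=> p _ pM; exists (nm p + 1); first by rewrite ltr_wpDl ?nm_ge0.
by move=> z Az; have := pM z; rewrite inE => /(_ Az); lra.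
Qed.

Lemma off_compact (A : set C) z : compact A -> ~ A z ->
  exists2 r : R, 0 < r & forall w, nm (w - z) < r -> ~ A w.
Proof.
move=> cA nAz; have clA : closed A by apply: compact_closed => //; exact: norm_hausdorff.
by apply: (open_nmP _).1 nAz; exact: closed_openC.
Qed.

Lemma removable_extension (U : set C) (f : C -> C) (M : R) : open U -> K `<=` U ->
  (forall z, U z -> ~ K z -> derivable f z 1 /\ nm (f z) <= M) ->
  exists2 g : C -> C, forall z, U z -> derivable g z 1 &
    forall z, U z -> ~ K z -> g z = f z.
Proof.
move=> oU KU fU; have [||g hg gf] := remK.2 U oU KU f.
- by move=> z [Uz nKz]; have [] := fU z Uz nKz.
- exists M%:C; split; first by rewrite realE !lecR -realE num_real.
  move=> x Mx z [Uz nKz]; have : (nm (f z))%:C <= x.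
    by apply: le_trans (ltW Mx); rewrite lecR; have [] := fU z Uz nKz.
  by rewrite -normcE_nm => H; exact H.
by exists g => // z Uz nKz; apply: gf; rewrite inE.
Qed.

(** If [K] contained a ball around [z], then [1 / (w - z)] would be bounded off [K]. Its extension
    would still be an inverse of [w - z] at [w = z], by the identity principle. *)
Lemma removable_no_interior z (r : R) : 0 < r -> exists2 w, nm (w - z) < r & ~ K w.
Proof.
move=> r0; apply: contrapT => noW.
have ballK w : nm (w - z) < r -> K w by move=> wr; apply: contrapT => nKw; apply: noW; exists w.
have [|||g hg gf] := @removable_extension setT (fun w => (w - z)^-1) r^-1.
- exact: openT.
- by [].
- move=> w _ nKw; have wr : r <= nm (w - z) by rewrite leNgt; apply/negP => /ballK.
  have wz0 : w - z != 0 by rewrite -nm_gt0; apply: lt_le_trans wr.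
  split; last by rewrite nmV lef_pV2 ?posrE ?nm_gt0.
  apply/derivable_cderP; eexists; apply: (@cderV _ (fun w => w - z)) => //.
  by apply: cderB; [exact: cder_id|exact: cder_cst].
have [M M0 KM] := compact_nm_bounded remK.1.
(* The unit ball around [p] misses [K], and the ball of radius [rho] around [z] contains [p]. *)
pose p : C := (M + 2)%:C; pose rho := nm z + M + 4.
have pE : nm p = M + 2 by rewrite nm_real gtr0_norm// addr_gt0.
pose B := [set w | nm (w - z) < rho].
have oB : open B.
  apply/open_nmP => w wr; exists (rho - nm (w - z)); first by rewrite subr_gt0.
  by move=> v vw; rewrite /B /=; have := nm_distD w v z; lra.
have Bz : B z by rewrite /B /= subrr nm0 /rho; have := nm_ge0 z; lra.
have Bp : B p by rewrite /B /=; have := nmB p z; rewrite pE /rho; lra.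
have far v : nm (v - p) < 1 -> ~ K v.
  by move=> vp /KM; have := nm_lerB p v; rewrite nm_distC pE; lra.
have /(_ z Bz)/eqP : forall w, B w -> g w * (w - z) - 1 = 0.
  apply: (@identity_principle _ (fun w => g w * (w - z) - 1) B p oB
    (connectedB (simply_connected_ball z rho) Bz) _ Bp).
    move=> w _; have /derivable_cderP[d gd] := hg w I; apply/derivable_cderP; eexists.
    apply: cderB; last exact: cder_cst.
    by apply: cderM; [exact: gd|apply: cderB; [exact: cder_id|exact: cder_cst]].
  exists 1 => // v /far nKv; rewrite gf// mulVf ?subrr//.
  rewrite -nm_gt0 ltNge; apply/negP => vz; apply: nKv; apply: ballK.
  exact: le_lt_trans vz r0.
by rewrite subrr mulr0 sub0r oppr_eq0 oner_eq0.
Qed.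

Lemma removable_dense (f g : C -> C) z (r : R) : 0 < r -> cont_at f z -> cont_at g z ->
  (forall w, nm (w - z) < r -> ~ K w -> f w = g w) -> f z = g z.
Proof.
move=> r0 cf cg fg; apply: cont_eq_off => // e e0.
have m0 : 0 < Num.min r e by rewrite lt_min r0.
have [w] := removable_no_interior z m0; rewrite lt_min => /andP[wr we] nKw.
by exists w => //; exact: fg.
Qed.

(** Chain classes stand in for connected components: points of [K] in different classes are at
    distance at least [delta], so a class is relatively clopen in [K]. *)
Inductive chain (delta : R) (w : C) : C -> Prop :=
| Chain0 : chain delta w w
| ChainS x y : chain delta w x -> K y -> nm (y - x) < delta -> chain delta w y.

Lemma chain_in delta w x : K w -> chain delta w x -> K x.
Proof. by move=> Kw; case. Qed.

Lemma chain_mono (d e : R) w x : d <= e -> chain d w x -> chain e w x.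
Proof.
move=> de; elim=> [|x' y _ IH Ky yx]; first exact: Chain0.
by apply: ChainS IH Ky _; exact: lt_le_trans yx de.
Qed.

(** The quotient telescopes along the chain; each factor [(z - x) / (z - y)] has positive real part
    because the link is shorter than the distance from [z] to [y]. *)
Lemma chain_sqrt (delta : R) w b : 0 < delta -> K w -> chain delta w b ->
  exists s : C -> C, forall z, (forall x, K x -> delta <= nm (z - x)) ->
    cont_at s z /\ s z ^+ 2 = (z - w) / (z - b).
Proof.
move=> d0 Kw; have off z x : (forall x, K x -> delta <= nm (z - x)) -> K x -> z - x != 0.
  by move=> zK Kx; rewrite -nm_gt0; apply: lt_le_trans (zK _ Kx).
elim=> [|x y wx [s sP] Ky yx].
  exists (fun=> 1) => z zK; split; first exact: cont_cst.
  by rewrite expr1n divff// off.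
have Kx := chain_in Kw wx.
exists (fun z => s z * psqrt ((z - x) / (z - y))) => z zK; have [cs sE] := sP z zK.
have pos : 0 < Re ((z - x) / (z - y)).
  apply: Re_ratio; have -> : z - x - (z - y) = y - x by ring.
  exact: lt_le_trans (zK _ Ky).
have zx := off _ _ zK Kx; have zy := off _ _ zK Ky.
split; last by rewrite exprMn psqrtK// sE; field; apply/andP.
apply: contM => //; apply: cont_compC; last exact: psqrt_cont.
apply: contM; first exact: cont_subc.
by apply: (@contV _ _ (fun z => z - y)) => //; exact: cont_subc.
Qed.

(** Near [z] a branch is determined by its value at [z]; convergence of branches at one point thus
    controls them nearby. *)
Lemma local_branch (s F : C -> C) z (r : R) :
  (forall w, nm (w - z) < r -> cont_at s w /\ s w ^+ 2 = F w) ->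
  (forall w, nm (w - z) < r -> cont_at F w /\ nm (F w - F z) < nm (F z)) ->
  forall w, nm (w - z) < r -> s w = s z * psqrt (F w / F z).
Proof.
move=> sP FP w wr; have z0 : nm (z - z) < r by rewrite subrr nm0 (le_lt_trans _ wr)// nm_ge0.
have inb t : nm (seg z w (clamp t) - z) < r by exact: (convex_ball z0 wr (clamp01 t)).
have cseg t : cont_at (fun t => seg z w (clamp t)) t.
  by apply: (@cont_comp _ _ _ (seg z w) (@clamp R)); [exact: clamp_cont|exact: seg_cont].
have Fz0 : F z != 0 by rewrite -nm_gt0; apply: le_lt_trans (nm_ge0 _) (FP _ z0).2.
have pos t : 0 < Re (F (seg z w (clamp t)) / F z) by apply: Re_ratio; exact: (FP _ (inb t)).2.
have F0 t : F (seg z w (clamp t)) != 0.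
  by apply: contraTneq (pos t) => ->; rewrite mul0r ltxx.
have i0 : 0 <= (0 : R) <= 1 by rewrite lexx ler01.
have i1 : 0 <= (1 : R) <= 1 by rewrite lexx ler01.
have := @path_lift_unique _ (fun t => s (seg z w (clamp t)))
  (fun t => s z * psqrt (F (seg z w (clamp t)) / F z)) _ _ _ _ 1 i1.
rewrite !clampE// seg0 seg1; apply.
- by move=> t; apply: cont_compC => //; have [] := sP _ (inb t).
- move=> t; apply: contM; first exact: cont_cst.
  apply: cont_compC; last exact: psqrt_cont.
  apply: contM; last exact: cont_cst.
  by apply: cont_compC => //; have [] := FP _ (inb t).
- move=> t _; have [_ sE] := sP _ (inb t); have [_ sz] := sP _ z0.
  by rewrite exprMn psqrtK// sz sE mulrC divfK// -sqrf_eq0 sE.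
- by rewrite divff// psqrt1 mulr1.
Qed.

(** Finer chains give branches closer to [K], with unrelated signs. An ultrafilter limit settles all
    signs at once, and [local_branch] makes the limit continuous. *)
Lemma chained_sqrt w b : K w -> K b -> (forall delta, 0 < delta -> chain delta w b) ->
  exists s : C -> C, forall z, ~ K z -> cont_at s z /\ s z ^+ 2 = (z - w) / (z - b).
Proof.
move=> Kw Kb ch; pose dl (n : nat) : R := n.+1%:R^-1.
have dl0 n : 0 < dl n by rewrite invr_gt0.
have [s sP] := choice (fun n => chain_sqrt (dl0 n) Kw (ch _ (dl0 n))).
have [U [UU UF UFf Uinf]] := ultra_nat.
pose F z := (z - w) / (z - b).
have off0 z x : ~ K z -> K x -> z - x != 0.
  by move=> nKz Kx; rewrite subr_eq0; apply: contra_notN nKz => /eqP ->.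
(* near a point off [K], all branches with small enough step are defined *)
have away z : ~ K z -> exists2 r : R, 0 < r &
    U [set n | forall v, nm (v - z) < r -> cont_at (s n) v /\ s n v ^+ 2 = F v].
  move=> nKz; have [r r0 rK] := off_compact remK.1 nKz.
  exists (r / 2); first by rewrite divr_gt0.
  have r20 : 0 < r / 2 by rewrite divr_gt0.
  have [N Nr] := invS_small r20; apply: Uinf; exists N => n nb v vz; apply: sP => x Kx.
  have dr : dl n <= r / 2 by exact/ltW/Nr.
  have : r <= nm (x - z) by rewrite leNgt; apply/negP => /rK.
  by have := nm_distD v x z; rewrite (nm_distC x v); lra.
have H z : exists l : C, ~ K z -> s n z @[n --> U] --> l.
  have [Kz|nKz] := pselect (K z); first by exists 0.
  have [r r0 rU] := away z nKz.
  have [|l sl] := @ultra_cvg _ _ U UU (fun n => s n z) (nm (F z) + 1); last by exists l.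
  apply: filterS rU => n /(_ z); rewrite subrr nm0 => /(_ r0)[_ sF] /=.
  have : nm (s n z) ^+ 2 = nm (F z) by rewrite -nmX sF.
  by move=> <-; have := sqr_ge0 (nm (s n z) - 1); have := nm_ge0 (s n z); rewrite !expr2; nra.
have [l lP] := choice H; exists l => z nKz.
have [r r0 rU] := away z nKz.
have lF v : ~ K v -> l v ^+ 2 = F v.
  move=> nKv; have [q q0 qU] := away v nKv.
  have c2 : s n v ^+ 2 @[n --> U] --> l v ^+ 2.
    by rewrite expr2; under eq_fun do rewrite expr2; exact: (cvgM (lP v nKv) (lP v nKv)).
  apply/eqP; rewrite -subr_eq0 -nm_eq0 eq_le nm_ge0 andbT.
  apply: (cvg_nm_le _ c2); apply: filterS qU => n /(_ v); rewrite subrr nm0 => /(_ q0)[_ ->].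
  by rewrite subrr nm0.
split; last exact: lF.
have cF v : ~ K v -> cont_at F v.
  move=> nKv; apply: contM; first exact: cont_subc.
  apply: (@contV _ _ (fun z => z - b)); first exact: off0.
  exact: cont_subc.
have Fz0 : F z != 0 by rewrite mulf_neq0 ?invr_eq0 ?off0.
have /continuous_nmP/(_ (nm (F z))) := cF z nKz; rewrite nm_gt0 => /(_ Fz0)[q q0 qH].
have [k k0 kK] := off_compact remK.1 nKz.
pose m := Num.min r (Num.min q k); have m0 : 0 < m by rewrite !lt_min r0 q0.
have mP v : nm (v - z) < m -> [/\ nm (v - z) < r, nm (F v - F z) < nm (F z) & ~ K v].
  by rewrite !lt_min => /and3P[? /qH ? /kK].
apply: (@cont_near _ _ (fun v => l z * psqrt (F v / F z))).
  apply/nbhs_nmP; exists m => // v vm; have [_ _ nKv] := mP v vm.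
  have c1 : s n z * psqrt (F v / F z) @[n --> U] --> l z * psqrt (F v / F z).
    by apply: cvgM; [exact: lP|exact: cvg_cst].
  have c2 : s n z * psqrt (F v / F z) - s n v @[n --> U] --> l z * psqrt (F v / F z) - l v.
    exact (cvgB c1 (lP v nKv)).
  apply/eqP; rewrite -subr_eq0 -nm_eq0 eq_le nm_ge0 andbT -[X in nm X]subr0.
  apply: (cvg_nm_le _ c2).
  apply: filterS rU => n sn.
  have <- : s n v = s n z * psqrt (F v / F z); last by rewrite subrr subr0 nm0.
  apply: (@local_branch (s n) F z m _ _ v vm) => u um; have [ur uF nKu] := mP u um.
    exact: sn.
  by split; [exact: cF|].
apply: contM; first exact: cont_cst.
apply: cont_compC; first by apply: contM; [exact: cF|exact: cont_cst].
by apply: psqrt_cont; rewrite divff//= ltr01.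
Qed.

(** The bounded function [1 / (s + s p)] extends to an entire [g]. Off [K], [P := 1 - g * s p]
    equals [g * s], so [g ^+ 2 * (z - w) = P ^+ 2 * (z - b)] everywhere by density. At [w] this
    gives [P w = 0], and after differentiation [g w = 0], hence [P w = 1]. *)
Lemma not_chained w b : K w -> K b -> b != w -> ~ forall delta, 0 < delta -> chain delta w b.
Proof.
move=> Kw Kb bw ch; have [s sP] := chained_sqrt Kw Kb ch.
have [p _ nKp] := removable_no_interior w (ltr01 : 0 < (1 : R)).
have off0 z x : ~ K z -> K x -> z - x != 0.
  by move=> nKz Kx; rewrite subr_eq0; apply: contra_notN nKz => /eqP ->.
have s0 z : ~ K z -> s z != 0.
  by move=> nKz; rewrite -sqrf_eq0 (sP z nKz).2 mulf_neq0 ?invr_eq0 ?off0.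
have [q q0 qK] := off_compact remK.1 nKp.
have sp0 : 0 < nm (s p) by rewrite nm_gt0 s0.
(* as [s ^ 2] is a Moebius map, [s] omits a neighborhood of [- s p] *)
have [c c0 cH] : exists2 c : R, 0 < c & forall z, ~ K z -> c <= nm (s z + s p).
  have /continuous_nmP/(_ _ sp0)[e e0 eH] := (sP p nKp).1.
  have pb0 : 0 < nm (p - b) by rewrite nm_gt0 off0.
  have wb0 : 0 < nm (w - b) by rewrite nm_gt0 subr_eq0 eq_sym.
  (* [s z ^+ 2 - s p ^+ 2] equals [(z - p) * (w - b) / ((z - b) * (p - b))]; [k] bounds its modulus
     from below when [z] is at distance at least [e] from [p]. *)
  pose k := nm (w - b) / nm (p - b) * (e / (e + nm (p - b))).
  have k0 : 0 < k by rewrite mulr_gt0 ?divr_gt0// addr_gt0.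
  exists (Num.min (nm (s p)) (k / (3 * nm (s p)))).
    by rewrite lt_min sp0 divr_gt0// mulr_gt0.
  move=> z nKz; have [ze|ze] := ltP (nm (z - p)) e.
    rewrite ge_min; apply/orP; left; have := eH z ze.
    have := nm_lerB (s p + s p) (s p - s z).
    have -> : s p + s p - (s p - s z) = s z + s p by ring.
    have -> : nm (s p + s p) = 2 * nm (s p).
      have -> : s p + s p = (2 : R)%:C * s p by rewrite -[2]/(1 + 1) rcD rc1; ring.
      by rewrite nmM nm_real gtr0_norm.
    by rewrite (nm_distC (s p) (s z)); lra.
  rewrite leNgt lt_min; apply/negP => /andP[lt1 lt2].
  have zb0 : 0 < nm (z - b) by rewrite nm_gt0 off0.
  have E : nm (s z - s p) * nm (s z + s p) = nm (z - p) * nm (w - b) / (nm (z - b) * nm (p - b)).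
    rewrite -!nmM -nmf; congr nm.
    have -> : (s z - s p) * (s z + s p) = s z ^+ 2 - s p ^+ 2 by ring.
    rewrite (sP z nKz).2 (sP p nKp).2; have := off0 _ _ nKz Kb; have := off0 _ _ nKp Kb.
    by move=> h1 h2; field; rewrite h1 h2.
  have low : k <= nm (s z - s p) * nm (s z + s p).
    rewrite E /k; have -> : nm (z - p) * nm (w - b) / (nm (z - b) * nm (p - b)) =
      nm (w - b) / nm (p - b) * (nm (z - p) / nm (z - b)) by field; rewrite !gt_eqF.
    rewrite ler_pM2l ?divr_gt0// ler_pdivrMr ?addr_gt0// mulrAC ler_pdivlMr//.
    have zb : nm (z - b) <= nm (z - p) + nm (p - b) by exact: nm_distD.
    have : e * nm (z - b) <= e * (nm (z - p) + nm (p - b)) by rewrite ler_pM2l.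
    have : e * nm (p - b) <= nm (z - p) * nm (p - b) by rewrite ler_pM2r.
    by lra.
  have up : nm (s z - s p) <= 3 * nm (s p).
    have := nmB (s z + s p) (s p + s p); have := nmD (s p) (s p).
    have -> : s z + s p - (s p + s p) = s z - s p by ring.
    by lra.
  have : nm (s z - s p) * nm (s z + s p) < k.
    apply: le_lt_trans (_ : 3 * nm (s p) * nm (s z + s p) < k).
      by rewrite ler_wpM2r ?nm_ge0.
    by rewrite mulrC -ltr_pdivlMr// mulr_gt0.
  by rewrite ltNge low.
have sum0 z : ~ K z -> s z + s p != 0.
  by move=> nKz; rewrite -nm_gt0; apply: lt_le_trans (cH z nKz).
have sder z : ~ K z -> derivable s z 1.
  move=> nKz; have [k k0 kK] := off_compact remK.1 nKz.
  have zb := off0 _ _ nKz Kb.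
  have Fd := cderM (cderB (cder_id z) (cder_cst w z))
    (@cderV _ (fun z => z - b) z _ zb (cderB (cder_id z) (cder_cst b z))).
  apply/derivable_cderP; eexists; apply: (sqrt_cder k0 _ (sP z nKz).1 (s0 z nKz) Fd).
  by move=> v /kK nKv; rewrite (sP v nKv).2.
have [|//||g hg gE] := @removable_extension setT (fun z => (s z + s p)^-1) c^-1.
- exact: openT.
- move=> z _ nKz; split; last by rewrite nmV lef_pV2 ?posrE ?nm_gt0 ?sum0// cH.
  have /derivable_cderP[d sd] := sder z nKz.
  apply/derivable_cderP; eexists; apply: (@cderV _ (fun z => s z + s p)); first exact: sum0.
  by apply: cderD; [exact: sd|exact: cder_cst].
pose P z := 1 - g z * s p.
have cg z : cont_at g z by apply: derivable_cont; exact: hg.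
have cP z : cont_at P z.
  by apply: contB; [exact: cont_cst|apply: contM => //; exact: cont_cst].
have gP z : g z ^+ 2 * (z - w) = P z ^+ 2 * (z - b).
  apply: (@removable_dense (fun z => g z ^+ 2 * (z - w)) (fun z => P z ^+ 2 * (z - b)) z 1) => //.
  - by apply: contM; [exact: contX|exact: cont_subc].
  - by apply: contM; [exact: contX|exact: cont_subc].
  - move=> v _ nKv; have gs : P v = g v * s v.
      by rewrite /P gE//; field; exact: sum0.
    rewrite gs exprMn (sP v nKv).2; field; exact: off0.
have Pw0 : P w = 0.
  have /esym/eqP := gP w; rewrite subrr mulr0 mulf_eq0 sqrf_eq0 [w - b == 0]subr_eq0 (eq_sym w).
  by rewrite (negPf bw) orbF => /eqP.
have /derivable_cderP[d gd] := hg w I.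
have D1 := cderM (cderM gd gd) (cderB (cder_id w) (cder_cst w w)).
have Pd := cderB (cder_cst 1 w) (cderM gd (cder_cst (s p) w)).
have D2 := cderM (cderM Pd Pd) (cderB (cder_id w) (cder_cst b w)).
have E : (fun z => g z * g z * (z - w)) = (fun z => P z * P z * (z - b)).
  by apply/funext => z; rewrite -!expr2 gP.
rewrite E in D1; have D12 := cder_unique D1 D2.
have /eqP : g w * g w = 0.
  transitivity ((d * g w + g w * d) * (w - w) + g w * g w * (1 - 0)); first by ring.
  by rewrite D12 -/(P w) Pw0; ring.
rewrite mulf_eq0 orbb => /eqP gw.
by have := Pw0; rewrite /P gw mul0r subr0 => /eqP; rewrite oner_eq0.
Qed.

End removable_sets.

(** * No root of [z - w] near a point [w] of a removable set *)

Section simply_connected_hull.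
Variable R : realType.
Local Notation C := R[i].
Implicit Types (z w x y b : C).

Variable K : set C.
Hypothesis remK : removable K.

(** Otherwise ever finer chains from [w] have endpoints at distance at least [e], accumulating at
    some [b] of [K]; one more link reaches [b], which is then chained to [w] for every step. *)
Lemma small_chain_class w (e : R) : K w -> 0 < e ->
  exists2 delta, 0 < delta & forall x, chain K delta w x -> nm (x - w) < e.
Proof.
move=> Kw e0; apply: contrapT => nod.
pose dl (n : nat) : R := n.+1%:R^-1; have dl0 n : 0 < dl n by rewrite invr_gt0.
have Hn n : exists x, chain K (dl n) w x /\ e <= nm (x - w).
  apply: contrapT => no; apply: nod; exists (dl n) => // x wx.
  by rewrite ltNge; apply/negP => ex; apply: no; exists x.
have [x xP] := choice Hn.
have [U [UU UF UFf Uinf]] := ultra_nat.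
have Kx n : K (x n) by have [c _] := xP n; exact: chain_in c.
have [M M0 KM] := compact_nm_bounded remK.1.
have [|b xb] := @ultra_cvg _ _ U UU x M.
  by apply: Uinf; exists 0%N => n _ /=; apply: KM.
have near_b k : 0 < k -> exists2 n : nat, dl n < k & nm (x n - b) < k.
  move=> k0; move/cvg_nmP : xb => /(_ _ k0) xb.
  have Un : U [set n | dl n < k] by apply: Uinf; exact: invS_small.
  by have [n [/= xn bn]] := filter_ex (filterI xb Un); exists n.
have Kb : K b.
  apply: contrapT => nKb; have [r r0 rK] := off_compact remK.1 nKb.
  by have [n _ /rK] := near_b r r0; apply.
have eb : e <= nm (b - w).
  apply/ler_addgt0Pl => k k0; have [n _ xn] := near_b k k0.
  have [_ exn] := xP n; have := nm_distD b (x n) w; lra.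
have bw : b != w by rewrite -subr_eq0 -nm_gt0; apply: lt_le_trans eb.
apply: (not_chained remK Kw Kb bw) => k k0; have [n dn xn] := near_b k k0.
have [wxn _] := xP n; apply: ChainS (chain_mono (ltW dn) wxn) Kb _.
by rewrite nm_distC.
Qed.

(** After extension, [g ^+ 2 = z - w] near [w] with [g w = 0]; differentiating at [w] gives
    [1 = 0]. *)
Lemma no_local_sqrt w (e : R) (h : C -> C) : K w -> 0 < e ->
  (forall z, nm (z - w) < e -> ~ K z -> derivable h z 1 /\ h z ^+ 2 = z - w) -> False.
Proof.
move=> Kw e0 hP; have [dl dl0 dlP] := small_chain_class Kw e0.
(* Neighborhoods of the chain class of [w] and of the rest of [K]. The radius [dl / 2] makes them
   disjoint, because points of [K] less than [dl] apart share a class. *)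
pose N1 : set C := [set z | nm (z - w) < e /\ exists2 x, chain K dl w x & nm (z - x) < dl / 2].
pose N2 : set C := [set z | exists2 x, K x /\ ~ chain K dl w x & nm (z - x) < dl / 2].
have dl20 : 0 < dl / 2 by rewrite divr_gt0.
have oN1 z : N1 z -> exists2 r : R, 0 < r & forall v, nm (v - z) < r -> N1 v.
  move=> [zw [x wx zx]]; exists (Num.min (e - nm (z - w)) (dl / 2 - nm (z - x))).
    by rewrite lt_min !subr_gt0 zw.
  move=> v; rewrite lt_min => /andP[v1 v2]; split.
    by have := nm_distD z v w; lra.
  by exists x => //; have := nm_distD z v x; lra.
have oN2 z : N2 z -> exists2 r : R, 0 < r & forall v, nm (v - z) < r -> N2 v.
  move=> [x xK zx]; exists (dl / 2 - nm (z - x)); first by rewrite subr_gt0.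
  by move=> v v2; exists x => //; have := nm_distD z v x; lra.
have N12 z : N1 z -> N2 z -> False.
  move=> [_ [x wx zx]] [y [Ky nwy] zy]; apply: nwy; apply: ChainS wx Ky _.
  by have := nm_distD z y x; rewrite (nm_distC y z); lra.
have KN : K `<=` N1 `|` N2.
  move=> x Kx; have [wx|nwx] := pselect (chain K dl w x); [left|right].
    by split; [exact: dlP|exists x; rewrite // subrr nm0].
  by exists x; rewrite // subrr nm0.
have oU : open (N1 `|` N2).
  apply/open_nmP => z [/oN1|/oN2] [r r0 rN]; exists r => // v /rN; by [left|right].
pose f z := if `[< N1 z >] then h z else 0.
have [|g hg gf] := @removable_extension _ K remK _ f (e + 1) oU KN.
  move=> z [N1z|N2z] nKz.
    have [hz hE] := hP z N1z.1 nKz; split.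
      have /derivable_cderP[d hd] := hz; apply/derivable_cderP; exists d.
      have [r r0 rN] := oN1 z N1z; apply: cder_near hd; exists r => // v /rN N1v.
      by rewrite /f asboolT.
    rewrite /f asboolT//; have : nm (h z) ^+ 2 < e by rewrite -nmX hE; case: N1z.
    by have := sqr_ge0 (nm (h z) - 1); have := nm_ge0 (h z); rewrite !expr2; nra.
  have nN1 v : N2 v -> f v = 0 by move=> N2v; rewrite /f asboolF// => /N12; apply.
  split; last by rewrite nN1// nm0 addr_ge0// ltW.
  apply/derivable_cderP; exists 0; have [r r0 rN] := oN2 z N2z.
  by apply: cder_near (cder_cst 0 z); exists r => // v /rN/nN1.
have N1w : N1 w by split; [|exists w; [exact: Chain0|]]; rewrite subrr nm0.
have [r r0 rN] := oN1 w N1w.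
have gE z : nm (z - w) < r -> g z ^+ 2 = z - w.
  move=> zr; have N1z := rN z zr.
  have rz0 : 0 < r - nm (z - w) by rewrite subr_gt0.
  apply: (@removable_dense _ K remK (fun z => g z ^+ 2) (fun z => z - w) z _ rz0).
  - by apply: contX; apply: derivable_cont; apply: hg; left.
  - exact: cont_subc.
  - move=> v vz nKv; have vr : nm (v - w) < r by have := nm_distD z v w; lra.
    have N1v := rN v vr; rewrite gf//; last by left.
    by rewrite /f asboolT//; have [] := hP v N1v.1 nKv.
have ww : nm (w - w) < r by rewrite subrr nm0.
have gw0 : g w = 0 by apply/eqP; rewrite -sqrf_eq0 gE// subrr.
have /derivable_cderP[d gd] := hg w (or_introl N1w).
have D1 := cderM gd gd; have D2 := cderB (cder_id w) (cder_cst w w).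
have D3 : cder (fun z => g z * g z) w (1 - 0).
  by apply: cder_near D2; exists r => // z /gE; rewrite expr2.
have := cder_unique D3 D1; rewrite gw0 mulr0 mul0r addr0 subr0 => /eqP.
by rewrite oner_eq0.
Qed.

(* If the disc image contained a punctured neighborhood of [w], a branch of
   [sqrt (z - w)] would live there. *)
Lemma disc_image_not_surrounding (f : C -> C) w (e : R) :
  holomorphic_on (@unit_disc R) f -> set_inj (@unit_disc R) f -> K w -> 0 < e ->
  (forall v, unit_disc v -> f v <> w) ->
  (forall z, nm (z - w) < e -> ~ K z -> exists2 v, unit_disc v & f v = z) -> False.
Proof.
move=> hf fi Kw e0 fw fon.
have discE : @unit_disc R = [set z | nm (z - 0) < 1].
  by apply/seteqP; split=> z; rewrite /= subr0 => /unit_discP.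
have scD : simply_connected (@unit_disc R) by rewrite discE; exact: simply_connected_ball.
have ballD v : unit_disc v -> exists2 r : R, 0 < r & forall u, nm (u - v) < r -> unit_disc u.
  move=> /unit_discP v1; exists (1 - nm v); first by rewrite subr_gt0.
  by move=> u uv; apply/unit_discP; have := nm_lerB u v; lra.
have oD : open (@unit_disc R) by apply/open_nmP => v /ballD.
have [||q qP] := @sqrt_branch _ (@unit_disc R) (fun v => f v - w) oD scD.
- by move=> v /hf/derivable_cont cf; apply: contB => //; exact: cont_cst.
- by move=> v /fw/eqP; rewrite subr_eq0.
have Hs z : exists v, (exists2 u, unit_disc u & f u = z) -> unit_disc v /\ f v = z.
  by have [[v vD fv]|no] := pselect (exists2 u, unit_disc u & f u = z); [exists v|exists 0].
have [fi' fiP] := choice Hs.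
have fiK v : unit_disc v -> fi' (f v) = v.
  move=> vD; have [|uD fu] := fiP (f v); first by exists v.
  by apply: fi fu; rewrite inE.
apply: (@no_local_sqrt w e (fun z => q (fi' z)) Kw e0) => z ze nKz.
have [v vD fv] := fon z ze nKz; rewrite -fv fiK//.
have hE u : unit_disc u -> q (fi' (f u)) ^+ 2 = f u - w by move=> uD; rewrite fiK//; have [] := qP u uD.
split; last by have [] := qP v vD.
have [r r0 rD] := ballD v vD.
have cfi : cont_at fi' (f v).
  by apply: (@inverse_cont _ f fi' v r r0) => u /rD; [exact: hf|exact: fiK].
have z0 : f v - w != 0 by rewrite subr_eq0; exact/eqP/fw.
have zw : f v != w by rewrite -subr_eq0.
have [k k0 kK] := off_compact remK.1 nKz.
have m0 : 0 < Num.min k (e - nm (z - w)) by rewrite lt_min k0 subr_gt0.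
have D2 := cderB (cder_id (f v)) (cder_cst w (f v)).
apply/derivable_cderP; eexists.
apply: (@sqrt_cder _ (fun z => z - w) (fun z => q (fi' z)) (f v) _ _ m0 _ _ _ D2).
- move=> x; rewrite fv lt_min => /andP[/kK nKx xe].
  have [|u uD fu] := fon x _ nKx; first by have := nm_distD z x w; lra.
  by rewrite -fu hE.
- by apply: cont_compC => //; rewrite fiK//; have [] := qP v vD.
- by rewrite -sqrf_eq0 hE.
Qed.

End simply_connected_hull.

(** * Monotonicity of the hyperbolic tangent *)

Section hyperbolic_tangent.
Variable R : realType.
Implicit Types x y r : R.

Lemma tanh_lt x y : x < y -> tanh x < tanh y.
Proof.
move=> xy; rewrite /tanh !expRN.
have u0 := expR_gt0 x; have v0 := expR_gt0 y.
have uv : expR x < expR y by rewrite ltr_expR.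
move: (expR x) (expR y) u0 v0 uv => u v u0 v0 uv.
have ui0 : 0 < u^-1 by rewrite invr_gt0. have vi0 : 0 < v^-1 by rewrite invr_gt0.
rewrite ltr_pdivrMr ?addr_gt0// mulrAC ltr_pdivlMr ?addr_gt0// -subr_gt0.
have -> : (v - v^-1) * (u + u^-1) - (u - u^-1) * (v + v^-1) = 2 * (v * u^-1 - u * v^-1) by ring.
rewrite mulr_gt0// subr_gt0 ltr_pdivrMr// mulrAC ltr_pdivlMr//.
by rewrite ltr_pM// ltW.
Qed.

Lemma tanh_le x y : x <= y -> tanh x <= tanh y.
Proof. by rewrite le_eqVlt => /orP[/eqP ->//|/tanh_lt/ltW]. Qed.

Lemma tanh_lt1 x : tanh x < 1.
Proof.
rewrite /tanh ltr_pdivrMr ?addr_gt0 ?expR_gt0// mul1r.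
by have := expR_gt0 (- x); lra.
Qed.

Lemma tanh0 : tanh (0 : R) = 0.
Proof. by rewrite /tanh oppr0 subrr mul0r. Qed.

Lemma tanh_ge0 x : 0 <= x -> 0 <= tanh x.
Proof. by move=> x0; rewrite -tanh0 tanh_le. Qed.

Lemma atanh_le x r : 0 <= x -> x < 1 -> (atanh x <= r) = (x <= tanh r).
Proof.
move=> x0 x1; have xE : tanh (atanh x) = x by rewrite atanhK// ger0_norm.
apply/idP/idP => [/tanh_le|xr]; first by rewrite xE.
by rewrite leNgt; apply/negP => /tanh_lt; rewrite xE ltNge xr.
Qed.

Lemma atanh_ge0 x : 0 <= x -> x < 1 -> 0 <= atanh x.
Proof.
move=> x0 x1; rewrite leNgt; apply/negP => /tanh_lt.
by rewrite atanhK ?ger0_norm// tanh0 ltNge x0.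
Qed.

End hyperbolic_tangent.

(** * The Caratheodory pseudodistance and its balls *)

Section caratheodory_distance.
Variable R : realType.
Local Notation C := R[i].
Implicit Types (G : set C) (f g : C -> C) (z w : C) (r : R).

Definition admissible G z f :=
  [/\ holomorphic_on G f, forall w, G w -> nm (f w) < 1 & f z = 0].

(** Trades the supremum in the extended reals for a bound on the moduli of all competitors, the form
    in which comparisons are made. *)
Lemma caratheodory_le G z w r : G w ->
  (caratheodory G z w <= r%:E)%E <-> forall f, admissible G z f -> nm (f w) <= tanh r.
Proof.
move=> Gw; split=> [cr f [hf f1 fz]|H].
  rewrite -atanh_le ?nm_ge0 ?f1// -lee_fin; apply: le_trans cr.
  apply: ereal_sup_ubound; exists f => //; split => //.
  by move=> _ [v Gv <-]; apply/unit_discP/f1.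
apply: ge_ereal_sup => _ [f [hf fG fz] <-].
have f1 v : G v -> nm (f v) < 1 by move=> Gv; apply/unit_discP/fG; exists v.
by rewrite lee_fin atanh_le ?nm_ge0 ?f1//; apply: H.
Qed.

Lemma admissible0 G z : admissible G z (fun=> 0).
Proof.
split=> [v _|v _|//]; last by rewrite nm0.
by apply/derivable_cderP; exists 0; exact: cder_cst.
Qed.

Lemma caratheodory_ge0 G z w : G w -> (0 <= caratheodory G z w)%E.
Proof.
move=> Gw; apply: ereal_sup_ubound; exists (fun=> 0).
  have [h0 _ _] := admissible0 G z; split => //.
  by move=> _ [v _ <-]; apply/unit_discP; rewrite nm0.
rewrite -[Normc.normc _]/(nm 0) nm0; congr EFin; apply/eqP; rewrite eq_le atanh_ge0// andbT.
by rewrite atanh_le// tanh0.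
Qed.

(** A strict inequality leaves room between [k] and [tanh r], uniformly in the competitor; this room
    is spent on moving [w]. *)
Lemma caratheodory_lt G z w r : G w -> (caratheodory G z w < r%:E)%E ->
  exists2 k, 0 <= k < tanh r & forall f, admissible G z f -> nm (f w) <= k.
Proof.
move=> Gw; have := caratheodory_ge0 z Gw.
case E : (caratheodory G z w) => [s| |]//; rewrite lee_fin lte_fin => s0 sr.
exists (tanh s); first by rewrite tanh_ge0//= tanh_lt.
by apply/caratheodory_le => //; rewrite E.
Qed.

Lemma lt_caratheodory G z w r (k : R) : G w -> 0 <= k < tanh r ->
  (forall f, admissible G z f -> nm (f w) <= k) -> (caratheodory G z w < r%:E)%E.
Proof.
move=> Gw /andP[k0 kr] H; have k1 : k < 1 := lt_trans kr (tanh_lt1 r).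
have kE : tanh (atanh k) = k by rewrite atanhK// ger0_norm.
apply: (@le_lt_trans _ _ (atanh k)%:E).
  by apply/caratheodory_le => // f /H; rewrite kE.
by rewrite lte_fin ltNge; apply/negP => /tanh_le; rewrite kE leNgt kr.
Qed.

(** Equicontinuity: [e] does not depend on [g], since functions bounded by 1 on a ball of radius
    [rho] share the Lipschitz constant [8 / rho] near its center. *)
Lemma uniform_growth (k k' rho : R) : k < k' -> 0 < rho -> exists2 e : R, 0 < e &
  forall (g : C -> C) w, holo_ball g w rho -> (forall v, nm (v - w) < rho -> nm (g v) <= 1) ->
  nm (g w) <= k -> forall v, nm (v - w) < e -> nm (g v) <= k'.
Proof.
move=> kk' rho0; have e0 : 0 < (k' - k) * rho / 8 by rewrite divr_gt0// mulr_gt0// subr_gt0.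
exists (Num.min (rho / 4) ((k' - k) * rho / 8)); first by rewrite lt_min e0 divr_gt0.
move=> g w hg g1 gw v; rewrite lt_min => /andP[v1 v2].
have w0 : nm (w - w) < rho / 4 by rewrite subrr nm0 divr_gt0.
have L := bounded_holo_lipschitz rho0 hg g1 v1 w0.
have : 8 * 1 / rho * nm (v - w) <= k' - k.
  rewrite mulr1 mulrAC ler_pdivrMr//; lra.
by have := nm_lerB (g v) (g w); lra.
Qed.

Lemma caratheodory_ball_open G z r : open G -> open (caratheodory_ball G z r).
Proof.
move=> oG; apply/open_nmP => w [Gw cw]; have [k /andP[k0 kr] kH] := caratheodory_lt Gw cw.
have [rho rho0 rhoG] := (open_nmP G).1 oG w Gw.
pose k' := (k + tanh r) / 2; have kk' : k < k' by rewrite /k'; lra.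
have k'r : k' < tanh r by rewrite /k'; lra.
have [e e0 eH] := uniform_growth kk' rho0.
exists (Num.min e rho); first by rewrite lt_min e0.
move=> v; rewrite lt_min => /andP[ve /rhoG Gv]; split => //.
apply: (@lt_caratheodory _ _ _ _ k') => //; first by rewrite k'r andbT; lra.
move=> f af; have [hf f1 _] := af; apply: (eH f w) => //; last exact: kH.
  by move=> u /rhoG; exact: hf.
by move=> u /rhoG/f1/ltW.
Qed.

Lemma caratheodory_ball_center G z r : G z -> 0 < r -> caratheodory_ball G z r z.
Proof.
move=> Gz r0; split => //; apply: (@lt_caratheodory _ _ _ _ 0) => //.
  by rewrite lexx -tanh0 tanh_lt.
by move=> f [_ _ ->]; rewrite nm0.
Qed.

(** Continuity across [K] only gives modulus at most 1 for the extension; scaled by [t < 1] it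
    becomes a competitor on [Omega], which yields the bound at [w], even for [w] in [K]. *)
Lemma admissible_extension (Omega K : set C) z w f (k : R) : open Omega -> removable K ->
  K `<=` Omega -> (Omega `\` K) z -> Omega w ->
  (forall g, admissible Omega z g -> nm (g w) <= k) -> admissible (Omega `\` K) z f ->
  exists g, [/\ forall v, Omega v -> derivable g v 1, forall v, Omega v -> nm (g v) <= 1,
    nm (g w) <= k & forall v, Omega v -> ~ K v -> g v = f v].
Proof.
move=> oO remK KO [Oz nKz] Ow H [hf f1 fz].
have [|g hg gf] := @removable_extension _ K remK Omega f 1 oO KO.
  by move=> v Ov nKv; split; [exact: hf|exact/ltW/f1].
have g1 v : Omega v -> nm (g v) <= 1.
  move=> Ov; rewrite leNgt; apply/negP => gv.
  have e0 : 0 < nm (g v) - 1 by rewrite subr_gt0.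
  have /continuous_nmP/(_ _ e0)[d d0 dH] := derivable_cont (hg v Ov).
  have [r r0 rO] := (open_nmP _).1 oO v Ov.
  have m0 : 0 < Num.min d r by rewrite lt_min d0.
  have [u] := removable_no_interior remK v m0; rewrite lt_min => /andP[/dH ud /rO Ou] nKu.
  have : nm (f u) < 1 by exact: f1.
  by rewrite -gf//; have := nm_lerB (g v) (g u); rewrite nm_distC; lra.
exists g; split => //; rewrite leNgt; apply/negP => kg.
have gw0 : 0 < nm (g w) + 1 by rewrite ltr_wpDl// nm_ge0.
have [t /andP[t0 t1] kt] : exists2 t : R, 0 < t < 1 & k < t * nm (g w).
  have k0 : 0 <= k.
    by apply: le_trans (nm_ge0 _) (H _ (admissible0 Omega z)).
  have gp : 0 < nm (g w) by exact: le_lt_trans kg.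
  (* Chosen so that [t * nm (g w)] is halfway between [k] and [nm (g w)]. *)
  exists ((k + nm (g w)) / 2 / nm (g w)).
    rewrite !divr_gt0 ?addr_ge0//=; last by rewrite ltr_wpDl.
    by rewrite ltr_pdivrMr// mul1r; lra.
  by rewrite divfK ?gt_eqF//; lra.
have : nm (t%:C * g w) <= k.
  apply: (H (fun v => t%:C * g v)); split.
  - move=> v Ov; have /derivable_cderP[d gd] := hg v Ov.
    by apply/derivable_cderP; eexists; apply: cderM; [exact: cder_cst|exact: gd].
  - move=> v Ov; rewrite nmM nm_real gtr0_norm//; apply: le_lt_trans t1.
    by rewrite ler_piMr// ?g1// ltW.
  - by rewrite gf// fz mulr0.
by rewrite nmM nm_real gtr0_norm// leNgt kt.
Qed.

End caratheodory_distance.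

(** * The two inequalities and the attained minimum *)

Section fridman_invariant_bounds.
Variable R : realType.
Local Notation C := R[i].
Implicit Types (G Omega K : set C) (z w : C).

Lemma injectivity_radius_le_fridman G z : open G -> G z -> (exists w, ~ G w) ->
  (injectivity_radius G z <= fridman_invariant G z)%E.
Proof.
move=> oG Gz [w nGw]; apply: le_ereal_sup => _ [r [r0 scB] <-]; exists r => //; split => //.
have [|f [hf fi fB]] := riemann_mapping (@caratheodory_ball_open _ G z r oG) scB
  (caratheodory_ball_center Gz r0); first by exists w => -[].
by exists f; split => //; rewrite fB// => v [].
Qed.

Lemma fridman_le_caratheodory Omega K z w : open Omega -> removable K -> K `<=` Omega ->
  (Omega `\` K) z -> K w ->
  (fridman_invariant (Omega `\` K) z <= etanh (caratheodory Omega z w))%E.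
Proof.
move=> oO remK KO Dz Kw; have Ow := KO w Kw.
apply: ge_ereal_sup => _ [r [r0 [f [hf fi fD Bf]]] <-].
have := caratheodory_ge0 z Ow.
case E : (caratheodory Omega z w) => [s| |]//= _; last by rewrite lee_fin ltW// tanh_lt1.
rewrite lee_fin leNgt; apply/negP => sr.
have cs : (caratheodory Omega z w < r%:E)%E.
  by rewrite E lte_fin ltNge; apply/negP => /tanh_le; rewrite leNgt sr.
have [k /andP[k0 kr] kH] := caratheodory_lt Ow cs.
have [rho rho0 rhoO] := (open_nmP _).1 oO w Ow.
pose k' := (k + tanh r) / 2; have kk' : k < k' by rewrite /k'; lra.
have k'r : k' < tanh r by rewrite /k'; lra.
have [e e0 eH] := uniform_growth kk' rho0.
have m0 : 0 < Num.min e rho by rewrite lt_min e0.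
apply: (@disc_image_not_surrounding _ K remK f w _ hf fi Kw m0).
  by move=> v vD fv; have [_] : (Omega `\` K) (f v) by [apply: fD; exists v]; rewrite fv.
move=> v; rewrite lt_min => /andP[ve /rhoO Ov] nKv.
have /Bf[u uD fu] : caratheodory_ball (Omega `\` K) z r v; last by exists u.
split=> //; apply: (@lt_caratheodory _ _ _ _ _ k') => //; first by rewrite k'r andbT; lra.
move=> h ah; have [g [hg g1 gw gh]] := admissible_extension oO remK KO Dz Ow kH ah.
by rewrite -gh//; apply: (eH g w) => // u /rhoO; [exact: hg|exact: g1].
Qed.

(* A supremum of continuous functions is lower semicontinuous. *)
Lemma caratheodory_min Omega K z : compact K -> K !=set0 -> K `<=` Omega ->
  exists2 w0, K w0 & forall w, K w ->
    (etanh (caratheodory Omega z w0) <= etanh (caratheodory Omega z w))%E.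
Proof.
move=> cK [p Kp] KO.
(* [x] is the least upper bound of the moduli at [w] of the competitors; this covers infinite
   distance, with [x = 1], and moves the minimization into the reals. *)
pose P w (x : R) := [/\ etanh (caratheodory Omega z w) = x%:E, 0 <= x,
  forall f, admissible Omega z f -> nm (f w) <= x &
  forall k, (forall f, admissible Omega z f -> nm (f w) <= k) -> x <= k].
have exP w : exists x, K w -> P w x.
  have [Kw|] := pselect (K w); last by exists 0.
  suff [x Px] : exists x, P w x by exists x.
  have Ow := KO w Kw; have := caratheodory_ge0 z Ow.
  have kneg k : (forall f, admissible Omega z f -> nm (f w) <= k) -> 0 <= k.
    by move=> /(_ _ (admissible0 Omega z)); rewrite nm0.
  case E : (caratheodory Omega z w) => [s| |]//= s0.
    exists (tanh s); rewrite /P E; split => //; first by rewrite tanh_ge0.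
      by apply/caratheodory_le => //; rewrite E.
    move=> k kH; have [k1|k1] := leP 1 k; first by apply: le_trans k1; rewrite ltW// tanh_lt1.
    have kE : tanh (atanh k) = k by rewrite atanhK// ger0_norm// kneg.
    rewrite -kE tanh_le// -lee_fin -E; apply/caratheodory_le => // f /kH.
    by rewrite kE.
  exists 1; rewrite /P E; split => //; first by move=> f [_ f1 _]; exact/ltW/f1.
  move=> k kH; rewrite leNgt; apply/negP => k1.
  have : (caratheodory Omega z w <= (atanh k)%:E)%E.
    by apply/caratheodory_le => // f /kH; rewrite atanhK// ger0_norm// kneg.
  by rewrite E.
have [t tP] := choice exP.
pose E := [set t w | w in K].
have infE : has_inf E.
  by split; [exists (t p), p|exists 0 => _ [w Kw <-]; have [_ ] := tP w Kw].
have Hn (n : nat) : exists w, K w /\ t w < inf E + n.+1%:R^-1.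
  have e0 : (0 : R) < n.+1%:R^-1 by rewrite invr_gt0.
  by have [_ [w Kw <-] lt] := inf_adherent e0 infE; exists w.
have [x xP] := choice Hn.
have [U [UU UF UFf Uinf]] := ultra_nat.
have [M M0 KM] := compact_nm_bounded cK.
have [|w0 xw0] := @ultra_cvg _ _ U UU x M.
  by apply: Uinf; exists 0%N => n _ /=; apply: KM; have [] := xP n.
have Kw0 : K w0.
  apply: contrapT => nK; have [r r0 rK] := off_compact cK nK.
  move/cvg_nmP : xw0 => /(_ _ r0) xw0; have [n /= xn] := filter_ex xw0.
  by apply: (rK _ xn); have [] := xP n.
exists w0 => // w Kw; have [-> _ _ tmin] := tP w0 Kw0; have [-> _ _ _] := tP w Kw.
rewrite lee_fin; apply: (@le_trans _ _ (inf E)); last first.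
  by apply: inf_lbound; [have [] := infE|exists w].
apply: tmin => f af; have [hf _ _] := af.
have cf : cont_at f w0 by apply/derivable_cont/hf/KO.
apply/ler_addgt0Pl => e e0; have e20 : 0 < e / 2 by rewrite divr_gt0.
have /continuous_nmP/(_ _ e20)[d d0 dH] := cf.
move/cvg_nmP : xw0 => /(_ _ d0) xw0.
have Un : U [set n : nat | n.+1%:R^-1 < e / 2] by apply: Uinf; exact: invS_small.
have [n [/= /dH xn ne]] := filter_ex (filterI xw0 Un).
have [Kxn txn] := xP n; have [_ _ /(_ f af) fx _] := tP _ Kxn.
move: (n.+1%:R^-1) ne txn => i ne txn.
by have := nm_lerB (f w0) (f (x n)); rewrite nm_distC; lra.
Qed.

End fridman_invariant_bounds.

(** The minimum is expressed by a point [w0] of [K] that attains it; [etanh] gives a meaning to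
    every value of the extended-real pseudodistance. *)
Theorem theorem1p4 (R : realType) (Omega K : set R[i])
  (hOmega : domain Omega) (hK0 : K !=set0) (hK : removable K)
  (hKO : K `<=` Omega) (hD : c_hyperbolic (Omega `\` K))
  (z : R[i]) (hz : (Omega `\` K) z) :
  (injectivity_radius (Omega `\` K) z <= fridman_invariant (Omega `\` K) z)%E /\
  exists w0 : R[i], [/\ K w0,
    forall w, K w ->
      (etanh (caratheodory Omega z w0) <= etanh (caratheodory Omega z w))%E &
    (fridman_invariant (Omega `\` K) z <= etanh (caratheodory Omega z w0))%E].
Proof.
have [oO _ _] := hOmega; have [p Kp] := hK0; have cK := hK.1.
have oD : open (Omega `\` K).
  apply/open_nmP => w [Ow nKw]; have [r r0 rO] := (open_nmP _).1 oO w Ow.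
  have [s s0 sK] := off_compact cK nKw; exists (Num.min r s); first by rewrite lt_min r0.
  by move=> v; rewrite lt_min => /andP[/rO ? /sK].
(* A point of [K] is missing from the domain, so the balls are proper subsets of the plane, as the
   Riemann mapping theorem requires. *)
split; first by apply: injectivity_radius_le_fridman => //; exists p => -[].
have [w0 Kw0 w0min] := caratheodory_min z cK hK0 hKO.
by exists w0; split => //; exact: fridman_le_caratheodory.
Qed.
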